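(* Let $A=\{1,\ldots,s\}$ and let $P$ be an attractive regular probability kernel on $A$. Let ${\bf X}^{\max}$ be the maximum phase of $P$. Then the following three assertions are equivalent: (1) There exists a unique stationary chain compatible with $P$. (2) ${\bf X}^{\max}$ is a finitary coding of a countable alphabet i.i.d. process. (3) The concentration of measure holds at exponential rate for ${\bf X}^{\max}$.
   Context: Notation. $A=\{1,2,\ldots,s\}$ is a finite ordered set. A past is a sequence $\underline{x}=x_{-1}x_{-2}\ldots\in A^{-\mathbb{N}}$; past symbols are written to the right, so $a_{-k}^{-1}=a_{-1}\ldots a_{-k}$ and $a_{-k}^{-1}\underline{x}$ is the past obtained by concatenation, whose most recent symbols are $a_{-1},\ldots,a_{-k}$. Pasts are partially ordered by $\underline{x}\le\underline{y}$ iff $x_{-i}\le y_{-i}$ for all $i\ge 1$; the maximal past is $\underline{s}=sss\ldots$. Kernels. A probability kernel on $A$ is a function $P:A\times A^{-\mathbb{N}}\to[0,1]$, $(a,\underline{x})\mapsto P(a|\underline{x})$, with $\sum_{a\in A}P(a|\underline{x})=1$ for all $\underline{x}$. It is strongly non-null if $\inf_{a,\underline{x}}P(a|\underline{x})>0$. It is continuous if $\mathrm{var}_k:=\sup_{b\in A}\sup_{a_{-k}^{-1}}\sup_{\underline{x},\underline{y}}|P(b|a_{-k}^{-1}\underline{x})-P(b|a_{-k}^{-1}\underline{y})|\to0$ as $k\to\infty$. It is regular if it is strongly non-null and continuous. It is attractive if for every $a\in A$ the map $\underline{x}\mapsto\sum_{j\ge a}P(j|\underline{x})$ is increasing (i.e.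 non-decreasing) with respect to the partial order on pasts. Compatibility and uniqueness. A stationary chain ${\bf X}=\{X_j\}_{j\in\mathbb{Z}}$ on $A$ with law $\mu$ is compatible with $P$ if $\mu(X_0=a|X_{-\infty}^{-1}=\underline{x})=P(a|\underline{x})$ for every $a\in A$ and $\mu$-a.e. $\underline{x}$. Uniqueness refers to the law of the stationary chain. Maximum phase. For a past $\underline{x}$, the fixed past chain ${\bf X}^{\underline{x}}$ has $(X^{\underline{x}}_0,X^{\underline{x}}_{-1},\ldots)=\underline{x}$ deterministically, and for $n\ge1$, $X_n^{\underline{x}}=a$ with probability $P(a|X^{\underline{x}}_{n-1}\ldots X_1^{\underline{x}}\underline{x})$ given $X^{\underline{x}}_{n-1},\ldots,X^{\underline{x}}_1$. Let $X^{\underline{x},j}_n=X^{\underline{x}}_{n+j}$. For attractive $P$ the weak limit ${\bf X}^{\max}:=\lim_{j\to\infty}{\bf X}^{\underline{s},j}$ exists and is stationary. Finitary coding. Let ${\bf U}=\{U_i\}_{i\in\mathbb{Z}}$ be an i.i.d. process with values in a set $\mathcal{U}$ and law $\mathbb{P}$. A stationary process ${\bf X}$ on $A$ with law $\mu$ is a finitary coding of ${\bf U}$ if there is a measurable $\Phi:\mathcal{U}^{\mathbb{Z}}\to A^{\mathbb{Z}}$ commuting with the shifts, with $\mu=\mathbb{P}\circ\Phi^{-1}$, and there are $\mathbb{P}$-a.s. finite $\theta_1,\theta_2:\mathcal{U}^{\mathbb{Z}}\to\mathbb{N}\cup\{\infty\}$ ($0$ allowed) such that $\{\theta_1({\bf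 U})=k\}\cap\{\theta_2({\bf U})=l\}$ is measurable with respect to $\sigma(U_{-k},\ldots,U_l)$ for all finite $k,l$, and $[\Phi({\bf U})]_0=[\Phi({\bf V})]_0$ whenever ${\bf U}$ and ${\bf V}$ agree on all coordinates from $-\theta_1({\bf U})$ to $\theta_2({\bf U})$. It is a finitary coding of a countable alphabet i.i.d. process if $\mathcal{U}$ can be taken countable. Exponential concentration. For $f:A^n\to\mathbb{R}$ let $\delta_jf=\sup\{|f(a_1^n)-f(b_1^n)|:a_i=b_i\ \forall i\ne j\}$, and let $\delta f=(\delta_1f,\ldots,\delta_nf)$, with $\|\delta f\|_{\ell_1(\mathbb{N})}=\sum_j\delta_jf$ and $\|\delta f\|_{\ell_2(\mathbb{N})}^2=\sum_j(\delta_jf)^2$. The concentration of measure holds at exponential rate for a stationary process ${\bf X}$ if there are a constant $C$ and a strictly positive function $g$ of two variables such that for all $n>0$, $\epsilon>0$ and all (non-constant) $f:A^n\to\mathbb{R}$, $$\mathbb{P}\left(|f(X_1^n)-\mathbb{E}[f(X_1^n)]|>\epsilon\right)\le C\exp\left\{-\frac{g(\epsilon,\|\delta f\|_{\ell_1(\mathbb{N})})}{\|\delta f\|^2_{\ell_2(\mathbb{N})}}\right\}.$$ *)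

(* Defs.v *)
From HB Require Import structures.
From mathcomp Require Import all_boot all_order all_algebra.
From mathcomp Require Import all_classical all_reals all_analysis.

Set Implicit Arguments.
Unset Strict Implicit.
Unset Printing Implicit Defensive.

Import Order.TTheory GRing.Theory Num.Theory.
Import numFieldNormedType.Exports.

Local Open Scope classical_set_scope.
Local Open Scope ring_scope.

(* The alphabet A = {1, ..., s}, s >= 1, is 'I_m.+1 with s = m + 1: the
   ordinal k stands for the letter k + 1, and the maximal letter s is ord_max.
   It carries the discrete sigma-algebra. *)
HB.instance Definition _ (m : nat) := isPointed.Build 'I_m.+1 ord0.

HB.instance Definition _ (m : nat) :=
  @isMeasurable.Build default_measure_display 'I_m.+1
    discrete_measurable discrete_measurable0
    discrete_measurableC discrete_measurableU.

Section sequence_spaces.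
Context d (V : measurableType d).

Definition coord_sets (I : Type) (J : set I) : set (set (I -> V)) :=
  \bigcup_(i in J) preimage_set_system setT (fun x : I -> V => x i) measurable.

(* V^I with the product sigma-algebra *)
Definition seq_space (I : Type) := g_sigma_algebraType (@coord_sets I setT).

Definition shift_seq (x : int -> V) : int -> V := fun n => x (n + 1).

Definition stationary (R : realType) (mu : probability (seq_space int) R) :=
  forall E : set (seq_space int), measurable E -> mu (shift_seq @^-1` E) = mu E.

Definition iid (R : realType) (mu : probability (seq_space int) R) :=
  (forall (J : seq int) (B : int -> set V), uniq J ->
     (forall j, measurable (B j)) ->
     mu [set x | forall j, j \in J -> B j (x j)] =
       (\prod_(j <- J) mu [set x | B j (x j)])%E) /\
  (forall (i j : int) (B : set V), measurable B ->
     mu [set x | B (x i)] = mu [set x | B (x j)]).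

End sequence_spaces.
Arguments coord_sets {d V I} J.
Arguments seq_space {d} V I.

Section kernels.
Context (R : realType) (m : nat).

(* In a past x : nat -> 'I_m.+1, the entry x i is the symbol x_{-(i+1)}. *)
Notation past := (nat -> 'I_m.+1).

(* The past a_{-k}^{-1} x, with w = (a_{-1}, ..., a_{-k}). *)
Definition prepend (k : nat) (w : k.-tuple 'I_m.+1) (x : past) : past :=
  fun i => if (i < k)%N then nth ord0 w i else x (i - k)%N.

Definition past_le (x y : past) := forall i, (x i <= y i)%N.

Definition max_past : past := fun=> ord_max.

Variable P : 'I_m.+1 -> past -> R.

Definition is_prob_kernel :=
  (forall a x, 0 <= P a x <= 1) /\ (forall x, \sum_a P a x = 1).

Definition strongly_nonnull := 0 < inf (range (fun ax => P ax.1 ax.2)).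

Definition variation (k : nat) : R :=
  sup [set r | exists (b : 'I_m.+1) (w : k.-tuple 'I_m.+1) (x y : past),
                 r = `|P b (prepend w x) - P b (prepend w y)|].

Definition continuous_kernel := variation @ \oo --> (0 : R).

Definition regular_kernel := strongly_nonnull /\ continuous_kernel.

Definition attractive :=
  forall (a : 'I_m.+1) (x y : past), past_le x y ->
    \sum_(j : 'I_m.+1 | (a <= j)%N) P j x <= \sum_(j : 'I_m.+1 | (a <= j)%N) P j y.

Notation law := (probability (seq_space 'I_m.+1 int) R).

Definition past_of (x : int -> 'I_m.+1) : past := fun i => x (- (i.+1)%:Z).

(* Q is a version of the conditional probability x |-> mu(X_0 = a | past x). *)
Definition cond_prob_version (mu : law) (a : 'I_m.+1) (Q : past -> R) :=
  measurable_fun setT (Q : seq_space 'I_m.+1 nat -> R) /\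
  mu.-integrable setT (fun x => (Q (past_of x))%:E) /\
  forall B : set (seq_space 'I_m.+1 nat), measurable B ->
    mu [set x | x 0 = a /\ B (past_of x)] =
      (\int[mu]_(x in [set x | B (past_of x)]) (Q (past_of x))%:E)%E.

Definition compatible (mu : law) :=
  forall a : 'I_m.+1, exists Q : past -> R,
    cond_prob_version mu a Q /\
    {ae mu, forall x, Q (past_of x) = P a (past_of x)}.

(* Measures are only constrained on measurable sets, so two laws are identified
   when they agree on these. *)
Definition unique_compatible_chain :=
  exists mu : law, (stationary mu /\ compatible mu) /\
    forall nu : law, stationary nu -> compatible nu ->
      forall E : set (seq_space 'I_m.+1 int), measurable E -> nu E = mu E.

(* nu is the law of the chain X^x started from the past x = X_0 X_{-1} ...;
   w lists X_k, ..., X_1, most recent symbol first. *)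
Definition fixed_past_chain (x : past) (nu : law) :=
  {ae nu, forall y, forall i : nat, y (- i%:Z) = x i} /\
  forall (k : nat) (w : k.-tuple 'I_m.+1) (a : 'I_m.+1),
    let history := [set y : int -> 'I_m.+1 |
                     forall i : 'I_k, y (k%:Z - i%:Z) = tnth w i] in
    nu (history `&` [set y | y (k.+1)%:Z = a]) =
      (nu history * (P a (prepend w x))%:E)%E.

(* Weak convergence for the product of the discrete topologies. *)
Definition weak_limit_of_shifts (nu mu : law) :=
  forall f : (int -> 'I_m.+1) -> R,
    continuous (f : {ptws int -> discrete_topology 'I_m.+1} -> R) ->
    (exists M : R, forall x, `|f x| <= M) ->
    ('E_nu[fun x => f (iter j (@shift_seq _ _) x)] @[j --> \oo] --> 'E_mu[f])%E.

Definition maximum_phase (mu : law) :=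
  exists nu : law, fixed_past_chain max_past nu /\ weak_limit_of_shifts nu mu.

End kernels.

Section finitary.
Context (R : realType) (m : nat).
Notation law := (probability (seq_space 'I_m.+1 int) R).

(* Coordinates from - t1 to t2, None standing for an infinite value. *)
Definition in_window (t1 t2 : option nat) (i : int) : bool :=
  (if t1 is Some k then - k%:Z <= i else true) &&
  (if t2 is Some l then i <= l%:Z else true).

Definition finitary_coding_of d (U : measurableType d)
    (PU : probability (seq_space U int) R) (mu : law) :=
  exists (Phi : (int -> U) -> (int -> 'I_m.+1))
         (theta1 theta2 : (int -> U) -> option nat),
  [/\ measurable_fun setT (Phi : seq_space U int -> seq_space 'I_m.+1 int),
      forall u, Phi (shift_seq u) = shift_seq (Phi u),
      forall E : set (seq_space 'I_m.+1 int), measurable E ->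
        mu E = PU (Phi @^-1` E),
      {ae PU, forall u, theta1 u <> None /\ theta2 u <> None} &
      (forall k l : nat,
        <<s coord_sets [set i : int | - k%:Z <= i <= l%:Z] >>
          [set u | theta1 u = Some k /\ theta2 u = Some l]) /\
      (forall u v : int -> U,
        (forall i, in_window (theta1 u) (theta2 u) i -> u i = v i) ->
        Phi u 0 = Phi v 0)].

Definition finitary_coding_countable_iid (mu : law) :=
  exists (d : measure_display) (U : measurableType d)
         (PU : probability (seq_space U int) R),
  [/\ countable [set: U], (forall B : set U, measurable B), iid PU &
      finitary_coding_of PU mu].

End finitary.

Section concentration.
Context (R : realType) (m : nat).
Notation law := (probability (seq_space 'I_m.+1 int) R).

Definition osc (n : nat) (f : n.-tuple 'I_m.+1 -> R) (j : 'I_n) : R :=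
  sup [set r | exists a b : n.-tuple 'I_m.+1,
    (forall i, i != j -> tnth a i = tnth b i) /\ r = `|f a - f b|].

Definition osc_l1 n (f : n.-tuple 'I_m.+1 -> R) : R := \sum_j osc f j.

Definition osc_l2_sq n (f : n.-tuple 'I_m.+1 -> R) : R := \sum_j osc f j ^+ 2.

(* The block X_1^n of a bi-infinite sequence. *)
Definition block (n : nat) (x : int -> 'I_m.+1) : n.-tuple 'I_m.+1 :=
  [tuple x (i.+1)%:Z | i < n].

Definition exponential_concentration (mu : law) :=
  exists (C : R) (g : R -> R -> R),
  (forall e l : R, 0 < e -> 0 < l -> 0 < g e l) /\
  forall (n : nat) (e : R) (f : n.-tuple 'I_m.+1 -> R),
    (0 < n)%N -> 0 < e -> (exists a b, f a <> f b) ->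
    (mu [set x | (e < `|f (block n x) - fine 'E_mu[f \o block n]%E|)%R] <=
      (C * expR (- (g e (osc_l1 f) / osc_l2_sq f)))%:E)%E.

End concentration.

(* Main.v *)
From HB Require Import structures.
From mathcomp Require Import all_boot all_order all_algebra.
From mathcomp Require Import all_classical all_reals all_analysis.
From mathcomp Require Import measurable_realfun ring lra zify.
Require Import Defs.

(* (1) => (2). Give every site an i.i.d. symbol made of finitely many fair bits,
   the number of bits having infinite mean. A site reads one bit from each
   sufficiently long symbol to its left, which determines nested dyadic
   intervals shrinking to a uniform variable. Running the chain from the distant
   past, with the maximal past and left endpoints, or with the minimal past and
   right endpoints, yields by attractiveness two monotone approximations: from
   above and from below. Both stabilise, and both limits have a stationary
   compatible law. Under uniqueness the two limits, being ordered with equal laws,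
   agree almost surely; hence the two approximations meet after finitely many
   steps, and from then on the value of the coding is determined.

   (2) => (3). Replacing the coding by one with windows of radius at most k changes
   each letter with probability p k, which tends to 0. The truncated function, and
   the sum of the errors weighted by the oscillations, both depend on i.i.d.
   symbols with bounded differences, so McDiarmid's inequality applies to both.

   (3) => (1). Let mu be the maximum phase and nu another compatible stationary law.
   By regularity the ratio of their densities on words of length n grows
   subexponentially, whereas mu gives exponentially small mass to the words on
   which an empirical average is far from its mu-mean. So nu gives them small mass
   too, and by stationarity the two means agree. *)

Set Implicit Arguments.
Unset Strict Implicit.
Unset Printing Implicit Defensive.

Import Order.TTheory GRing.Theory Num.Theory.
Import numFieldNormedType.Exports.

Local Open Scope classical_set_scope.
Local Open Scope ring_scope.

(** * Means of bounded functions *)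

(** With one uniform variable per site (1) => (2) would be a plain coupling from the past, but the
    alphabet must be countable: a site owns only finitely many bits and has to borrow the others
    from symbols further left. It finds a bit at lag [r] with probability 2/(r+2). The divergence of
    this series, which is the infinite mean of the number of bits, is what makes the intervals
    shrink, and with this choice the mean width after [n] lags is exactly 1/(n+1). Compatibility of
    the two limits uses only this mean width.

    The bits borrowed for site 0 lie in symbols that earlier sites also read, though at other ranks.
    Independence is therefore expressed bit by bit, through the invariance of the law under flipping
    one bit.

    In (2) => (3) the truncation radius is chosen from [e] and the total oscillation alone, as the
    form of [g] demands. In (3) => (1) nothing is known of how [g] varies with its second argument,
    so functions are first rescaled to total oscillation 1. *)

Section mean.
Context d (T : measurableType d) (R : realType).
Implicit Types (P Q : probability T R) (f g : T -> R) (A : set T).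

Definition mean P f : R := \int[P]_x f x.

Definition bounded_mfun f :=
  measurable_fun setT f /\ exists M, forall x, `|f x| <= M.

Lemma bounded_mfun_integrable P f : bounded_mfun f -> P.-integrable setT (EFin \o f).
Proof.
move=> [mf [M fM]]; apply: measurable_bounded_integrable => //.
  by rewrite (le_lt_trans (probability_le1 P measurableT))// ltry.
exists M; split; rewrite ?num_real // => x Mx y _ /=.
by rewrite (le_trans (fM y))// ltW.
Qed.

Lemma bounded_mfun_cst r : bounded_mfun (fun=> r).
Proof. by split; [exact: measurable_cst|exists `|r|]. Qed.

Lemma bounded_mfunD f g : bounded_mfun f -> bounded_mfun g ->
  bounded_mfun (fun x => f x + g x).
Proof.
move=> [mf [M fM]] [mg [N gN]]; split; first exact: measurable_funD.
by exists (M + N) => x; rewrite (le_trans (ler_normD _ _))// lerD.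
Qed.

Lemma bounded_mfunM f g : bounded_mfun f -> bounded_mfun g ->
  bounded_mfun (fun x => f x * g x).
Proof.
move=> [mf [M fM]] [mg [N gN]]; split; first exact: measurable_funM.
by exists (M * N) => x; rewrite normrM ler_pM.
Qed.

Lemma bounded_mfunZ r f : bounded_mfun f -> bounded_mfun (fun x => r * f x).
Proof. by move=> bf; apply: bounded_mfunM => //; exact: bounded_mfun_cst. Qed.

Lemma bounded_mfunB f g : bounded_mfun f -> bounded_mfun g ->
  bounded_mfun (fun x => f x - g x).
Proof.
move=> [mf [M fM]] [mg [N gN]]; split; first exact: measurable_funB.
by exists (M + N) => x; rewrite (le_trans (ler_normB _ _))// lerD.
Qed.

Lemma bounded_mfun_sum (I : Type) (s : seq I) (h : I -> T -> R) :
  (forall i, bounded_mfun (h i)) -> bounded_mfun (fun x => \sum_(i <- s) h i x).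
Proof.
move=> bh; elim: s => [|i s IH].
  by under eq_fun do rewrite big_nil; exact: bounded_mfun_cst.
by under eq_fun do rewrite big_cons; exact: bounded_mfunD.
Qed.

Lemma bounded_mfun_indic A : measurable A -> bounded_mfun (\1_A : T -> R).
Proof.
move=> mA; split; first exact: measurable_indic.
by exists 1 => x; rewrite indicE; case: (_ \in _); rewrite ?normr0 ?normr1.
Qed.

Lemma bounded_mfun_expR f : bounded_mfun f -> bounded_mfun (fun x => expR (f x)).
Proof.
move=> [mf [M fM]]; split; first exact: measurableT_comp.
exists (expR M) => x; rewrite ger0_norm ?expR_ge0// ler_expR.
by rewrite (le_trans (ler_norm _)).
Qed.

Lemma bounded_mfun_norm f : bounded_mfun f -> bounded_mfun (fun x => `|f x|).
Proof.
move=> [mf [M fM]]; split; first exact: measurableT_comp.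
by exists M => x; rewrite normr_id.
Qed.

Lemma mean_cst P r : mean P (fun=> r) = r.
Proof.
rewrite /mean Rintegral_cst//.
by rewrite [X in fine X](probability_setT P) mulr1.
Qed.

Lemma meanD P f g : bounded_mfun f -> bounded_mfun g ->
  mean P (fun x => f x + g x) = mean P f + mean P g.
Proof. by move=> bf bg; apply: RintegralD => //; exact: bounded_mfun_integrable. Qed.

Lemma meanB P f g : bounded_mfun f -> bounded_mfun g ->
  mean P (fun x => f x - g x) = mean P f - mean P g.
Proof. by move=> bf bg; apply: RintegralB => //; exact: bounded_mfun_integrable. Qed.

Lemma meanZ P r f : bounded_mfun f -> mean P (fun x => r * f x) = r * mean P f.
Proof. by move=> bf; apply: RintegralZl => //; exact: bounded_mfun_integrable. Qed.

Lemma mean_le P f g : bounded_mfun f -> bounded_mfun g ->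
  (forall x, f x <= g x) -> mean P f <= mean P g.
Proof.
by move=> bf bg fg; apply: le_Rintegral => //; exact: bounded_mfun_integrable.
Qed.

Lemma mean_ge0 P f : (forall x, 0 <= f x) -> 0 <= mean P f.
Proof. by move=> f0; apply: Rintegral_ge0. Qed.

Lemma mean_norm P f : bounded_mfun f -> `|mean P f| <= mean P (fun x => `|f x|).
Proof. by move=> bf; apply: le_normr_Rintegral => //; exact: bounded_mfun_integrable. Qed.

Lemma eq_mean P f g : (forall x, f x = g x) -> mean P f = mean P g.
Proof. by move=> fg; congr (mean P _); apply/funext. Qed.

Lemma mean_sum P (I : Type) (s : seq I) (h : I -> T -> R) :
  (forall i, bounded_mfun (h i)) ->
  mean P (fun x => \sum_(i <- s) h i x) = \sum_(i <- s) mean P (h i).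
Proof.
move=> bh; elim: s => [|i s IH].
  by rewrite big_nil -[RHS](mean_cst P); apply: eq_mean => x; rewrite big_nil.
rewrite big_cons -IH -meanD//; last exact: bounded_mfun_sum.
by apply: eq_mean => x; rewrite big_cons.
Qed.

Lemma mean_indic P A : measurable A -> mean P \1_A = fine (P A).
Proof. by move=> mA; rewrite /mean /Rintegral integral_indic// setIT. Qed.

Lemma mean_indicE P A : measurable A -> P A = (mean P \1_A)%:E.
Proof. by move=> mA; rewrite mean_indic// fineK// fin_num_measure. Qed.

Lemma mean_integral P f : bounded_mfun f -> (\int[P]_x (f x)%:E)%E = (mean P f)%:E.
Proof.
move=> bf; rewrite /mean /Rintegral fineK//.
exact: (integrable_fin_num measurableT (bounded_mfun_integrable P bf)).
Qed.

Lemma mean_expectation P f : fine ('E_P[f]) = mean P f.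
Proof. by rewrite unlock. Qed.

Lemma eq_mean_ae P f g : bounded_mfun f -> bounded_mfun g ->
  {ae P, forall x, f x = g x} -> mean P f = mean P g.
Proof.
move=> [mf _] [mg _] fg; congr fine; apply: ae_eq_integral => //.
- exact/measurable_EFinP.
- exact/measurable_EFinP.
- by apply: filterS fg => x fgx _; rewrite fgx.
Qed.

Lemma ae_imply P (A B : T -> Prop) : (forall x, A x -> B x) ->
  {ae P, forall x, A x} -> {ae P, forall x, B x}.
Proof. by move=> AB; apply: filterS. Qed.

Lemma probability_bigcup P (F : nat -> set T) : (forall n, measurable (F n)) ->
  trivIset setT F -> P (\bigcup_n F n) = (\sum_(0 <= n <oo) P (F n))%E.
Proof. by move=> mF tF; apply: measure_semi_bigcup => //; exact: bigcupT_measurable. Qed.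

Lemma eq_mean_law P Q f : (forall A, measurable A -> P A = Q A) ->
  mean P f = mean Q f.
Proof.
by move=> PQ; congr fine; apply: eq_measure_integral => // A mA _; exact: PQ.
Qed.

Lemma mean_dominated P (fs : nat -> T -> R) f M :
  (forall n, measurable_fun setT (fs n)) -> measurable_fun setT f ->
  (forall n x, `|fs n x| <= M) ->
  (forall x, fs n x @[n --> \oo] --> f x) ->
  mean P (fs n) @[n --> \oo] --> mean P f.
Proof.
move=> mfs mf fM fsf.
have bfs n : bounded_mfun (fs n) by split => //; exists M.
have fleM x : `|f x| <= M.
  have h : `|fs n x| @[n --> \oo] --> `|f x| by apply: cvg_norm.
  rewrite -(cvg_lim _ h)//; apply: limr_le; first by apply/cvg_ex; exists `|f x|.
  exact: nearW.
have bf : bounded_mfun f by split => //; exists M.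
have := @dominated_convergence _ _ _ P setT measurableT
  (fun n => EFin \o fs n) (EFin \o f) (fun=> M%:E).
case=> //.
- by move=> n; exact/measurable_EFinP.
- exact/measurable_EFinP.
- by apply: aeW => x _ /=; apply/cvg_EFin; [exact: nearW|exact: fsf].
- exact: (bounded_mfun_integrable P (bounded_mfun_cst M)).
- by apply: aeW => x n _ /=; rewrite lee_fin.
move=> _ _ /=; under eq_fun do rewrite mean_integral//.
by rewrite mean_integral//; move/fine_cvgP => [].
Qed.

End mean.

Lemma bounded_mfun_comp d d' (T : measurableType d) (T' : measurableType d')
    (R : realType) (phi : T -> T') (f : T' -> R) :
  measurable_fun setT phi -> bounded_mfun f -> bounded_mfun (f \o phi).
Proof.
move=> mphi [mf [M fM]]; split; first exact: measurableT_comp.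
by exists M => x /=.
Qed.

Section law_image.
Context d d' (T : measurableType d) (T' : measurableType d') (R : realType).
Variables (P : probability T R) (phi : T -> T').
Hypothesis mphi : measurable_fun setT phi.

Let mphi_fun : {mfun T >-> T'} :=
  HB.pack_for {mfun T >-> T'} phi (isMeasurableFun.Build _ _ _ _ _ mphi).

Definition law_image : probability T' R := distribution P mphi_fun.

Lemma law_imageE A : law_image A = P (phi @^-1` A).
Proof. by []. Qed.

Lemma mean_law_image f : bounded_mfun f -> mean law_image f = mean P (f \o phi).
Proof.
move=> bf; congr fine; rewrite (@integral_distribution _ _ _ _ _ P mphi_fun)//.
- by apply/measurable_EFinP; case: bf.
- by apply: (bounded_mfun_integrable P); exact: bounded_mfun_comp.
Qed.

End law_image.

(** * Functions of finitely many coordinates *)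

Lemma sum_indic_trivIset (T : Type) (R : realType) (F : nat -> set T) n x :
  trivIset setT F ->
  \sum_(i < n) (\1_(F i) x : R) = \1_(\big[setU/set0]_(i < n) F i) x.
Proof.
move=> tF; elim: n => [|n IH]; first by rewrite !big_ord0 indic0.
rewrite !big_ord_recr /= IH !indicE in_setU -natrD; congr _%:R.
have [xn|_] := boolP (x \in F n); last by rewrite addn0 orbF.
rewrite orbT; case: (boolP (x \in _)) => // xU; exfalso.
move: xU; rewrite inE -bigcup_mkord => -[i /= ilt Fi].
have := tF i n I I (ex_intro _ x (conj Fi (set_mem xn))) => ein.
by rewrite ein ltnn in ilt.
Qed.

Section agreement.
Context (I : eqType) (V : Type).
Implicit Types (J K : seq I) (x y w : I -> V).

Definition agree J x y := forall i, i \in J -> x i = y i.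

(** Over countable discrete alphabets dependence on finitely many coordinates implies measurability,
    and over the finite alphabet also continuity for the product topology; most side conditions are
    reduced to it. *)
Definition local_on (Y : Type) J (f : (I -> V) -> Y) :=
  forall x y, agree J x y -> f x = f y.

Definition cylinder J w : set (I -> V) := [set x | agree J x w].

Definition upd x j v : I -> V := fun i => if i == j then v else x i.

Lemma updE x j v : upd x j v j = v.
Proof. by rewrite /upd eqxx. Qed.

Lemma updN x j v i : i != j -> upd x j v i = x i.
Proof. by rewrite /upd => /negPf ->. Qed.

Lemma updC x j v i u : i != j -> upd (upd x j v) i u = upd (upd x i u) j v.
Proof.
move=> ij; apply/funext => k; rewrite /upd.
by case: (k =P i) => [->|//]; rewrite (negPf ij).
Qed.

Lemma upd_same x j : upd x j (x j) = x.
Proof. by apply/funext => k; rewrite /upd; case: eqP => [->|]. Qed.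

Lemma agree_sym J x y : agree J x y -> agree J y x.
Proof. by move=> h i iJ; rewrite h. Qed.

Lemma agree_sub J K x y : {subset K <= J} -> agree J x y -> agree K x y.
Proof. by move=> KJ h i /KJ; exact: h. Qed.

Lemma local_on_sub (Y : Type) J K (f : (I -> V) -> Y) :
  {subset K <= J} -> local_on K f -> local_on J f.
Proof. by move=> KJ h x y /(agree_sub KJ); exact: h. Qed.

Lemma local_on_upd (Y : Type) J (f : (I -> V) -> Y) x j v :
  local_on J f -> j \notin J -> f (upd x j v) = f x.
Proof.
move=> h jJ; apply: h => i iJ; rewrite updN//.
by apply: contraNneq jJ => <-.
Qed.

Lemma local_on_cylinder J w : local_on J (cylinder J w).
Proof.
by move=> x y xy; apply/propext; split=> h i iJ; rewrite -h// xy.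
Qed.

Lemma local_on_indic (R : pzRingType) J (E : set (I -> V)) :
  local_on J E -> local_on J (\1_E : (I -> V) -> R).
Proof.
move=> h x y /h xy; rewrite !indicE; congr (nat_of_bool _)%:R.
by apply/idP/idP; rewrite !inE xy.
Qed.

End agreement.

Section seq_space_measurability.
Context d (V : measurableType d) (I : eqType).
Implicit Types (J K : seq I) (x y w : I -> V) (E : set (I -> V)).

Lemma measurable_coord (i : I) : measurable_fun setT (fun x : seq_space V I => x i).
Proof.
move=> _ B mB; apply: sub_sigma_algebra; exists i => //.
by exists B.
Qed.

Lemma measurable_seqP d' (T : measurableType d') (phi : T -> seq_space V I) :
  (forall i, measurable_fun setT (fun t => phi t i)) -> measurable_fun setT phi.
Proof.
move=> h; apply: (@measurability _ _ T (seq_space V I) setT phi (coord_sets setT)) => //.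
move=> _ [_ [i _ [B mB <-] <-]]; rewrite !setTI.
by have := h i measurableT B mB; rewrite setTI.
Qed.

(** The events that do not separate two given sequences form a sigma-algebra, and it contains the
    generators when the sequences agree on [W]. *)
Lemma coord_sigma_sub (W : set I) E :
  <<s coord_sets W >> E -> forall x y, (forall i, W i -> x i = y i) -> E x = E y.
Proof.
move=> EW x y xy.
apply: (EW [set F : set (I -> V) | F x = F y]); split => /=.
- split.
  + by [].
  + by move=> A /= AE; rewrite /setD/= AE.
  + move=> F FE; rewrite /bigcup/=; apply/propext.
    by split=> -[i _ Fi]; exists i => //; move: Fi; rewrite (FE i).
- move=> _ [i Wi [B mB <-]] /=.
  by apply/propext; rewrite /setI/preimage/= (xy _ Wi).
Qed.

Hypotheses (cV : countable [set: V]) (dV : forall B : set V, measurable B).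

(** Split along the countably many values of the head coordinate; once that coordinate is frozen by
    [upd], the event depends on the remaining ones only. *)
Lemma local_on_sigma J (W : set I) E :
  (forall i, i \in J -> W i) -> local_on J E -> <<s coord_sets W >> E.
Proof.
elim: J E => [|j J IH] E JW EJ.
  have [[x Ex]|nE] := pselect (exists x, E x).
    suff -> : E = setT by exact: (@measurableT _ (g_sigma_algebraType _)).
    by apply/seteqP; split => // y _; rewrite (EJ y x).
  suff -> : E = set0 by exact: (@measurable0 _ (g_sigma_algebraType _)).
  by apply/seteqP; split => // y Ey; apply: nE; exists y.
have -> : E = \bigcup_v ([set x | x j = v] `&` [set x | E (upd x j v)]).
  apply/seteqP; split => [x Ex|x [v _ [/= <-]]]; last by rewrite upd_same.
  by exists (x j) => //; split => //=; rewrite upd_same.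
apply: (@countable_bigcupT_measurable _ (g_sigma_algebraType (coord_sets W))) => // v.
apply: (@measurableI _ (g_sigma_algebraType (coord_sets W))).
  apply: sub_sigma_algebra; exists j; first by apply: JW; rewrite inE eqxx.
  by exists [set v] => //; rewrite setTI.
apply: IH => [i iJ|x y xy]; first by apply: JW; rewrite inE iJ orbT.
apply: EJ => i; rewrite inE /upd; case: eqP => //= _; exact: xy.
Qed.

Lemma measurable_local J E : local_on J E -> measurable (E : set (seq_space V I)).
Proof. by move=> h; apply: (local_on_sigma (W := setT)) h. Qed.

Lemma measurable_cylinder J w : measurable (cylinder J w : set (seq_space V I)).
Proof. exact: (measurable_local (@local_on_cylinder _ _ J w)). Qed.

Lemma measurable_fun_local d' (T : measurableType d') J (f : (I -> V) -> T) :
  local_on J f -> measurable_fun setT (f : seq_space V I -> T).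
Proof.
move=> fJ _ B _; rewrite setTI; apply: (measurable_local (J := J)).
by move=> x y /fJ xy; rewrite /preimage/= xy.
Qed.

Lemma bounded_mfun_local (R : realType) J (f : (I -> V) -> R) M :
  local_on J f -> (forall x, `|f x| <= M) ->
  bounded_mfun (f : seq_space V I -> R).
Proof. by move=> fJ fM; split; [exact: measurable_fun_local fJ|exists M]. Qed.

Lemma coord_sets_cylinders :
  <<s coord_sets [set: I] >> `<=`
  <<s [set E : set (I -> V) | E = set0 \/ exists J w, E = cylinder J w] >>.
Proof.
set G := [set E | _]; apply: smallest_sub; first exact: smallest_sigma_algebra.
move=> _ [i _ [B mB <-]]; rewrite setTI.
have -> : (fun x : I -> V => x i) @^-1` B =
    \bigcup_v (if v \in B then cylinder [:: i] (fun=> v) else set0).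
  apply/seteqP; split => [x Bx|x [v _]].
    exists (x i) => //; rewrite mem_set// => k; rewrite inE => /eqP ->//.
  case: ifPn => // vB /(_ i); rewrite inE eqxx => /(_ isT) /= xi.
  by rewrite /preimage/= xi; exact: set_mem.
apply: (@countable_bigcupT_measurable _ (g_sigma_algebraType G)) => // v.
apply: sub_sigma_algebra; case: ifP => _; last by left.
by right; exists [:: i], (fun=> v).
Qed.

(** Two cylinders that meet at [x] intersect in the cylinder around [x]; the empty set is included
    for the incompatible ones. *)
Lemma cylinders_setI_closed :
  setI_closed [set E : set (I -> V) | E = set0 \/ exists J w, E = cylinder J w].
Proof.
move=> A B [->|[J [w ->]]]; first by rewrite set0I; left.
move=> [->|[K [v ->]]]; first by rewrite setI0; left.
have [[x [xJ xK]]|h] := pselect (exists x, cylinder J w x /\ cylinder K v x).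
  right; exists (J ++ K), x; apply/seteqP; split => [y [yJ yK] i|y yx].
    by rewrite mem_cat => /orP[iJ|iK]; [rewrite yJ// xJ|rewrite yK// xK].
  by split=> i iJK; rewrite yx ?mem_cat ?iJK ?orbT//; [exact: xJ|exact: xK].
by left; apply/seteqP; split => // x [xJ xK]; apply: h; exists x.
Qed.

Lemma law_ext (R : realType) (P Q : probability (seq_space V I) R) :
  (forall J w, P (cylinder J w) = Q (cylinder J w)) ->
  forall E, measurable (E : set (seq_space V I)) -> P E = Q E.
Proof.
move=> PQ E mE.
pose G := [set E : set (seq_space V I) | E = set0 \/ exists J w, E = cylinder J w].
have GT : G setT.
  by right; exists [::], point; apply/seteqP; split => // x _ i.
apply: (measure_unique G (fun=> setT)) => //.
- apply/seteqP; split; first exact: coord_sets_cylinders.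
  apply: smallest_sub; first exact: smallest_sigma_algebra.
  move=> A [->|[J [w ->]]]; first exact: (@measurable0 _ (seq_space V I)).
  exact: measurable_cylinder.
- exact: cylinders_setI_closed.
- by rewrite bigcup_const.
- by move=> A [->|[J [w ->]]]; [rewrite !measure0|exact: PQ].
- by move=> k; rewrite [X in (X < _)%E](probability_setT P) ltry.
Qed.

(** Needed beside [law_ext] when the two sides compared are means against a weight rather than
    probabilities. *)
Lemma law_ext_dynkin (Pr : set (seq_space V I) -> Prop) :
  Pr setT -> (forall J w, Pr (cylinder J w)) -> Pr set0 ->
  (forall S, measurable S -> Pr S -> Pr (~` S)) ->
  (forall F : (set (seq_space V I))^nat, (forall n, measurable (F n)) ->
    trivIset setT F -> (forall n, Pr (F n)) -> Pr (\bigcup_k F k)) ->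
  forall E, measurable (E : set (seq_space V I)) -> Pr E.
Proof.
move=> PT Pc P0 PC PU E mE.
pose G := [set E : set (seq_space V I) | E = set0 \/ exists J w, E = cylinder J w].
have GE : @measurable _ (seq_space V I) = <<s G >>.
  apply/seteqP; split; first exact: coord_sets_cylinders.
  apply: smallest_sub; first exact: smallest_sigma_algebra.
  move=> A [->|[J [w ->]]]; first exact: (@measurable0 _ (seq_space V I)).
  exact: measurable_cylinder.
apply: (dynkin_induction GE) => //.
- exact: cylinders_setI_closed.
- by move=> A [->|[J [w ->]]].
- by rewrite -GE.
Qed.

End seq_space_measurability.

(** * Shifts, kernels and compatibility *)

Section shifts.
Context d (V : measurableType d).

Lemma iter_shift (j : nat) (x : int -> V) (i : int) :
  iter j (@shift_seq _ V) x i = x (i + j%:Z).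
Proof.
elim: j i => [|j IH] i; first by rewrite addr0.
by rewrite /= /shift_seq IH; congr x; rewrite -addrA -natz; congr (_ + _); lia.
Qed.

Lemma measurable_shift :
  measurable_fun setT (@shift_seq _ V : seq_space V int -> seq_space V int).
Proof. by apply: measurable_seqP => i; exact: measurable_coord. Qed.

Lemma measurable_iter_shift j :
  measurable_fun setT (iter j (@shift_seq _ V) : seq_space V int -> seq_space V int).
Proof.
apply: measurable_seqP => i.
have -> : (fun t : seq_space V int => iter j (@shift_seq _ V) t i) =
    (fun t => t (i + j%:Z)) by apply/funext => t; exact: iter_shift.
exact: measurable_coord.
Qed.

Context (R : realType) (mu : probability (seq_space V int) R).

Lemma bounded_mfun_iter_shift j (f : seq_space V int -> R) : bounded_mfun f ->
  bounded_mfun (fun x : seq_space V int => f (iter j (@shift_seq _ V) x)).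
Proof. by move=> bf; exact: (bounded_mfun_comp (@measurable_iter_shift j) bf). Qed.

Lemma stationary_mean f : stationary mu -> bounded_mfun (f : seq_space V int -> R) ->
  mean mu (fun x => f (shift_seq x)) = mean mu f.
Proof.
move=> st bf; rewrite -(mean_law_image mu measurable_shift bf).
by apply: eq_mean_law => A mA; rewrite law_imageE st.
Qed.

Lemma stationary_mean_iter f j : stationary mu ->
  bounded_mfun (f : seq_space V int -> R) ->
  mean mu (fun x => f (iter j (@shift_seq _ V) x)) = mean mu f.
Proof.
move=> st; elim: j f => [//|j IH] f bf.
rewrite -(IH f bf) -[RHS](stationary_mean st); last first.
  by apply: bounded_mfun_comp bf; exact: measurable_iter_shift.
by apply: eq_mean => x; rewrite iterSr.
Qed.

Hypotheses (cV : countable [set: V]) (dV : forall B : set V, measurable B).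

Lemma stationary_cylinder :
  (forall J w, mu (@shift_seq _ V @^-1` cylinder J w) = mu (cylinder J w)) ->
  stationary mu.
Proof.
move=> h E mE; rewrite -[LHS](law_imageE mu measurable_shift).
by apply: (law_ext cV dV) mE => J w; rewrite law_imageE h.
Qed.

End shifts.

Section kernel_continuity.
Context (R : realType) (m : nat) (P : 'I_m.+1 -> (nat -> 'I_m.+1) -> R).
Notation A := 'I_m.+1.
Notation past := (nat -> A).
Hypothesis Pk : is_prob_kernel P.

Lemma countable_alphabet : countable [set: A].
Proof. exact: countableP. Qed.

Lemma measurable_alphabet (B : set A) : measurable B.
Proof. by []. Qed.

Lemma prepend_lt k (w : k.-tuple A) (x : past) i :
  (i < k)%N -> prepend w x i = nth ord0 w i.
Proof. by rewrite /prepend => ->. Qed.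

Lemma prepend_take k (x : past) :
  prepend [tuple x i | i < k] (fun i => x (k + i)%N) = x.
Proof.
apply/funext => i; rewrite /prepend; case: ltnP => ik; last by rewrite subnKC.
by rewrite -[i in LHS]/(nat_of_ord (Ordinal ik)) -tnth_nth tnth_mktuple.
Qed.

Lemma kernel_norm a x : `|P a x| <= 1.
Proof. by have [/(_ a x)/andP[P0 P1] _] := Pk; rewrite ger0_norm. Qed.

Lemma variation_ub k (b : A) (w : k.-tuple A) (x y : past) :
  `|P b (prepend w x) - P b (prepend w y)| <= variation P k.
Proof.
apply: sup_ubound; last by exists b, w, x, y.
exists 2 => _ [b' [w' [x' [y' ->]]]].
by rewrite (le_trans (ler_normB _ _))// (_ : 2 = 1 + 1)// lerD// kernel_norm.
Qed.

Lemma variation_agree k b (x y : past) : (forall i, (i < k)%N -> x i = y i) ->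
  `|P b x - P b y| <= variation P k.
Proof.
move=> xy.
have -> : P b x = P b (prepend [tuple x i | i < k] (fun i => x (k + i)%N)).
  by rewrite prepend_take.
have -> : P b y = P b (prepend [tuple x i | i < k] (fun i => y (k + i)%N)).
  rewrite (_ : [tuple x i | i < k] = [tuple y i | i < k]) ?prepend_take//.
  by apply: eq_from_tnth => i; rewrite !tnth_mktuple xy.
exact: variation_ub.
Qed.

Hypothesis Pc : continuous_kernel P.

Lemma variation_small e : 0 < e -> exists k0, forall k, (k0 <= k)%N -> variation P k <= e.
Proof.
move=> e0; have /cvgrPdist_le/(_ _ e0) := Pc.
case=> k0 _ h; exists k0 => k /h /=; rewrite sub0r normrN.
by apply: le_trans; rewrite ler_norm.
Qed.

Lemma kernel_close e : 0 < e -> exists k, forall b (x y : past),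
  (forall i, (i < k)%N -> x i = y i) -> `|P b x - P b y| <= e.
Proof.
move=> /variation_small[k h]; exists k => b x y /(variation_agree b) xy.
exact: le_trans xy (h _ (leqnn k)).
Qed.

(** Measurability comes from continuity: filling the past beyond its first [k] symbols with a fixed
    letter gives local functions that converge pointwise. *)
Lemma bounded_mfun_kernel a : bounded_mfun (P a : seq_space A nat -> R).
Proof.
split; last by exists 1 => x; exact: kernel_norm.
pose fs k (x : past) := P a (prepend [tuple x i | i < k] (fun=> ord0)).
apply: (@measurable_fun_cvg _ (seq_space A nat) R setT fs) => //.
- move=> k; apply: (measurable_fun_local countable_alphabet measurable_alphabet
    (J := iota 0 k)).
  move=> x y xy; congr (P a (prepend _ _)).
  by apply: eq_from_tnth => i; rewrite !tnth_mktuple xy// mem_iota /=.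
- move=> x _; apply/cvgrPdist_le => e e0; have [k h] := kernel_close e0.
  exists k => // n /= kn; apply: h => i ik.
  rewrite prepend_lt ?(leq_trans ik)//.
  rewrite -[i in RHS]/(nat_of_ord (Ordinal (leq_trans ik kn))) -tnth_nth.
  by rewrite tnth_mktuple.
Qed.

Lemma measurable_past_of :
  measurable_fun setT (@past_of m : seq_space A int -> seq_space A nat).
Proof. by apply: measurable_seqP => i; exact: measurable_coord. Qed.

Lemma bounded_mfun_kernel_past a :
  bounded_mfun (fun x : seq_space A int => P a (past_of x)).
Proof. exact: (bounded_mfun_comp measurable_past_of (bounded_mfun_kernel a)). Qed.

Notation law := (probability (seq_space A int) R).

Lemma bounded_mfun_coord (i : int) a :
  bounded_mfun (fun x : seq_space A int => (x i == a)%:R : R).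
Proof.
apply: (bounded_mfun_local countable_alphabet measurable_alphabet
  (J := [:: i]) (M := 1)) => [x y xy|x].
  by rewrite xy// inE.
by case: eqP; rewrite ?normr1 ?normr0.
Qed.

Lemma bounded_mfun_past_indic (B : set past) :
  measurable (B : set (seq_space A nat)) ->
  bounded_mfun (fun x : seq_space A int => \1_B (past_of x) : R).
Proof.
by move=> mB; exact: (bounded_mfun_comp measurable_past_of (bounded_mfun_indic R mB)).
Qed.

Lemma past_eventE (mu : law) a (B : set past) :
  measurable (B : set (seq_space A nat)) ->
  mu [set x | x 0 = a /\ B (past_of x)] =
    (mean mu (fun x : seq_space A int => (x 0 == a)%:R * \1_B (past_of x)))%:E.
Proof.
move=> mB; set E := [set x | _].
have mE : measurable (E : set (seq_space A int)).
  have -> : E = (fun x : seq_space A int => x 0) @^-1` [set a] `&` @past_of m @^-1` B.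
    by apply/seteqP; split.
  apply: measurableI.
    apply: (measurable_local countable_alphabet measurable_alphabet (J := [:: 0])).
    by move=> x y xy; rewrite /preimage/= xy ?inE.
  by rewrite -[X in measurable X]setTI; exact: measurable_past_of.
rewrite (mean_indicE mu mE); congr (_ %:E); apply: eq_mean => x.
rewrite !indicE -natrM mulnb; congr (nat_of_bool _)%:R.
apply/idP/andP; first by rewrite inE => -[/eqP ? ?]; rewrite inE.
by move=> [/eqP ? ]; rewrite !inE.
Qed.

Lemma past_integralE (mu : law) a (B : set past) :
  measurable (B : set (seq_space A nat)) ->
  (\int[mu]_(x in [set x | B (past_of x)]) (P a (past_of x))%:E)%E =
    (mean mu (fun x : seq_space A int => P a (past_of x) * \1_B (past_of x)))%:E.
Proof.
move=> mB; rewrite integral_mkcond -mean_integral; last first.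
  by apply: bounded_mfunM; [exact: bounded_mfun_kernel_past|exact: bounded_mfun_past_indic].
apply: eq_integral => x _; rewrite patchE indicE.
rewrite (_ : x \in [set x | B (past_of x)] = (past_of x \in B)); last by apply/idP/idP; rewrite !inE.
by case: ifPn; rewrite ?mulr1 ?mulr0.
Qed.

Lemma compatible_mean (mu : law) a (B : set past) : compatible P mu ->
  measurable (B : set (seq_space A nat)) ->
  mean mu (fun x : seq_space A int => (x 0 == a)%:R * \1_B (past_of x)) =
  mean mu (fun x : seq_space A int => P a (past_of x) * \1_B (past_of x)).
Proof.
move=> /(_ a)[Q [[mQ [iQ hQ]] QP]] mB.
apply: EFin_inj; rewrite -past_eventE// -past_integralE// hQ//.
have mB' : measurable ([set x | B (past_of x)] : set (seq_space A int)).
  by rewrite -[X in measurable X]setTI; exact: measurable_past_of.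
apply: ae_eq_integral => //.
- apply/measurable_EFinP; apply: measurable_funTS.
  exact: (measurableT_comp mQ measurable_past_of).
- apply/measurable_EFinP; apply: measurable_funTS.
  by case: (bounded_mfun_kernel_past a).
- by apply: ae_imply QP => x -> _.
Qed.

(** Both sides are means of a bounded weight, an indicator or the kernel, against the indicator of
    [B]. So one computation [C], made for any bounded weight, passes the identity to complements,
    and another one to disjoint unions. *)
Lemma compatible_of_cylinders (mu : law) :
  (forall a J w, mean mu (fun x : seq_space A int => (x 0 == a)%:R * \1_(cylinder J w) (past_of x)) =
     mean mu (fun x : seq_space A int => P a (past_of x) * \1_(cylinder J w) (past_of x))) ->
  compatible P mu.
Proof.
move=> h a; exists (P a); split; last exact: aeW.
split; first by case: (bounded_mfun_kernel a).
split; first exact: (bounded_mfun_integrable mu (bounded_mfun_kernel_past a)).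
have bP := bounded_mfun_kernel_past a; have b0 := bounded_mfun_coord 0 a.
move=> B mB; rewrite past_eventE// past_integralE//; congr _%:E.
pose Pr (B : set (seq_space A nat)) :=
  mean mu (fun x : seq_space A int => (x 0 == a)%:R * \1_B (past_of x)) =
  mean mu (fun x : seq_space A int => P a (past_of x) * \1_B (past_of x)).
have PT : Pr setT.
  have := h a [::] (fun=> ord0); rewrite (_ : cylinder _ _ = setT)//.
  by apply/seteqP; split => // x _ i.
apply: (law_ext_dynkin countable_alphabet measurable_alphabet (Pr := Pr) _ _ _ _ _ mB) => //.
- exact: h.
- rewrite /Pr; under eq_mean do rewrite indic0 mulr0.
  by under [RHS]eq_mean do rewrite indic0 mulr0.
- move=> S mS PS; have bS := bounded_mfun_past_indic mS.
  have C (f : seq_space A int -> R) : bounded_mfun f ->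
      mean mu (fun x : seq_space A int => f x * \1_(~` S) (past_of x)) =
      mean mu (fun x : seq_space A int => f x * \1_setT (past_of x)) -
      mean mu (fun x : seq_space A int => f x * \1_S (past_of x)).
    move=> bf; rewrite -meanB; last 2 first.
    + by apply: bounded_mfunM => //; apply: bounded_mfun_past_indic; exact: measurableT.
    + exact: bounded_mfunM.
    apply: eq_mean => x; rewrite !indicE in_setC in_setT.
    by case: (_ \in S); rewrite /= ?mulr1 ?mulr0 ?subr0 ?subrr.
  by rewrite /Pr !C// PS PT.
- move=> F mF tF PF; rewrite /Pr.
  have mU n : measurable (\big[setU/set0]_(i < n) F i : set (seq_space A nat)).
    by apply: bigsetU_measurable => i _; exact: mF.
  have mUF : measurable (\bigcup_k F k : set (seq_space A nat)) by exact: bigcup_measurable.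
  have C (f : seq_space A int -> R) : bounded_mfun f ->
      \sum_(i < n) mean mu (fun x : seq_space A int => f x * \1_(F i) (past_of x)) @[n --> \oo] -->
      mean mu (fun x : seq_space A int => f x * \1_(\bigcup_k F k) (past_of x)).
    move=> bf; have [mf [M fM]] := bf.
    have bfF i : bounded_mfun (fun x => f x * \1_(F i) (past_of x)).
      by apply: bounded_mfunM => //; exact: bounded_mfun_past_indic.
    under eq_cvg => n do rewrite -mean_sum//.
    have indU n x : \sum_(i < n) f x * \1_(F i) (past_of x) =
        f x * \1_(\big[setU/set0]_(i < n) F i) (past_of x).
      by rewrite -mulr_sumr sum_indic_trivIset.
    apply: (@mean_dominated _ _ _ _ _ _ M).
    + by move=> n; case: (bounded_mfun_sum (index_enum 'I_n) (fun i : 'I_n => bfF i)).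
    + by case: (bounded_mfunM bf (bounded_mfun_past_indic mUF)).
    + move=> n x; rewrite indU normrM -[leRHS]mulr1 ler_pM// indicE.
      by case: (_ \in _); rewrite ?normr1 ?normr0.
    + move=> x; apply: cvg_near_cst.
      have [[k _ Fk]|nF] := pselect ((\bigcup_k F k) (past_of x)).
        exists k.+1 => // n /= kn; rewrite indU !indicE !mem_set//; first by exists k.
        by rewrite -bigcup_mkord; exists k.
      near=> n; rewrite indU !indicE !memNset// => nFn; apply: nF.
      by move: nFn; rewrite -bigcup_mkord => -[i _ Fi]; exists i.
  have := C _ b0; under eq_cvg => n do under eq_bigr => i do rewrite PF.
  by move=> h1; exact: (cvg_unique _ h1 (C _ bP)).
Unshelve. all: by end_near.
Qed.

End kernel_continuity.

(** * The maximum phase is stationary and compatible *)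

Section weak_limit.
Context (R : realType) (m : nat) (P : 'I_m.+1 -> (nat -> 'I_m.+1) -> R).
Notation A := 'I_m.+1.
Notation past := (nat -> A).
Notation law := (probability (seq_space A int) R).

Lemma nbhs_agree (x : int -> A) J : nbhs (x : {ptws int -> discrete_topology A}) [set y | agree J x y].
Proof.
have F : Filter (nbhs (x : {ptws int -> discrete_topology A})) by exact: nbhs_filter.
elim: J => [|j J IH]. by apply: filterS filterT => y _ i.
have cj : nbhs (x : {ptws int -> discrete_topology A}) [set y | y j = x j].
  have := (@proj_continuous int (fun=> discrete_topology A) j x [set a | a = x j]).
  apply.
  rewrite nbhs_principalE. by apply/principal_filterP.
apply: filterS (filterI cj IH) => y [/= yj yJ] i.
rewrite inE => /predU1P[->//|].
exact: yJ.
Qed.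
(** Stated with an error [e] so as to cover the kernel, which sees the whole past but is uniformly
    close to local functions. *)
Lemma approx_local_continuous (f : (int -> A) -> R) :
  (forall e, 0 < e -> exists J, forall x y, agree J x y -> `|f x - f y| <= e) ->
  continuous (f : {ptws int -> discrete_topology A} -> R).
Proof.
move=> h x; have F : Filter (nbhs (x : {ptws int -> discrete_topology A})) by exact: nbhs_filter.

apply/cvgrPdist_le => e /h[J hJ].
by apply: filterS (nbhs_agree x J) => y xy; exact: hJ.
Qed.

Lemma local_continuous J (f : (int -> A) -> R) : local_on J f ->
  continuous (f : {ptws int -> discrete_topology A} -> R).
Proof.
move=> fJ; apply: approx_local_continuous => e e0; exists J => x y /fJ ->.
by rewrite subrr normr0 ltW.
Qed.

Lemma weak_limit_mean (nu mu : law) (f : (int -> A) -> R) :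
  weak_limit_of_shifts nu mu ->
  bounded_mfun (f : seq_space A int -> R) ->
  continuous (f : {ptws int -> discrete_topology A} -> R) ->
  mean nu (fun x => f (iter j (@shift_seq _ A) x)) @[j --> \oo] --> mean mu f.
Proof.
move=> wl bf cf; have := wl f cf bf.2.
have e j : 'E_nu[fun x => f (iter j (@shift_seq _ A) x)]%E =
    (mean nu (fun x => f (iter j (@shift_seq _ A) x)))%:E.
  rewrite unlock mean_integral//.
  exact: bounded_mfun_iter_shift.
rewrite (_ : (fun j => _) = (fun j => (mean nu (fun x => f (iter j (@shift_seq _ A) x)))%:E)).
  by rewrite unlock mean_integral// => /fine_cvg.
by apply/funext => j; exact: e.
Qed.

(** A cylinder and its preimage under the shift are both local, hence admissible test sets, and
    their means along the chain are one sequence up to an index shift. *)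
Lemma weak_limit_stationary (nu mu : law) :
  weak_limit_of_shifts nu mu -> stationary mu.
Proof.
move=> wl; apply: (stationary_cylinder (countable_alphabet m) (@measurable_alphabet m)).
move=> J w.
have mC := @measurable_cylinder _ _ _ (countable_alphabet m) (@measurable_alphabet m) J w.
set S := _ @^-1` _.
have mS : measurable (S : set (seq_space A int)).
  by rewrite /S -[X in measurable X]setTI; exact: (@measurable_shift _ A measurableT _ mC).
rewrite !mean_indicE//; congr _%:E.
have lC := local_on_indic R (@local_on_cylinder _ _ J w).
have lS : local_on [seq i + 1 | i <- J] (\1_S : _ -> R).
  apply: local_on_indic => x y xy; apply: local_on_cylinder => i iJ.
  by rewrite /shift_seq xy//; apply/mapP; exists i.
have c1 := weak_limit_mean wl (bounded_mfun_indic R mC) (local_continuous lC).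
have c2 := weak_limit_mean wl (bounded_mfun_indic R mS) (local_continuous lS).
pose u j := mean nu (fun x : seq_space A int => \1_(cylinder J w) (iter j (@shift_seq _ A) x)).
(* The sequence in [c2] is convertible to [u] shifted by one index, since [S] is a preimage under
   the shift. *)
have c3 : [sequence u n.+1]_n @ \oo --> mean mu (\1_S : seq_space A int -> R).
  by apply: cvg_trans c2.
have c4 : [sequence u n.+1]_n @ \oo --> mean mu (\1_(cylinder J w) : seq_space A int -> R).
  by rewrite (cvg_shiftS u).
exact: (cvg_unique _ c3 c4).
Qed.

Hypotheses (Pk : is_prob_kernel P) (Pc : continuous_kernel P).

(** Almost surely the past of time [k.+1] is a word of length [k] followed by [x], so it takes
    finitely many values. Summing over the word reduces the identity to the product formula that
    defines the chain. *)
Lemma fixed_past_chain_step (x : past) (nu : law) (k : nat) a (B : set past) :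
  fixed_past_chain P x nu -> measurable (B : set (seq_space A nat)) ->
  mean nu (fun y : seq_space A int => (y k.+1%:Z == a)%:R *
    \1_B (past_of (iter k.+1 (@shift_seq _ A) y))) =
  mean nu (fun y : seq_space A int => P a (past_of (iter k.+1 (@shift_seq _ A) y)) *
    \1_B (past_of (iter k.+1 (@shift_seq _ A) y))).
Proof.
move=> [nux hstep] mB.
pose word (y : int -> A) : k.-tuple A := [tuple y (k%:Z - (nat_of_ord i)%:Z) | i < k].
pose J := [seq k%:Z - i%:Z | i <- iota 0 k.+1] ++ [:: k.+1%:Z].
have inJ (i : 'I_k) : (k%:Z - (nat_of_ord i)%:Z) \in J.
  rewrite mem_cat; apply/orP; left; apply/mapP; exists (nat_of_ord i) => //.
  by rewrite mem_iota /= add0n ltnS ltnW.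
have kJ : k.+1%:Z \in J by rewrite mem_cat mem_seq1 eqxx orbT.
have lw : local_on J word.
  by move=> y z yz; apply: eq_from_tnth => i; rewrite !tnth_mktuple yz.
have ml (M : R) (f : (int -> A) -> R) : local_on J f -> (forall y, `|f y| <= M) ->
    bounded_mfun (f : seq_space A int -> R).
  by move=> h1 h2; apply: (bounded_mfun_local (countable_alphabet m) (@measurable_alphabet m) (J := J) (M := M)).
have ind1 (b : bool) : `|b%:R : R| <= 1 by case: b; rewrite ?normr1 ?normr0.
have word_past : {ae nu, forall y, past_of (iter k.+1 (@shift_seq _ A) y) = prepend (word y) x}.
  apply: ae_imply nux => y yx; apply/funext => i; rewrite /past_of iter_shift /prepend.
  case: ltnP => ik.
    rewrite -[i in RHS]/(nat_of_ord (Ordinal ik)) -tnth_nth tnth_mktuple /=.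
    by congr y; lia.
  by rewrite -yx; congr y; lia.
have biter : measurable_fun setT
    (fun y : seq_space A int => past_of (iter k.+1 (@shift_seq _ A) y) : seq_space A nat).
  exact: (measurableT_comp (@measurable_past_of m) (@measurable_iter_shift _ A k.+1)).
have bB : bounded_mfun (fun y : seq_space A int =>
    \1_B (past_of (iter k.+1 (@shift_seq _ A) y)) : R).
  exact: (bounded_mfun_comp biter (bounded_mfun_indic R mB)).
pose phi (w : k.-tuple A) : R := \1_B (prepend w x).
transitivity (mean nu (fun y : seq_space A int =>
    \sum_(w : k.-tuple A) phi w * ((y k.+1%:Z == a) && (word y == w))%:R)).
  have bj w : bounded_mfun (fun y : seq_space A int =>
      ((y k.+1%:Z == a) && (word y == w))%:R : R).
    by apply: (ml 1) => // y z yz; rewrite (lw y z yz) yz.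
  apply: eq_mean_ae.
  - by apply: bounded_mfunM => //; exact: bounded_mfun_coord.
  - by apply: bounded_mfun_sum => w; exact: bounded_mfunZ.
  apply: ae_imply word_past => y ->.
  rewrite (bigD1 (word y))//= eqxx andbT big1 ?addr0 1?mulrC// => w /negPf ww.
  by rewrite [word y == w]eq_sym ww andbF mulr0.
have bw w : bounded_mfun (fun y : seq_space A int => (word y == w)%:R : R).
  by apply: (ml 1) => // y z yz; rewrite (lw y z yz).
have bj w : bounded_mfun (fun y : seq_space A int =>
    ((y k.+1%:Z == a) && (word y == w))%:R : R).
  by apply: (ml 1) => // y z yz; rewrite (lw y z yz) yz.
transitivity (mean nu (fun y : seq_space A int =>
    \sum_(w : k.-tuple A) (phi w * P a (prepend w x)) * (word y == w)%:R)); last first.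
  apply: eq_mean_ae.
  - by apply: bounded_mfun_sum => w; exact: bounded_mfunZ.
  - apply: bounded_mfunM => //.
    exact: (bounded_mfun_comp biter (bounded_mfun_kernel Pk Pc a)).
  apply: ae_imply word_past => y ->.
  rewrite (bigD1 (word y))//= eqxx big1 ?addr0 ?mulr1 1?mulrC// => w /negPf ww.
  by rewrite [word y == w]eq_sym ww mulr0.
rewrite !mean_sum; last 2 first.
- by move=> w; exact: bounded_mfunZ.
- by move=> w; exact: bounded_mfunZ.
apply: eq_bigr => w _; rewrite !meanZ// -mulrA; congr (_ * _).
have := hstep k w a; rewrite /=; set H := [set y | _].
have mH : measurable (H : set (seq_space A int)).
  apply: (measurable_local (countable_alphabet m) (@measurable_alphabet m) (J := J)).
  by move=> y z yz; apply/propext; split => h i; rewrite -h -?yz// yz.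
have mHa : measurable (H `&` [set y | y k.+1%:Z = a] : set (seq_space A int)).
  apply: measurableI => //.
  apply: (measurable_local (countable_alphabet m) (@measurable_alphabet m) (J := J)).
  by move=> y z yz; rewrite /= yz.
have wH y : (word y == w) = (y \in H).
  apply/eqP/idP; rewrite inE /H /=; first by move=> <- i; rewrite tnth_mktuple.
  by move=> h; apply: eq_from_tnth => i; rewrite tnth_mktuple h.
rewrite !mean_indicE// -EFinM => -[e].
transitivity (mean nu (\1_(H `&` [set y | y k.+1%:Z = a]) : seq_space A int -> R)).
  apply: eq_mean => y; rewrite indicE in_setI wH andbC; congr (nat_of_bool (_ && _))%:R.
  by apply/eqP/idP; rewrite inE.
rewrite e mulrC; congr (_ * _); apply: eq_mean => y; by rewrite indicE wH.
Qed.

(** The one-step identity holds along the chain and passes to the weak limit, because continuity of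
    the kernel makes its right-hand side a continuous test function too. *)
Lemma weak_limit_compatible (x : past) (nu mu : law) :
  fixed_past_chain P x nu -> weak_limit_of_shifts nu mu -> compatible P mu.
Proof.
move=> fx wl; apply: compatible_of_cylinders => // a J w.
set B := cylinder J w.
have mB : measurable (B : set (seq_space A nat)).
  exact: measurable_cylinder (countable_alphabet m) (@measurable_alphabet m) J w.
have lB : local_on [seq - (i.+1)%:Z | i <- J] (fun y => \1_B (past_of y) : R).
  move=> y z yz; apply: (local_on_indic R (@local_on_cylinder _ _ J w)) => i iJ.
  by rewrite /past_of yz//; apply/mapP; exists i.
have b1 : bounded_mfun (fun y : seq_space A int => (y 0 == a)%:R * \1_B (past_of y) : R).
  by apply: bounded_mfunM; [exact: bounded_mfun_coord|exact: bounded_mfun_past_indic].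
have b2 : bounded_mfun (fun y : seq_space A int => P a (past_of y) * \1_B (past_of y)).
  by apply: bounded_mfunM; [exact: bounded_mfun_kernel_past|exact: bounded_mfun_past_indic].
have f1_cont : continuous ((fun y => (y 0 == a)%:R * \1_B (past_of y)) :
    {ptws int -> discrete_topology A} -> R).
  apply: (local_continuous (J := 0 :: [seq - (i.+1)%:Z | i <- J])) => y z yz.
  rewrite (yz 0) ?inE// (lB y z)// => i iJ.
  by apply: yz; rewrite inE iJ orbT.
have f2_cont : continuous ((fun y => P a (past_of y) * \1_B (past_of y)) :
    {ptws int -> discrete_topology A} -> R).
  apply: approx_local_continuous => e e0; have [k hk] := kernel_close Pk Pc e0.
  exists ([seq - (i.+1)%:Z | i <- iota 0 k] ++ [seq - (i.+1)%:Z | i <- J]) => y z yz.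
  rewrite (lB y z) => [|i iJ]; last by apply: yz; rewrite mem_cat iJ orbT.
  rewrite -mulrBl normrM -[leRHS]mulr1 ler_pM//.
    apply: hk => i ik; rewrite /past_of yz// mem_cat; apply/orP; left.
    by apply/mapP; exists i => //; rewrite mem_iota.
  by rewrite indicE; case: (_ \in _); rewrite ?normr1 ?normr0.
have c1 := weak_limit_mean wl b1 f1_cont; have c2 := weak_limit_mean wl b2 f2_cont.
pose u j := mean nu (fun y : seq_space A int =>
  ((iter j (@shift_seq _ A) y) 0 == a)%:R * \1_B (past_of (iter j (@shift_seq _ A) y))).
pose v j := mean nu (fun y : seq_space A int =>
  P a (past_of (iter j (@shift_seq _ A) y)) * \1_B (past_of (iter j (@shift_seq _ A) y))).
(* At time 0 the symbol is prescribed, not drawn from the kernel; the identity is available from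
   time 1 on. *)
have uv : [sequence u n.+1]_n = [sequence v n.+1]_n.
  apply/funext => n; rewrite /= /v -(fixed_past_chain_step _ _ fx mB).
  by apply: eq_mean => y; rewrite iter_shift add0r.
have c3 : [sequence u n.+1]_n @ \oo --> mean mu (fun y : seq_space A int =>
    (y 0 == a)%:R * \1_B (past_of y)) by rewrite (cvg_shiftS u).
have c4 : [sequence u n.+1]_n @ \oo --> mean mu (fun y : seq_space A int =>
    P a (past_of y) * \1_B (past_of y)) by rewrite uv (cvg_shiftS v).
exact: (cvg_unique _ c3 c4).
Qed.

End weak_limit.

(** * Oscillations and ratios of word probabilities *)

Section oscillation.
Context (R : realType) (m n : nat).
Notation A := 'I_m.+1.
Implicit Types (f : n.-tuple A -> R) (a b : n.-tuple A) (j : 'I_n).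

Lemma osc_ub f j a b : (forall i, i != j -> tnth a i = tnth b i) ->
  `|f a - f b| <= osc f j.
Proof.
move=> ab; apply: sup_ubound; last by exists a, b.
exists (\sum_(t : n.-tuple A) `|f t| + \sum_(t : n.-tuple A) `|f t|) => _ [a' [b' [_ ->]]].
rewrite (le_trans (ler_normB _ _))// lerD//.
  by rewrite (bigD1 a')//= lerDl sumr_ge0.
by rewrite (bigD1 b')//= lerDl sumr_ge0.
Qed.

Lemma osc_le f j c :
  (forall a b, (forall i, i != j -> tnth a i = tnth b i) -> `|f a - f b| <= c) ->
  osc f j <= c.
Proof.
move=> h; apply: ge_sup => [|_ [a [b [ab ->]]]]; last exact: h.
by exists `|f [tuple ord0 | _ < n] - f [tuple ord0 | _ < n]|, [tuple ord0 | _ < n], [tuple ord0 | _ < n].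
Qed.

Lemma osc_ge0 f j : 0 <= osc f j.
Proof.
pose t : n.-tuple A := [tuple ord0 | _ < n].
by have /(le_trans _) -> // := @osc_ub f j t t (fun _ _ => erefl).
Qed.

Lemma osc_l1_ge0 f : 0 <= osc_l1 f.
Proof. by apply: sumr_ge0 => j _; exact: osc_ge0. Qed.

Lemma osc_scale f j c : 0 < c -> osc (fun t => c * f t) j = c * osc f j.
Proof.
have le (h : n.-tuple A -> R) (k : R) : 0 < k -> osc (fun t => k * h t) j <= k * osc h j.
  move=> k0; apply: osc_le => a b ab.
  by rewrite -mulrBr normrM gtr0_norm// ler_pM2l// osc_ub.
move=> c0; apply/eqP; rewrite eq_le le//=.
rewrite -ler_pdivlMl// -[in X in X <= _](_ : (fun t => c^-1 * (c * f t)) = f).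
  by rewrite le// invr_gt0.
by apply/funext => t; rewrite mulKf// gt_eqF.
Qed.

(** Pass from [a] to [b] through the hybrids [hyb k], which take their first [k] letters from [b]; a
    step at which the two words agree costs nothing. *)
Lemma osc_telescope f a b :
  `|f a - f b| <= \sum_j (tnth a j != tnth b j)%:R * osc f j.
Proof.
pose hyb k : n.-tuple A := [tuple if (i < k)%N then tnth b i else tnth a i | i < n].
suff H k : (k <= n)%N ->
    `|f a - f (hyb k)| <= \sum_(j < n | (j < k)%N) (tnth a j != tnth b j)%:R * osc f j.
  have -> : b = hyb n.
    by apply: eq_from_tnth => i; rewrite tnth_mktuple ltn_ord.
  apply: le_trans (H n (leqnn n)) _; rewrite le_eqVlt; apply/orP; left; apply/eqP.
  apply: eq_big => [j|j _]; first by rewrite ltn_ord.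
  by rewrite tnth_mktuple ltn_ord.
elim: k => [_|k IH kn].
  rewrite (_ : hyb 0%N = a) ?subrr ?normr0 ?sumr_ge0//.
    by apply: eq_from_tnth => i; rewrite tnth_mktuple.
pose k' := Ordinal kn.
rewrite (bigD1 k')//=.
apply: le_trans (ler_distD (f (hyb k)) _ _) _; rewrite [leRHS]addrC lerD//.
  apply: le_trans (IH (ltnW kn)) _; rewrite le_eqVlt; apply/orP; left; apply/eqP.
  apply: eq_bigl => j; rewrite ltnS -val_eqE/=.
  by rewrite [in RHS]leq_eqVlt; case: ltngtP.
case: (eqVneq (tnth a k') (tnth b k')) => [e|ne] /=.
  rewrite (_ : hyb k = hyb k.+1) ?subrr ?normr0 ?mul0r//.
  apply: eq_from_tnth => i; rewrite !tnth_mktuple [in RHS]ltnS [in RHS]leq_eqVlt.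
  case: (eqVneq i k') => [->|]; first by rewrite /= ltnn eqxx e.
  by rewrite -val_eqE/= => /negPf ->.
rewrite mul1r; apply: osc_ub => i ik; rewrite !tnth_mktuple [in RHS]ltnS [in RHS]leq_eqVlt.
by rewrite -val_eqE/= in ik; rewrite (negPf ik).
Qed.

Lemma osc_total f a b : `|f a - f b| <= osc_l1 f.
Proof.
apply: le_trans (osc_telescope f a b) _; apply: ler_sum => j _.
by case: (_ != _); rewrite ?mul1r ?mul0r// osc_ge0.
Qed.

End oscillation.

Section word_ratio.
Context (R : realType) (m : nat) (P : 'I_m.+1 -> (nat -> 'I_m.+1) -> R).
Notation A := 'I_m.+1.
Notation past := (nat -> A).
Notation law := (probability (seq_space A int) R).
Hypotheses (Pk : is_prob_kernel P) (Pr : regular_kernel P).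

Definition past_word n (x : int -> A) : n.-tuple A := [tuple past_of x i | i < n].

Lemma local_past_word n :
  local_on [seq - (i.+1)%:Z | i <- iota 0 n] (past_word n).
Proof.
move=> x y xy; apply: eq_from_tnth => i; rewrite !tnth_mktuple /past_of xy//.
by apply/mapP; exists (nat_of_ord i) => //; rewrite mem_iota /=.
Qed.

Lemma bounded_mfun_past_word n (c : n.-tuple A -> R) :
  bounded_mfun (fun x : seq_space A int => c (past_word n x)).
Proof.
apply: (bounded_mfun_local (countable_alphabet m) (@measurable_alphabet m)
  (J := [seq - (i.+1)%:Z | i <- iota 0 n]) (M := \sum_t `|c t|)) => [x y xy|x].
  by rewrite (local_past_word xy).
by rewrite (bigD1 (past_word n x))//= lerDl sumr_ge0.
Qed.

Lemma kernel_inf a x : inf (range (fun ax => P ax.1 ax.2)) <= P a x.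
Proof.
apply: ge_inf; last by exists (a, x).
by exists 0 => _ [[b y] _ <-] /=; have [/(_ b y)/andP[]] := Pk.
Qed.

Let delta := inf (range (fun ax => P ax.1 ax.2)).

(* Two pasts agreeing on [k] symbols give probabilities whose ratio is at most
   [1 + variation P k / delta]. *)
Definition ratio_bound n : R := \prod_(k < n) (1 + variation P k / delta) ^+ 2.

Let d0 : 0 < delta. Proof. by case: Pr. Qed.

Lemma variation_ge0 k : 0 <= variation P k.
Proof.
apply: le_trans (variation_ub Pk ord0 [tuple ord0 | _ < k] (fun=> ord0) (fun=> ord0)).
exact: normr_ge0.
Qed.

(** Stationarity lets the word be read one step later: its most recent letter becomes the symbol at
    0 and the others its past, where compatibility applies. *)
Lemma past_word_step (mu : law) n a (w : n.-tuple A) :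
  stationary mu -> compatible P mu ->
  mean mu (fun x : seq_space A int => (past_word n.+1 x == cons_tuple a w)%:R) =
  mean mu (fun x : seq_space A int => P a (past_of x) * (past_word n x == w)%:R).
Proof.
move=> st cp.
pose B : set past := [set x | [tuple x i | i < n] = w].
have mB : measurable (B : set (seq_space A nat)).
  apply: (measurable_local (countable_alphabet m) (@measurable_alphabet m) (J := iota 0 n)).
  move=> x y xy; rewrite /B/=; congr (_ = _).
  by apply: eq_from_tnth => i; rewrite !tnth_mktuple xy// mem_iota /=.
have BE (x : int -> A) : (\1_B (past_of x) : R) = (past_word n x == w)%:R.
  rewrite indicE; congr (nat_of_bool _)%:R; apply/idP/eqP; first by rewrite inE.
  by move=> h; rewrite inE.
have := compatible_mean Pk Pr.2 a cp mB.
under eq_mean do rewrite BE.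
under [RHS]eq_mean do rewrite BE.
move=> <-.
rewrite -(stationary_mean st (bounded_mfun_past_word (fun t => (t == cons_tuple a w)%:R))).
apply: eq_mean => x; rewrite -natrM mulnb; congr (nat_of_bool _)%:R.
apply/eqP/andP => [h|[/eqP h0 /eqP h]].
  split; first by have := congr1 (fun t => tnth t ord0) h; rewrite tnth_mktuple /past_of /shift_seq tnth0 => /eqP.
  apply/eqP/eq_from_tnth => i; have := congr1 (fun t => tnth t (lift ord0 i)) h.
  rewrite !tnth_mktuple tnthS => <-; rewrite /past_of /shift_seq.
  by congr x; rewrite lift0; lia.
apply: eq_from_tnth => i; rewrite tnth_mktuple /past_of /shift_seq.
case: (unliftP ord0 i) => [j ->|->]; last by rewrite tnth0.
rewrite tnthS -h tnth_mktuple /past_of lift0; congr x; lia.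
Qed.

(** Once [w] is fixed, the kernel is within [variation P n] of the reference value [ps]. Replacing
    it by [ps] under [nu] and then [ps] by it under [mu] costs two factors [r], hence the square in
    [ratio_bound]. *)
Lemma past_word_ratio (mu nu : law) n (w : n.-tuple A) :
  stationary mu -> compatible P mu -> stationary nu -> compatible P nu ->
  mean nu (fun x : seq_space A int => (past_word n x == w)%:R) <=
  ratio_bound n * mean mu (fun x : seq_space A int => (past_word n x == w)%:R).
Proof.
move=> smu cmu snu cnu; elim: n w => [|n IH] w.
  rewrite /ratio_bound big_ord0 mul1r le_eqVlt; apply/orP; left; apply/eqP.
  rewrite (@eq_mean _ _ _ nu _ (fun=> 1)); last by move=> x; rewrite tuple0 (tuple0 w) eqxx.
  rewrite (@eq_mean _ _ _ mu _ (fun=> 1)); last by move=> x; rewrite tuple0 (tuple0 w) eqxx.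
  by rewrite !mean_cst.
case/tupleP: w => a w.
rewrite (past_word_step a w smu cmu) (past_word_step a w snu cnu).
pose ps := P a (prepend w (fun=> ord0)); set r := 1 + variation P n / delta.
have v0 := variation_ge0 n.
have r1 : 1 <= r by rewrite lerDl divr_ge0// ltW.
have close (x : int -> A) : past_word n x = w -> `|P a (past_of x) - ps| <= variation P n.
  move=> xw; apply: variation_agree => // i iN; rewrite prepend_lt// -xw.
  by rewrite -[i in RHS]/(nat_of_ord (Ordinal iN)) -tnth_nth tnth_mktuple.
(* Non-nullness turns the additive error into a multiplicative one: [variation P n] is at most
   [q * (variation P n / delta)]. *)
have up p q : delta <= q -> `|p - q| <= variation P n -> p <= q * r.
  move=> dq /(le_trans (ler_norm _)); rewrite lerBlDl => /le_trans; apply.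
  rewrite mulrDr mulr1 lerD2l mulrCA ler_peMr// ler_pdivlMr// mul1r.
  exact: dq.
have bw := bounded_mfun_past_word (fun t => (t == w)%:R).
have bPw : bounded_mfun (fun x : seq_space A int => P a (past_of x) * (past_word n x == w)%:R).
  by apply: bounded_mfunM => //; exact: bounded_mfun_kernel_past Pr.2 _.
have hnu : mean nu (fun x : seq_space A int => P a (past_of x) * (past_word n x == w)%:R) <=
    ps * r * mean nu (fun x : seq_space A int => (past_word n x == w)%:R).
  rewrite -meanZ//; apply: mean_le => //; first exact: bounded_mfunZ.
  move=> x; case: eqP => [xw|]; rewrite ?mulr0// !mulr1.
  by apply: up; [exact: kernel_inf|exact: close].
have hmu : ps * mean mu (fun x : seq_space A int => (past_word n x == w)%:R) <=
    r * mean mu (fun x : seq_space A int => P a (past_of x) * (past_word n x == w)%:R).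
  rewrite -!meanZ//; apply: mean_le => //; [exact: bounded_mfunZ|exact: bounded_mfunZ|].
  move=> x; case: eqP => [xw|]; rewrite ?mulr0// !mulr1 mulrC.
  by apply: up; [exact: kernel_inf|rewrite distrC; exact: close].
have ps0 : 0 <= ps by have [/(_ a (prepend w (fun=> ord0)))/andP[]] := Pk.
have r0 : 0 <= r by rewrite (le_trans ler01).
have K0 : 0 <= ratio_bound n by apply: prodr_ge0 => k _; exact: sqr_ge0.
rewrite /ratio_bound big_ord_recr /= -/(ratio_bound n) -/r.
apply: le_trans hnu _.
apply: le_trans (ler_wpM2l (mulr_ge0 ps0 r0) (IH w)) _.
rewrite (_ : ps * r * (ratio_bound n * mean mu (fun x : seq_space A int => (past_word n x == w)%:R)) = ratio_bound n * r *
   (ps * mean mu (fun x : seq_space A int => (past_word n x == w)%:R))); last by ring.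
by rewrite expr2 !mulrA -mulrA [leRHS](_ : _ = ratio_bound n * r * (r * mean mu (fun x : seq_space A int => P a (past_of x) * (past_word n x == w)%:R))) ?ler_wpM2l ?mulr_ge0//; ring.
Qed.

Lemma past_fun_ratio (mu nu : law) n (c : n.-tuple A -> R) :
  stationary mu -> compatible P mu -> stationary nu -> compatible P nu ->
  (forall t, 0 <= c t) ->
  mean nu (fun x : seq_space A int => c (past_word n x)) <=
  ratio_bound n * mean mu (fun x : seq_space A int => c (past_word n x)).
Proof.
move=> smu cmu snu cnu c0.
have E (la : law) : mean la (fun x : seq_space A int => c (past_word n x)) =
    \sum_t c t * mean la (fun x : seq_space A int => (past_word n x == t)%:R).
  transitivity (mean la (fun x : seq_space A int => \sum_t c t * (past_word n x == t)%:R)).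
    apply: eq_mean => x; rewrite (bigD1 (past_word n x))//= eqxx mulr1 big1 ?addr0// => t.
    by rewrite eq_sym => /negPf ->; rewrite mulr0.
  rewrite mean_sum => [|t]; last by apply: bounded_mfunZ; exact: (bounded_mfun_past_word (fun s => (s == t)%:R)).
  apply: eq_bigr => t _; rewrite meanZ//.
  exact: (bounded_mfun_past_word (fun s => (s == t)%:R)).
rewrite !E mulr_sumr; apply: ler_sum => t _; rewrite mulrCA ler_wpM2l//.
exact: past_word_ratio.
Qed.

(** The variations tend to 0, so all factors but the first [k0] are at most [expR eta]; these first
    factors make up [M]. *)
Lemma ratio_bound_growth (eta : R) : 0 < eta -> exists2 M, 0 <= M &
  forall n, ratio_bound n <= M * expR (eta * n%:R).
Proof.
(* The threshold is [eta * delta / 2], because each factor is a square and costs [expR (eta / 2)]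
   twice. *)
move=> e0; have [k0 hk] := variation_small Pr.2 (divr_gt0 (mulr_gt0 e0 d0) (ltr0Sn R 1)).
have f1 k : 1 <= (1 + variation P k / delta) ^+ 2.
  by rewrite exprn_ege1// lerDl divr_ge0 ?variation_ge0// ltW.
have K0 n : 0 <= ratio_bound n by apply: prodr_ge0 => k _; exact: sqr_ge0.
have Kmono n k : ratio_bound n <= ratio_bound (n + k).
  elim: k => [|k IH]; rewrite ?addn0// addnS /ratio_bound big_ord_recr /=.
  by apply: le_trans IH _; rewrite -[leLHS]mulr1 ler_wpM2l.
exists (ratio_bound k0) => // n; apply: le_trans (Kmono n k0) _; rewrite addnC.
elim: n => [|n IH]; first by rewrite addn0 mulr0 expR0 mulr1.
rewrite addnS /ratio_bound big_ord_recr /= -/(ratio_bound _).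
rewrite -natr1 mulrDr mulr1 expRD [leRHS]mulrA ler_pM// ?sqr_ge0//.
have -> : expR eta = expR (eta / 2) ^+ 2 by rewrite -expRM_natl -mulr_natl mulrC divfK.
rewrite ler_pXn2r ?nnegrE ?expR_ge0//; last first.
  by rewrite addr_ge0// divr_ge0 ?variation_ge0// ltW.
apply: le_trans (expR_ge1Dx _); rewrite lerD2l ler_pdivrMr//.
apply: le_trans (hk _ (leq_addr _ _)) _; rewrite le_eqVlt; apply/orP; left; apply/eqP.
by ring.
Qed.

End word_ratio.

(** * Concentration implies uniqueness *)

Lemma sum_window_left N j L :
  (\sum_(i < N) ((i <= j) && (j < i + L)) <= L)%N.
Proof.
elim: L => [|L IH].
  by rewrite big1// => i _; rewrite addn0; case: leqP => //= ij; case: ltnP => //; lia.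
have one : (\sum_(i < N) (i + L == j)%N <= 1)%N.
  suff -> : (\sum_(i < N) (i + L == j)%N)%N = (L <= j < N + L)%N by case: (_ && _).
  elim: N {IH} => [|N IHN]; first by rewrite big_ord0; case: (leqP L j) => //=; case: ltnP => //; lia.
  rewrite big_ord_recr /= IHN addSn ltnS [(j <= N + L)%N]leq_eqVlt.
  case: (eqVneq (N + L)%N j) => [<-|] /=; first by rewrite ltnn leq_addl ?eqxx.
  by move=> /negPf ne; rewrite ?addn0 ?[(j == _)%N]eq_sym ?ne ?addn0.
apply: (leq_trans (n := \sum_(i < N) ((i <= j) && (j < i + L)) + \sum_(i < N) (i + L == j)%N)).
  rewrite -big_split; apply: leq_sum => i _; rewrite addnS ltnS [(_ + _ == _)%N]eq_sym.
  by case: (leqP i j) => //= _; case: ltngtP.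
by rewrite -[L.+1]addn1 leq_add.
Qed.

Lemma sum_window_right N j L :
  (\sum_(p < N) ((j <= p) && (p < j + L)) <= L)%N.
Proof.
elim: L => [|L IH].
  by rewrite big1// => i _; rewrite addn0; case: leqP => //= ij; case: ltnP => //; lia.
have one : (\sum_(i < N) (nat_of_ord i == j + L)%N <= 1)%N.
  suff -> : (\sum_(i < N) (nat_of_ord i == j + L)%N)%N = (j + L < N)%N by case: (_ < _)%N.
  elim: N {IH} => [|N IHN]; first by rewrite big_ord0.
  by rewrite big_ord_recr /= IHN ltnS; case: (ltngtP (j + L)%N N).
apply: (leq_trans (n := \sum_(i < N) ((j <= i) && (i < j + L)) + \sum_(i < N) (nat_of_ord i == j + L)%N)).
  rewrite -big_split; apply: leq_sum => i _; rewrite addnS ltnS.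
  by case: (leqP j i) => //= _; case: ltngtP.
by rewrite -[L.+1]addn1 leq_add.
Qed.

Section concentration_uniqueness.
Context (R : realType) (m : nat).
Notation A := 'I_m.+1.
Notation law := (probability (seq_space A int) R).
Variables (L : nat) (h : (int -> A) -> R).
Hypothesis (hloc : local_on [seq (i.+1)%:Z | i <- iota 0 L] h).
Hypothesis (h01 : forall x, 0 <= h x <= 1).

Definition average N (x : int -> A) : R :=
  N%:R^-1 * \sum_(i < N) h (iter i (@shift_seq _ A) x).

(** Places letter [k] at coordinate [k.+1], as [block] does; the averages never read the filler
    [ord0]. *)
Definition extend n (t : n.-tuple A) : int -> A :=
  fun z => if z is Posz k.+1 then nth ord0 t k else ord0.

Definition block_average N (t : (N + L).-tuple A) : R := average N (extend t).

Lemma h_norm x : `|h x| <= 1.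
Proof. by have /andP[h0 h1] := h01 x; rewrite ger0_norm. Qed.

Lemma h_norm2 x y : `|h x - h y| <= 1.
Proof. by have := h01 x; have := h01 y; rewrite ler_norml; lra. Qed.

Lemma bounded_mfun_h : bounded_mfun (h : seq_space A int -> R).
Proof.
exact: (bounded_mfun_local (countable_alphabet m) (@measurable_alphabet m) hloc h_norm).
Qed.

Lemma average_block N x : average N x = block_average (block (N + L) x).
Proof.
congr (_ * _); apply: eq_bigr => i _; apply: hloc => z /mapP[k].
rewrite mem_iota /= add0n => kL ->; rewrite !iter_shift.
have kN : (k + i < N + L)%N by rewrite addnC; have := ltn_ord i; lia.
have -> : (k.+1%:Z + i%:Z) = (k + i).+1%:Z by lia.
by rewrite -[RHS](tnth_nth ord0 (block (N + L) x) (Ordinal kN)) tnth_mktuple.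
Qed.

Lemma local_block n : local_on [seq (i.+1)%:Z | i <- iota 0 n] (@block m n).
Proof.
move=> x y xy; apply: eq_from_tnth => i; rewrite !tnth_mktuple xy//.
by apply/mapP; exists (nat_of_ord i) => //; rewrite mem_iota /=.
Qed.

Lemma local_average N : local_on [seq (i.+1)%:Z | i <- iota 0 (N + L)] (average N).
Proof. by move=> x y xy; rewrite !average_block (local_block xy). Qed.

Lemma average_ge0 N x : 0 <= average N x.
Proof.
rewrite mulr_ge0 ?invr_ge0// sumr_ge0// => i _; by have /andP[] := h01 (iter i (@shift_seq _ A) x).
Qed.

Lemma average_le1 N x : average N x <= 1.
Proof.
have [->|N0] := posnP N; first by rewrite /average invr0 mul0r.
rewrite /average ler_pdivrMl ?ltr0n// mulr1.
apply: (le_trans (y := \sum_(i < N) 1)).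
  by apply: ler_sum => i _; have /andP[] := h01 (iter i (@shift_seq _ A) x).
by rewrite sumr_const card_ord.
Qed.

Lemma bounded_mfun_average N : bounded_mfun (average N : seq_space A int -> R).
Proof.
apply: bounded_mfunZ; apply: bounded_mfun_sum => i.
exact: (bounded_mfun_iter_shift i bounded_mfun_h).
Qed.

Lemma mean_average (mu : law) N : stationary mu -> (0 < N)%N ->
  mean mu (average N) = mean mu h.
Proof.
move=> st N0; rewrite meanZ; last first.
  by apply: bounded_mfun_sum => i; exact: (bounded_mfun_iter_shift i bounded_mfun_h).
rewrite mean_sum; last by move=> i; exact: (bounded_mfun_iter_shift i bounded_mfun_h).
under eq_bigr => i _ do rewrite (stationary_mean_iter i st bounded_mfun_h).
rewrite sumr_const card_ord -[mean mu h *+ N]mulr_natl mulKf//.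
by rewrite pnatr_eq0 -lt0n.
Qed.

(** A letter enters at most [L] of the [N] windows, and each window contributes at most [1 / N]. *)
Lemma osc_average N (j : 'I_(N + L)) : osc (@block_average N) j <= L%:R / N%:R.
Proof.
apply: osc_le => a b ab.
rewrite -mulrBr -sumrB normrM mulrC [X in _ * X]ger0_norm ?invr_ge0// ler_wpM2r ?invr_ge0//.
apply: le_trans (ler_norm_sum _ _ _) _.
apply: (le_trans (y := (\sum_(i < N) ((i <= j) && (j < i + L)))%N%:R)); last first.
  by rewrite ler_nat sum_window_left.
rewrite natr_sum; apply: ler_sum => i _.
case: (boolP ((i <= j)%N && (j < i + L)%N)) => [_|ij]; first exact: h_norm2.
rewrite (_ : h _ = h (iter i (@shift_seq _ A) (extend b))) ?subrr ?normr0//.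
apply: hloc => z /mapP[k]; rewrite mem_iota /= add0n => kL ->; rewrite !iter_shift.
have kN : (k + i < N + L)%N by rewrite addnC; have := ltn_ord i; lia.
have -> : (k.+1%:Z + i%:Z) = (k + i).+1%:Z by lia.
rewrite /= -[(k + i)%N]/(nat_of_ord (Ordinal kN)) -!tnth_nth ab//.
by rewrite -val_eqE /=; apply: contraNneq ij => <-; lia.
Qed.

(** The total oscillation of the average depends on [N], while [g] is arbitrary in that variable.
    Rescaling to total oscillation 1 leaves a single value [g e' 1] to serve for all [N]. *)
Lemma concentration_average (mu : law) (e : R) : stationary mu ->
  exponential_concentration mu -> 0 < e ->
  exists C gamma : R, [/\ 0 <= C, 0 < gamma & forall N, (0 < N)%N ->
    (mu [set x : int -> A | (e < `|average N x - mean mu h|)%R] <= (C * expR (- (gamma * N%:R)))%:E)%E].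
Proof.
move=> st [C [g [gpos conc]]] e0.
(* For [N] positive, [N + L] oscillations of size at most [L / N] add up to at most [L.+1 * L];
   adding 1 keeps [Lam] positive when [L = 0]. *)
pose Lam : R := (L.+1 * L)%:R + 1.
have Lam0 : 0 < Lam by rewrite ltr_wpDl.
pose e' := e / Lam; have e'0 : 0 < e' by rewrite divr_gt0.
have g0 : 0 < g e' 1 by exact: gpos.
exists `|C|, (g e' 1 * e / (L%:R + 1)); split => //.
  by rewrite divr_gt0// ?mulr_gt0// ltr_wpDl.
move=> N N0; have N0R : 0 < N%:R :> R by rewrite ltr0n.
set f := @block_average N.
have mf x : f (block (N + L) x) = average N x by rewrite [RHS]average_block.
have mfE : mean mu (f \o block (N + L)) = mean mu h.
  by rewrite -(mean_average st N0); apply: eq_mean => x /=; rewrite mf.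
set l1 := osc_l1 f; have l1_ge0 : 0 <= l1 := osc_l1_ge0 f.
have dev x : `|average N x - mean mu h| <= l1.
  rewrite -(mean_average st N0) -(mean_cst mu (average N x)) -meanB; last 2 first.
  - exact: bounded_mfun_cst.
  - exact: bounded_mfun_average.
  apply: le_trans (mean_norm _ _) _.
    by apply: bounded_mfunB; [exact: bounded_mfun_cst|exact: bounded_mfun_average].
  rewrite -(mean_cst mu l1); apply: mean_le.
  - apply: bounded_mfun_norm; apply: bounded_mfunB; [exact: bounded_mfun_cst|exact: bounded_mfun_average].
  - exact: bounded_mfun_cst.
  - by move=> y; rewrite -!mf; exact: osc_total.
(* A deviation never exceeds [l1], so the event is empty when [l1 < e]; otherwise [l1^-1 <= e^-1],
   which controls the rescaled oscillations. *)
have [l1e|el1] := ltP l1 e.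
  rewrite (_ : [set x | _] = set0) ?measure0 ?lee_fin ?mulr_ge0 ?expR_ge0//.
  by apply/seteqP; split => // x /=; rewrite ltNge (le_trans (dev x))// ltW.
have l1_gt0 : 0 < l1 by apply: lt_le_trans el1.
have l1Lam : l1 <= Lam.
  apply: (le_trans (y := \sum_(j < N + L) (L%:R / N%:R))).
    by apply: ler_sum => j _; exact: osc_average.
  rewrite sumr_const card_ord -[leLHS]mulr_natl mulrA ler_pdivrMr// -natrM.
  rewrite /Lam natr1 -natrM ler_nat; nia.
pose ft (t : (N + L).-tuple A) : R := l1^-1 * f t.
have l1i : 0 < l1^-1 by rewrite invr_gt0.
have oft j : osc ft j = l1^-1 * osc f j by exact: osc_scale.
have l1ft : osc_l1 ft = 1.
  by rewrite /osc_l1; under eq_bigr do rewrite oft; rewrite -mulr_sumr mulVf// gt_eqF.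
have bf : bounded_mfun (fun x : seq_space A int => f (block (N + L) x)).
  by have := bounded_mfun_average N; congr bounded_mfun; apply/funext => x; rewrite mf.
have sub : [set x : int -> A | e < `|average N x - mean mu h|] `<=`
    [set x : int -> A | e' < `|ft (block (N + L) x) - fine 'E_mu[ft \o block (N + L)]%E|].
  move=> x /= ex.
  rewrite mean_expectation /ft (meanZ mu l1^-1 bf) -mulrBr normrM gtr0_norm// mfE mf.
  rewrite mulrC ltr_pdivlMr// (le_lt_trans _ ex)// /e' mulrAC ler_pdivrMr//.
  by rewrite ler_wpM2l// ltW.
have nc : exists a b, ft a <> ft b.
  apply: contrapT => nc; move: l1ft; rewrite /osc_l1 big1 => [/esym/eqP|j _].
    by rewrite oner_eq0.
  apply/eqP; rewrite eq_le osc_ge0 andbT; apply: osc_le => a b _.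
  have -> : ft a = ft b by apply: contrapT => h1; apply: nc; exists a, b.
  by rewrite subrr normr0.
have NL : (0 < N + L)%N by rewrite addn_gt0 N0.
have mset (D : (N + L).-tuple A -> Prop) :
    measurable ([set x | D (block (N + L) x)] : set (seq_space A int)).
  apply: (measurable_local (countable_alphabet m) (@measurable_alphabet m)
    (J := [seq (i.+1)%:Z | i <- iota 0 (N + L)])) => x y xy /=.
  by rewrite (local_block xy).
apply: (le_trans (le_measure mu _ _ sub)); rewrite ?inE.
- rewrite (_ : [set x | _] = [set x : int -> A | e < `|f (block (N + L) x) - mean mu h|]).
    exact: (mset (fun t => e < `|f t - mean mu h|)).
  by apply/seteqP; split => x /=; rewrite mf.
- exact: (mset (fun t => e' < `|ft t - fine 'E_mu[ft \o block (N + L)]%E|)).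
apply: (le_trans (conc _ _ ft NL e'0 nc)); rewrite lee_fin l1ft.
apply: (le_trans (ler_wpM2r (expR_ge0 _) (ler_norm C))).
rewrite ler_wpM2l// ler_expR lerN2.
(* The sum of squares is at most the largest oscillation times the sum of the oscillations, which is
   now 1. *)
have l2 : osc_l2_sq ft <= (L%:R + 1) / (N%:R * e).
  rewrite /osc_l2_sq.
  apply: (le_trans (y := \sum_j (l1^-1 * (L%:R / N%:R)) * osc ft j)).
    apply: ler_sum => j _; rewrite expr2 ler_wpM2r ?osc_ge0// oft ler_wpM2l ?(ltW l1i)//.
    exact: osc_average.
  rewrite -mulr_sumr -/(osc_l1 ft) l1ft mulr1 invfM mulrCA mulrC.
  rewrite [leRHS]mulrC [l1^-1 / _]mulrC.
  rewrite ler_pM ?lerDl ?mulr_ge0 ?invr_ge0 ?ler0n ?(ltW l1_gt0)//.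
  by rewrite ler_wpM2l ?invr_ge0 ?ler0n// lef_pV2 ?posrE.
have l2_gt0 : 0 < osc_l2_sq ft.
  rewrite lt_neqAle sumr_ge0 ?andbT => [|j _]; last exact: sqr_ge0.
  apply/eqP => /esym/eqP; rewrite psumr_eq0 => [/allP z|j _]; last exact: sqr_ge0.
  move: l1ft; rewrite /osc_l1 big1 => [/esym/eqP|j _]; first by rewrite oner_eq0.
  by apply/eqP; have := z j (mem_index_enum j); rewrite /= sqrf_eq0.
rewrite ler_pdivlMr//.
apply: (le_trans (ler_wpM2l _ l2)).
  by rewrite !mulr_ge0 ?invr_ge0 ?addr_ge0// ltW.
rewrite le_eqVlt; apply/orP; left; apply/eqP; field.
by rewrite !gt_eqF// ltr_wpDl.
Qed.

End concentration_uniqueness.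

Section uniqueness.
Context (R : realType) (m : nat) (P : 'I_m.+1 -> (nat -> 'I_m.+1) -> R).
Notation A := 'I_m.+1.
Notation law := (probability (seq_space A int) R).
Hypotheses (Pk : is_prob_kernel P) (Pr : regular_kernel P).

Lemma concentration_unique_local (mu nu : law) L (h : (int -> A) -> R) :
  stationary mu -> compatible P mu -> stationary nu -> compatible P nu ->
  exponential_concentration mu ->
  local_on [seq (i.+1)%:Z | i <- iota 0 L] h -> (forall x, 0 <= h x <= 1) ->
  mean nu h = mean mu h.
Proof.
move=> smu cmu snu cnu conc hloc h01.
apply/eqP; rewrite -subr_eq0 -normr_le0; apply/ler_addgt0Pl => e e0; rewrite addr0.
have e20 : 0 < e / 2 by rewrite divr_gt0.
have [C [gam [C0 g0 hC]]] := concentration_average hloc h01 smu conc e20.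
have g20 : 0 < gam / 2 by rewrite divr_gt0.
(* Half of the concentration rate: the density ratio then consumes only half of the exponential
   decay. *)
have [M M0 hM] := ratio_bound_growth Pk Pr g20.
pose dev (N : nat) (x : int -> A) : R := (e / 2 < `|average h N x - mean mu h|)%R%:R.
have bh := bounded_mfun_h hloc h01.
have bd N : bounded_mfun (fun x : seq_space A int => average h N x - mean mu h).
  by apply: bounded_mfunB; [exact: (bounded_mfun_average hloc h01)|exact: bounded_mfun_cst].
pose c N (t : (N + L).-tuple A) : R := (e / 2 < `|block_average h t - mean mu h|)%R%:R.
(* [block] lists letters in order of time and [past_word] most recent first, hence the reversal. *)
pose c' N (t : (N + L).-tuple A) : R := c N [tuple tnth t (rev_ord i) | i < N + L].
have devE N x : dev N x = c' N (past_word (N + L) (iter (N + L).+1 (@shift_seq _ A) x)).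
  rewrite /dev (average_block hloc).
  have -> : block (N + L) x = [tuple tnth (past_word (N + L)
      (iter (N + L).+1 (@shift_seq _ A) x)) (rev_ord i) | i < N + L].
    apply: eq_from_tnth => i; rewrite !tnth_mktuple /past_of iter_shift.
    by congr x; rewrite /=; have := ltn_ord i; lia.
  by [].
have dev_mean N (la : law) : stationary la ->
    mean la (dev N) = mean la (fun x : seq_space A int => c' N (past_word (N + L) x)).
  move=> sl; rewrite -(stationary_mean_iter (N + L).+1 sl (bounded_mfun_past_word (@c' N))).
  by apply: eq_mean => x; rewrite devE.
have bdev N : bounded_mfun (dev N : seq_space A int -> R).
  rewrite (_ : dev N = fun x => c' N (past_word (N + L) (iter (N + L).+1 (@shift_seq _ A) x))).
    exact: (bounded_mfun_iter_shift (N + L).+1 (bounded_mfun_past_word (@c' N))).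
  by apply/funext => x; rewrite devE.
have devmu N : (0 < N)%N -> mean mu (dev N) <= C * expR (- (gam * N%:R)).
  move=> N0; rewrite -lee_fin; apply: le_trans (hC N N0).
  rewrite (_ : dev N = \1_[set x : int -> A | e / 2 < `|average h N x - mean mu h|]); last first.
    apply/funext => x; rewrite /dev indicE; congr (nat_of_bool _)%:R.
    by apply/idP/idP; rewrite inE.
  rewrite -mean_indicE//.
  apply: (measurable_local (countable_alphabet m) (@measurable_alphabet m)
    (J := [seq (i.+1)%:Z | i <- iota 0 (N + L)])) => x y xy /=.
  by rewrite (local_average hloc xy).
have devnu N : (0 < N)%N ->
    mean nu (dev N) <= M * C * expR (gam / 2 * L%:R) * expR (- (gam / 2 * N%:R)).
  move=> N0; rewrite dev_mean//.
  have c0 t : 0 <= c' N t by exact: ler0n.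
  apply: (le_trans (past_fun_ratio Pk Pr smu cmu snu cnu c0)).
  rewrite -dev_mean//.
  apply: (le_trans (y := M * expR (gam / 2 * (N + L)%:R) * (C * expR (- (gam * N%:R))))).
    apply: ler_pM => //.
    - by apply: prodr_ge0 => k _; exact: sqr_ge0.
    - by apply: mean_ge0 => x; exact: ler0n.
    - exact: devmu.
  rewrite natrD mulrDr expRD le_eqVlt; apply/orP; left; apply/eqP.
  have -> : gam * N%:R = gam / 2 * N%:R + gam / 2 * N%:R by field.
  rewrite opprD expRD.
  have := expRxMexpNx_1 (gam / 2 * N%:R) => E.
  transitivity (M * C * expR (gam / 2 * L%:R) * expR (- (gam / 2 * N%:R)) *
     (expR (gam / 2 * N%:R) * expR (- (gam / 2 * N%:R)))); first by ring.
  by rewrite E mulr1.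
set D := M * C * expR (gam / 2 * L%:R) in devnu.
have D0 : 0 <= D by rewrite !mulr_ge0 ?expR_ge0.
(* Large enough for [D <= e / 2 * (gam / 2 * N)], which bounds the mean by [e / 2] since an
   exponential dominates its argument. *)
pose N := (Num.bound (D / (gam / 2 * (e / 2)))).+1.
have devN : mean nu (dev N) <= e / 2.
  apply: le_trans (devnu N isT) _; rewrite expRN ler_pdivrMr ?expR_gt0//.
  have N1 : D / (gam / 2 * (e / 2)) <= N%:R.
    apply: le_trans (ltW (archi_boundP _)) _; last by rewrite ler_nat.
    by rewrite divr_ge0// mulr_ge0// ltW.
  rewrite ler_pdivrMr ?mulr_gt0// in N1.
  apply: le_trans N1 _.
  rewrite (_ : N%:R * (gam / 2 * (e / 2)) = e / 2 * (gam / 2 * N%:R)); last by ring.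
  rewrite ler_wpM2l ?(ltW e20)//.
  by apply: le_trans (expR_ge1Dx _); rewrite lerDr.
rewrite -(mean_average hloc h01 snu (isT : (0 < N)%N)) -(mean_cst nu (mean mu h)) -meanB; last 2 first.
- exact: (bounded_mfun_average hloc h01).
- exact: bounded_mfun_cst.
apply: le_trans (mean_norm _ (bd N)) _.
apply: (le_trans (y := mean nu (fun x => e / 2 + dev N x))).
  apply: mean_le; first exact: bounded_mfun_norm.
    by apply: bounded_mfunD => //; exact: bounded_mfun_cst.
  (* On the bad event the deviation is at most 1, both quantities lying in [0, 1]; off it, it is at
     most [e / 2]. *)
  move=> x; rewrite /dev; case: ltP => [_|].
    have := average_ge0 h01 N x; have := average_le1 h01 N x.
    have m0 : 0 <= mean mu h by apply: mean_ge0 => y; have /andP[] := h01 y.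
    have m1 : mean mu h <= 1.
      rewrite -(mean_cst mu 1); apply: mean_le => //; first exact: bounded_mfun_cst.
      by move=> y; have /andP[] := h01 y.
    by move=> a1 a0; rewrite /= mulr1n ler_norml; apply/andP; split; move: e20 m0 m1 a0 a1; lra.
  by rewrite /= mulr0n addr0.
rewrite meanD//; last exact: bounded_mfun_cst.
by rewrite mean_cst [leRHS]splitr lerD2l.
Qed.

Lemma concentration_unique (mu nu : law) :
  stationary mu -> compatible P mu -> stationary nu -> compatible P nu ->
  exponential_concentration mu ->
  forall E : set (seq_space A int), measurable E -> nu E = mu E.
Proof.
move=> smu cmu snu cnu conc E mE.
apply: (law_ext (countable_alphabet m) (@measurable_alphabet m)) mE => J w.
have mC := @measurable_cylinder _ _ _ (countable_alphabet m) (@measurable_alphabet m) J w.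
rewrite !mean_indicE//; congr _%:E.
(* Shifting by [M] moves every coordinate of [J] to a positive one below [M + M]. *)
pose M := (\max_(j <- J) `|j|%N).+1.
pose h (x : int -> A) : R := \1_(cylinder J w) (iter M (@shift_seq _ A) x).
have bC := bounded_mfun_indic R mC.
rewrite -(stationary_mean_iter M smu bC) -(stationary_mean_iter M snu bC).
apply: (concentration_unique_local (L := M + M) smu cmu snu cnu conc (h := h)).
- move=> x y xy; apply: (local_on_indic R (@local_on_cylinder _ _ J w)) => j jJ.
  rewrite !iter_shift; apply: xy; apply/mapP.
  have jM : (`|j| < M)%N by rewrite ltnS; apply: (@leq_bigmax_seq _ J xpredT (fun j => `|j|%N)).
  exists (absz (j + M%:Z)).-1; last by lia.
  by rewrite mem_iota /=; lia.
- by move=> x; rewrite /h indicE; case: (_ \in _); rewrite ?lexx ?ler01.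
Qed.

End uniqueness.

(** * Bounded differences for i.i.d. sequences *)

(** Takes the place of Hoeffding's lemma: the linear term vanishes for a centred variable. Below 1/2
    compare with [(1 - y)^-1]; above it [y <= 2 * y ^+ 2]. *)
Lemma expR_le_quad (R : realType) (y : R) : expR y <= y + expR (2 * y ^+ 2).
Proof.
have q := expR_ge1Dx (2 * y ^+ 2).
have [y12|y12] := leP y (1 / 2); last first.
  by rewrite ler_wpDl ?ler_expR; nra.
have y1 : 0 < 1 - y by lra.
apply: (le_trans (y := (1 - y)^-1)).
  rewrite -[leLHS]invrK lef_pV2 ?posrE ?invr_gt0 ?expR_gt0// -expRN.
  exact: expR_ge1Dx.
apply: (le_trans (y := 1 + y + 2 * y ^+ 2)); last by lra.
by rewrite -[leLHS]mul1r ler_pdivrMr//; nra.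
Qed.

Section independent_coordinates.
Context d (U : measurableType d) (R : realType) (PU : probability (seq_space U int) R).
Hypotheses (cU : countable [set: U]) (dU : forall B : set U, measurable B).
Hypothesis iidU : iid PU.

Lemma iid_cylinder J w : uniq J ->
  PU (cylinder J w) = (\prod_(j <- J) PU [set x | x j = w j])%E.
Proof. by move=> uJ; rewrite -(iidU.1 J (fun j => [set w j]) uJ)//. Qed.

Lemma measurable_resample (j : int) :
  measurable_fun setT (fun z : seq_space U int * seq_space U int =>
    upd z.1 j (z.2 j) : seq_space U int).
Proof.
apply: measurable_seqP => i; rewrite /upd; case: (i == j).
  exact: (measurableT_comp (measurable_coord j) measurable_snd).
exact: (measurableT_comp (measurable_coord i) measurable_fst).
Qed.

(** Redrawing coordinate [j] from an independent copy does not change the law: a cylinder splits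
    into its part off [j] and its part at [j]. The inner mean in [resample] thus acts as a
    conditional expectation given the other coordinates. *)
Lemma resample_law (j : int) E : measurable (E : set (seq_space U int)) ->
  PU E = law_image (PU \x PU)%E (measurable_resample j) E.
Proof.
move=> mE; apply: (law_ext cU dU _ mE) => J w.
have -> : cylinder J w = cylinder (undup J) w.
  by apply/seteqP; split => x h i iJ; apply: h; move: iJ; rewrite mem_undup.
have := undup_uniq J; move: (undup J) => {}J uJ.
have mC K : measurable (cylinder K w : set (seq_space U int)).
  exact: measurable_cylinder.
pose F (z : seq_space U int * seq_space U int) : seq_space U int := upd z.1 j (z.2 j).
change (PU (cylinder J w) = (PU \x PU)%E (F @^-1` cylinder J w)).
have [jJ|jJ] := boolP (j \in J); last first.
  have -> : F @^-1` cylinder J w = cylinder J w `*` setT.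
    apply/seteqP; split => -[x y]; rewrite /F /=.
      move=> h; split => // i iJ; rewrite -h// updN//.
      by apply: contraNneq jJ => <-.
    move=> [h _] i iJ; rewrite updN ?h//.
    by apply: contraNneq jJ => <-.
  by rewrite [RHS]product_measure1E// [X in (_ * X)%E](probability_setT PU) mule1.
have -> : F @^-1` cylinder J w = cylinder (rem j J) w `*` cylinder [:: j] w.
  apply/seteqP; split => -[x y]; rewrite /F /=.
    move=> h; split => i; last by rewrite inE => /eqP ->; rewrite -h// updE.
    by rewrite mem_rem_uniq// !inE => /andP[ij iJ]; rewrite -h// updN.
  move=> [hx hy] i iJ; rewrite /upd; case: eqP => [->|/eqP ij].
    by rewrite hy// inE.
  by rewrite hx// mem_rem_uniq// !inE ij.
transitivity (PU (cylinder (rem j J) w) * PU (cylinder [:: j] w))%E; last first.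
  by rewrite [RHS]product_measure1E.
rewrite iid_cylinder// (iid_cylinder w (rem_uniq j uJ)).
by rewrite (@iid_cylinder [:: j] w isT) big_seq1 muleC (big_rem j).
Qed.

Lemma resample (j : int) (f : seq_space U int -> R) : bounded_mfun f ->
  mean PU f = mean PU (fun x => mean PU (fun y => f (upd x j (y j)))).
Proof.
move=> bf; rewrite (eq_mean_law _ (@resample_law j)) mean_law_image//.
have bfz := bounded_mfun_comp (measurable_resample j) bf.
have := integral12_prod_meas1 (bounded_mfun_integrable (PU \x PU)%E bfz).
rewrite /mean /Rintegral => <-; congr fine.
apply: eq_integral => x _; rewrite /fubini_F /= fineK//.
apply: (integrable_fin_num measurableT); apply: bounded_mfun_integrable.
have mx : measurable_fun setT (fun y : seq_space U int => upd x j (y j) : seq_space U int).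
  apply: measurable_seqP => i; rewrite /upd; case: (i == j) => //.
  exact: measurable_coord.
exact: (bounded_mfun_comp mx bf).
Qed.

(** Coordinate [j] is averaged out: the conditional mean [g] inherits the bounds [c] on the
    remaining coordinates, while the increment [D] is centred and at most [c j] in absolute value,
    so it contributes the factor [expR (2 * c j ^+ 2)]. *)
Lemma exp_moment (J : seq int) (f : (int -> U) -> R) (c : int -> R) M :
  uniq J -> local_on J f -> (forall x, `|f x| <= M) ->
  (forall x u j, j \in J -> `|f x - f (upd x j u)| <= c j) ->
  mean PU (fun x => expR (f x)) <= expR (mean PU f + 2 * \sum_(j <- J) c j ^+ 2).
Proof.
elim: J f => [|j J IH] f uJ fJ fM fc.
  have fE x : f x = f point by apply: fJ => i.
  rewrite big_nil mulr0 addr0 (eq_mean _ (g := fun=> expR (f point))); last by move=> x; rewrite fE.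
  by rewrite mean_cst (eq_mean _ (g := fun=> f point)) ?mean_cst.
move: uJ; rewrite cons_uniq => /andP[jJ uJ].
have bl K (h : (int -> U) -> R) N : local_on K h -> (forall x, `|h x| <= N) ->
    bounded_mfun (h : seq_space U int -> R).
  by move=> hK hN; apply: (bounded_mfun_local cU dU hK hN).
have bf : bounded_mfun (f : seq_space U int -> R) by exact: bl fJ fM.
have bfu x : bounded_mfun (fun y : seq_space U int => f (upd x j (y j))).
  by apply: (bl [:: j] _ M) => // y z yz; rewrite yz ?inE.
pose g (x : int -> U) := mean PU (fun y : seq_space U int => f (upd x j (y j))).
have gM x : `|g x| <= M.
  apply: le_trans (mean_norm _ (bfu x)) _; rewrite -(mean_cst PU M).
  by apply: mean_le; [exact: bounded_mfun_norm|exact: bounded_mfun_cst|].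
have gJ : local_on J g.
  move=> x z xz; apply: eq_mean => y; apply: fJ => i; rewrite inE /upd.
  by case: eqP => //= _; exact: xz.
have gc x u i : i \in J -> `|g x - g (upd x i u)| <= c i.
  move=> iJ; rewrite /g -meanB//.
  apply: le_trans (mean_norm _ _) _; first exact: bounded_mfunB.
  rewrite -(mean_cst PU (c i)); apply: mean_le.
  - by apply: bounded_mfun_norm; exact: bounded_mfunB.
  - exact: bounded_mfun_cst.
  - move=> y; have ij : j != i by apply: contraNneq jJ => ->.
    by rewrite (updC _ _ _ ij) fc// inE iJ orbT.
have bg : bounded_mfun (g : seq_space U int -> R) by exact: bl gJ gM.
rewrite big_cons mulrDr addrCA expRD.
have -> : mean PU f = mean PU g by rewrite (resample j bf).
apply: (le_trans (y := expR (2 * c j ^+ 2) * mean PU (fun x => expR (g x)))); last first.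
  by rewrite ler_wpM2l ?expR_ge0//; exact: IH.
have bef := bounded_mfun_expR bf.
rewrite (resample j bef) -meanZ; last exact: bounded_mfun_expR.
have beu x := bounded_mfun_expR (bfu x).
apply: mean_le.
- apply: (bl J _ (expR M)).
    move=> x z xz; apply: eq_mean => y; congr expR; apply: fJ => i; rewrite inE /upd.
    by case: eqP => //= _; exact: xz.
  move=> x; rewrite ger0_norm; last by apply: mean_ge0 => y; exact: expR_ge0.
  rewrite -(mean_cst PU (expR M)); apply: mean_le => //; first exact: bounded_mfun_cst.
  by move=> y; rewrite ler_expR (le_trans (ler_norm _)).
- by apply: bounded_mfunZ; exact: bounded_mfun_expR.
move=> x.
pose D (y : seq_space U int) : R := f (upd x j (y j)) - g x.
have bD : bounded_mfun D by apply: bounded_mfunB => //; exact: bounded_mfun_cst.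
have D0 : mean PU D = 0 by rewrite meanB ?mean_cst ?subrr//; exact: bounded_mfun_cst.
have Dc y : `|D y| <= c j.
  rewrite /D -(mean_cst PU (f (upd x j (y j)))) -meanB//; last exact: bounded_mfun_cst.
  apply: le_trans (mean_norm _ _) _.
    by apply: bounded_mfunB => //; exact: bounded_mfun_cst.
  rewrite -(mean_cst PU (c j)); apply: mean_le.
  - by apply: bounded_mfun_norm; apply: bounded_mfunB => //; exact: bounded_mfun_cst.
  - exact: bounded_mfun_cst.
  - move=> z; rewrite (_ : upd x j (z j) = upd (upd x j (y j)) j (z j)) ?fc ?inE ?eqxx//.
    by apply/funext => k; rewrite /upd; case: eqP.
have -> : mean PU (fun y : seq_space U int => expR (f (upd x j (y j)))) =
    expR (g x) * mean PU (fun y => expR (D y)).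
  rewrite -meanZ; last exact: bounded_mfun_expR.
  by apply: eq_mean => y; rewrite -expRD /D addrC subrK.
rewrite mulrC ler_wpM2r ?expR_ge0//.
apply: (le_trans (y := mean PU (fun y => D y + expR (2 * c j ^+ 2)))).
  apply: mean_le.
  - exact: bounded_mfun_expR.
  - by apply: bounded_mfunD => //; exact: bounded_mfun_cst.
  - move=> y; apply: le_trans (expR_le_quad _) _; rewrite lerD2l ler_expR ler_wpM2l//.
    by rewrite -real_normK ?num_real// ler_pXn2r ?nnegrE// (le_trans _ (Dc y)).
by rewrite meanD ?D0 ?add0r ?mean_cst//; exact: bounded_mfun_cst.
Qed.

Lemma bounded_differences (J : seq int) (f : (int -> U) -> R) (c : int -> R) M S e :
  uniq J -> local_on J f -> (forall x, `|f x| <= M) ->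
  (forall x u j, j \in J -> `|f x - f (upd x j u)| <= c j) ->
  \sum_(j <- J) c j ^+ 2 <= S -> 0 < e ->
  (PU [set x | (e < f x - mean PU f)%R] <=
    (expR (- (e ^+ 2 / (8 * S))))%:E)%E.
Proof.
move=> uJ fJ fM fc cS e0.
have bf : bounded_mfun (f : seq_space U int -> R) by exact: (bounded_mfun_local cU dU fJ fM).
have S0 : 0 <= S by apply: le_trans cS; apply: sumr_ge0 => j _; exact: sqr_ge0.
(* Minimises the Chernoff exponent [- la * e + 2 * la ^+ 2 * S], with value
   [- (e ^+ 2 / (8 * S))]. *)
pose la := e / (4 * S); have la0 : 0 <= la by rewrite divr_ge0 ?mulr_ge0// ltW.
set E := [set x | _].
have mE : measurable (E : set (seq_space U int)).
  by apply: (measurable_local cU dU (J := J)) => x y xy; rewrite /E/= (fJ _ _ xy).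
rewrite mean_indicE// lee_fin.
have bl : bounded_mfun (fun x : seq_space U int => la * f x) by exact: bounded_mfunZ.
apply: (le_trans (y := mean PU (fun x => expR (- (la * (mean PU f + e))) * expR (la * f x)))).
  apply: mean_le; first exact: bounded_mfun_indic.
    by apply: bounded_mfunZ; exact: bounded_mfun_expR.
  move=> x; rewrite indicE -expRD; case: (boolP (x \in E)) => [|_]; last exact: expR_ge0.
  rewrite inE /E /= => ex; rewrite -expR0 ler_expR.
  by rewrite addrC -mulrBr mulr_ge0// subr_ge0; lra.
rewrite meanZ; last exact: bounded_mfun_expR.
apply: (le_trans (ler_wpM2l (expR_ge0 _) (@exp_moment J (fun x => la * f x) (fun j => la * c j) (la * M) uJ _ _ _))).
- by move=> x y xy; rewrite (fJ _ _ xy).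
- by move=> x; rewrite normrM (ger0_norm la0) ler_wpM2l.
- by move=> x u j jJ; rewrite -mulrBr normrM (ger0_norm la0) ler_wpM2l// fc.
rewrite -expRD ler_expR meanZ//.
under eq_bigr => j _ do rewrite exprMn.
rewrite -mulr_sumr.
apply: (le_trans (y := - (la * (mean PU f + e)) + (la * mean PU f + 2 * (la ^+ 2 * S)))).
  by rewrite !lerD2l ler_wpM2l// ler_wpM2l// sqr_ge0.
rewrite /la.
(* The inverse of 0 is 0, so for [S = 0] the asserted bound is the trivial bound 1. *)
have [->|Sn0] := eqVneq S 0; first by rewrite !(mulr0, invr0, mul0r, expr0n, add0r, addr0, oppr0) /= ?mulr0.
rewrite le_eqVlt; apply/orP; left; apply/eqP; field.
exact: Sn0.
Qed.

Lemma iid_stationary : stationary PU.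
Proof.
apply: (stationary_cylinder cU dU) => J w.
have -> : cylinder J w = cylinder (undup J) w.
  by apply/seteqP; split => x h i iJ; apply: h; move: iJ; rewrite mem_undup.
have := undup_uniq J; move: (undup J) => {}J uJ.
have -> : @shift_seq _ U @^-1` cylinder J w =
    cylinder [seq j + 1 | j <- J] (fun i => w (i - 1)).
  apply/seteqP; split => x h i; first by move=> /mapP[j jJ ->]; rewrite addrK -(h j jJ).
  by move=> iJ; rewrite /shift_seq h ?addrK//; apply/mapP; exists i.
rewrite !iid_cylinder//; last by rewrite map_inj_uniq//; exact: addIr.
rewrite big_map; apply: eq_bigr => j _; rewrite addrK.
exact: (iidU.2 (j + 1) j [set w j]).
Qed.

End independent_coordinates.

(** * Finitary codings concentrate *)

(** Symmetrise the double sum on the right, then compare term by term through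
    [(o i - o j) ^+ 2 >= 0]. *)
Lemma weighted_cauchy (R : realFieldType) (n : nat) (a o : 'I_n -> R) :
  (forall i, 0 <= a i) ->
  (\sum_i a i * o i) ^+ 2 <= (\sum_i a i) * \sum_i a i * o i ^+ 2.
Proof.
move=> a0; rewrite expr2 !mulr_suml.
under eq_bigr => i _ do rewrite mulr_sumr.
under [leRHS]eq_bigr => i _ do rewrite mulr_sumr.
have sym : \sum_(i < n) \sum_(j < n) a i * (a j * o j ^+ 2) =
    \sum_(i < n) \sum_(j < n) a i * (a j * o i ^+ 2).
  by rewrite exchange_big /=; apply: eq_bigr => i _; apply: eq_bigr => j _; ring.
have -> : \sum_(i < n) \sum_(j < n) a i * (a j * o j ^+ 2) =
    \sum_(i < n) \sum_(j < n) a i * a j * ((o i ^+ 2 + o j ^+ 2) / 2).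
  transitivity ((\sum_(i < n) \sum_(j < n) a i * (a j * o j ^+ 2) +
      \sum_(i < n) \sum_(j < n) a i * (a j * o i ^+ 2)) / 2).
    by rewrite -sym; field.
  rewrite -big_split mulr_suml; apply: eq_bigr => i _.
  by rewrite -big_split mulr_suml; apply: eq_bigr => j _ /=; field.
apply: ler_sum => i _; apply: ler_sum => j _.
rewrite (_ : a i * o i * (a j * o j) = a i * a j * (o i * o j)); last by ring.
by rewrite ler_wpM2l ?mulr_ge0//; have := sqr_ge0 (o i - o j); nra.
Qed.

Section coding_concentration.
Context d (U : measurableType d) (R : realType) (m : nat).
Notation A := 'I_m.+1.
Variables (PU : probability (seq_space U int) R) (mu : probability (seq_space A int) R).
Hypotheses (cU : countable [set: U]) (dU : forall B : set U, measurable B).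
Hypothesis iidU : iid PU.
Variables (Phi : (int -> U) -> (int -> A)) (theta1 theta2 : (int -> U) -> option nat).
Hypothesis mPhi : measurable_fun setT (Phi : seq_space U int -> seq_space A int).
Hypothesis PhiS : forall u, Phi (shift_seq u) = shift_seq (Phi u).
Hypothesis muE : forall E : set (seq_space A int), measurable E -> mu E = PU (Phi @^-1` E).
Hypothesis theta_fin : {ae PU, forall u, theta1 u <> None /\ theta2 u <> None}.
Hypothesis theta_meas : forall k l : nat,
  <<s coord_sets [set i : int | - k%:Z <= i <= l%:Z] >>
    [set u | theta1 u = Some k /\ theta2 u = Some l].
Hypothesis theta_det : forall u v : int -> U,
  (forall i, in_window (theta1 u) (theta2 u) i -> u i = v i) -> Phi u 0 = Phi v 0.

Let G k : set (int -> U) := [set u | exists a b : nat,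
  [/\ (a <= k)%N, (b <= k)%N & theta1 u = Some a /\ theta2 u = Some b]].

Let window k : seq int := [seq i%:Z - k%:Z | i <- iota 0 (k + k).+1].

Let mem_window k (i : int) : - k%:Z <= i <= k%:Z -> i \in window k.
Proof.
move=> ik; apply/mapP; exists (absz (i + k%:Z)); last by lia.
by rewrite mem_iota /=; lia.
Qed.

(** Each joint event of the two radii is measurable in its own window, so whether both are at most
    [k] can be decided inside [window k]. This is what makes the truncated letter [Y k] local. *)
Let local_G k : local_on (window k) (G k).
Proof.
suff H x y : agree (window k) x y -> G k x -> G k y.
  by move=> x y xy; apply/propext; split; apply: H => //; exact: agree_sym.
move=> xy [a [b [ak bk tx]]]; exists a, b; split => //.
have := coord_sigma_sub (@theta_meas a b) (x := x) (y := y) _.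
rewrite /= => <-// i /andP[ia ib]; apply: xy; apply: mem_window.
by apply/andP; split; lia.
Qed.

Let Y k (u : int -> U) : A := if `[< G k u >] then Phi u 0 else ord0.

Let local_Y k : local_on (window k) (Y k).
Proof.
move=> x y xy; rewrite /Y (local_G xy); case: ifPn => // /asboolP Gy.
have : G k x by rewrite (local_G xy).
case=> a [b [ak bk [tx1 tx2]]]; apply: theta_det => i.
rewrite tx1 tx2 /in_window => /andP[ia ib]; apply: xy; apply: mem_window.
by apply/andP; split; lia.
Qed.

Let mG k : measurable (G k : set (seq_space U int)).
Proof. exact: (measurable_local cU dU (@local_G k)). Qed.

Let p k : R := mean PU \1_(~` G k).

Let p0 k : 0 <= p k.
Proof. by apply: mean_ge0 => u; rewrite indicE. Qed.

Let p_cvg : p k @[k --> \oo] --> 0.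
Proof.
pose B := \bigcap_k ~` G k.
have mB : measurable (B : set (seq_space U int)).
  by apply: bigcapT_measurable => k; apply: measurableC; exact: mG.
have -> : 0 = mean PU (\1_B : seq_space U int -> R).
  rewrite -[LHS](mean_cst PU); apply: eq_mean_ae.
  - exact: bounded_mfun_cst.
  - exact: bounded_mfun_indic.
  apply: ae_imply theta_fin => u [].
  case E1 : (theta1 u) => [a|//] _; case E2 : (theta2 u) => [b|//] _.
  rewrite indicE memNset// => /(_ (maxn a b) I); apply; exists a, b.
  by rewrite leq_maxl leq_maxr.
apply: (@mean_dominated _ _ _ _ _ _ 1).
- by move=> k; apply: measurable_indic; apply: measurableC; exact: mG.
- exact: measurable_indic.
- by move=> k u; rewrite indicE; case: (_ \in _); rewrite ?normr1 ?normr0.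
move=> u; apply: cvg_near_cst.
have [Bu|/existsNP[k /not_implyP[_ /contrapT [a [b [ak bk t]]]]]] := pselect (B u).
  by near=> k; rewrite !indicE !mem_set//; exact: Bu.
exists k => // n /= kn; rewrite !indicE !memNset//.
  by move=> /(_ k I); apply; exists a, b.
by apply; exists a, b; rewrite (leq_trans ak)// (leq_trans bk).
Unshelve. all: by end_near.
Qed.

Let Phi_iter j u : Phi (iter j (@shift_seq _ U) u) = iter j (@shift_seq _ A) (Phi u).
Proof. by elim: j => [//|j IH]; rewrite /= PhiS IH. Qed.

Section block_function.
Variables (n k : nat) (f : n.-tuple A -> R).

Let yblock (u : int -> U) : n.-tuple A := [tuple Y k (iter i.+1 (@shift_seq _ U) u) | i < n].
(* [H] is the truncated block function and [S] bounds its distance to the original;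
   both have bounded differences [c]. *)
Let H (u : int -> U) : R := f (yblock u).
Let S (u : int -> U) : R := \sum_(i < n) \1_(~` G k) (iter i.+1 (@shift_seq _ U) u) * osc f i.
Let J : seq int := [seq p%:Z - k%:Z | p <- iota 0 (n + (k + k)).+1].
Let near_site (i : nat) (z : int) : bool := (i.+1%:Z - k%:Z <= z <= i.+1%:Z + k%:Z).
Let c (z : int) : R := \sum_(i < n) (near_site i z)%:R * osc f i.

Let uniq_J : uniq J.
Proof. by rewrite map_inj_uniq ?iota_uniq// => a b; lia. Qed.

Let agree_iter x y (i : nat) : (forall z, near_site i z -> x z = y z) ->
  agree (window k) (iter i.+1 (@shift_seq _ U) x) (iter i.+1 (@shift_seq _ U) y).
Proof.
move=> h z zw; rewrite !iter_shift; apply: h.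
by move: zw => /mapP[q]; rewrite mem_iota /= add0n => qk ->; rewrite /near_site; lia.
Qed.

Let near_J i z : (i < n)%N -> near_site i z -> z \in J.
Proof.
move=> iN /andP[z1 z2]; apply/mapP; exists (absz (z + k%:Z)); last by lia.
by rewrite mem_iota /=; lia.
Qed.

Let upd_far x j u (i : nat) : ~~ near_site i j ->
  agree (window k) (iter i.+1 (@shift_seq _ U) x) (iter i.+1 (@shift_seq _ U) (upd x j u)).
Proof.
move=> ij; apply: agree_iter => z iz; rewrite updN//.
by apply: contraNneq ij => <-.
Qed.

Let local_H : local_on J H.
Proof.
move=> x y xy; congr f; apply: eq_from_tnth => i; rewrite !tnth_mktuple.
by apply: local_Y; apply: agree_iter => z iz; apply: xy; exact: near_J iz.
Qed.

Let local_S : local_on J S.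
Proof.
move=> x y xy; apply: eq_bigr => i _; congr (_ * _).
have := local_G (@agree_iter x y i _); rewrite !indicE => Gxy.
rewrite !in_setC; congr (~~ _)%:R; apply/idP/idP; rewrite !inE Gxy// => z iz;
  by apply: xy; exact: near_J iz.
Qed.

Let H_osc x u j : j \in J -> `|H x - H (upd x j u)| <= c j.
Proof.
move=> _; apply: le_trans (osc_telescope f _ _) _; apply: ler_sum => i _.
rewrite ler_wpM2r ?osc_ge0// !tnth_mktuple.
case: (boolP (near_site i j)) => [_|ij]; first by case: (_ != _).
by rewrite (local_Y (upd_far x u ij)) eqxx.
Qed.

Let S_osc x u j : j \in J -> `|S x - S (upd x j u)| <= c j.
Proof.
move=> _; rewrite /S -sumrB; apply: le_trans (ler_norm_sum _ _ _) _.
apply: ler_sum => i _; rewrite -mulrBl normrM [X in _ * X]ger0_norm ?osc_ge0//.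
rewrite ler_wpM2r ?osc_ge0//.
case: (boolP (near_site i j)) => [_|ij].
  by rewrite !indicE; do 2 case: (_ \in _); rewrite ?subrr ?subr0 ?sub0r ?normrN ?normr0 ?normr1.
have e := local_G (upd_far x u ij).
rewrite [X in X - _](_ : _ = \1_(~` G k) (iter i.+1 (@shift_seq _ U) (upd x j u))) ?subrr ?normr0//.
by rewrite !indicE !in_setC; congr (~~ _)%:R; apply/idP/idP; rewrite !inE e.
Qed.

(** A symbol influences at most [K] letters and a letter reads [K] symbols. Cauchy-Schwarz yields
    the first factor [K], exchanging the two sums the second. *)
Let c_sq : \sum_(j <- J) c j ^+ 2 <= ((k + k).+1%:R ^+ 2) * osc_l2_sq f.
Proof.
set K := (k + k).+1.
rewrite big_map -/(index_iota 0 (n + (k + k)).+1) big_mkord.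
pose a (q : nat) (i : 'I_n) : R := ((i.+1 <= q) && (q < i.+1 + K))%N%:R.
have ca (q : nat) : c (q%:Z - k%:Z) = \sum_(i < n) a q i * osc f i.
  apply: eq_bigr => i _; congr (_%:R * _); rewrite /near_site /K; lia.
apply: (le_trans (y := \sum_(q < (n + (k + k)).+1) K%:R * \sum_(i < n) a q i * osc f i ^+ 2)).
  apply: ler_sum => q _; rewrite ca; apply: le_trans (weighted_cauchy _ _) _; first by move=> i; exact: ler0n.
  rewrite ler_wpM2r//; first by apply: sumr_ge0 => i _; rewrite mulr_ge0// sqr_ge0.
  rewrite -natr_sum ler_nat; apply: leq_trans (sum_window_left n q.-1 K).
  by apply: leq_sum => i _; case: q => -[|q] //= _; lia.
rewrite -mulr_sumr exchange_big /= expr2 -mulrA ler_wpM2l//.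
rewrite mulr_sumr; apply: ler_sum => i _; rewrite -mulr_suml ler_wpM2r ?sqr_ge0//.
rewrite -natr_sum ler_nat; exact: sum_window_right.
Qed.

Let bound (g : (int -> U) -> R) : local_on J g -> (exists N, forall x, `|g x| <= N) ->
  bounded_mfun (g : seq_space U int -> R).
Proof. by move=> gJ [N gN]; exact: (bounded_mfun_local cU dU gJ gN). Qed.

Let fM : exists M, forall t, `|f t| <= M.
Proof.
exists (\sum_t `|f t|) => t; by rewrite (bigD1 t)//= lerDl sumr_ge0.
Qed.

Let bH : bounded_mfun (H : seq_space U int -> R).
Proof. by apply: bound local_H _; have [M hM] := fM; exists M => x; exact: hM. Qed.

Let S_le x : `|S x| <= osc_l1 f.
Proof.
apply: le_trans (ler_norm_sum _ _ _) _; apply: ler_sum => i _.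
rewrite normrM [X in _ * X]ger0_norm ?osc_ge0// -[leRHS]mul1r ler_wpM2r ?osc_ge0// indicE.
by case: (_ \in _); rewrite ?normr0 ?normr1.
Qed.

Let bS : bounded_mfun (S : seq_space U int -> R).
Proof. by apply: bound local_S _; exists (osc_l1 f) => x; exact: S_le. Qed.

Let bf : bounded_mfun (fun x : seq_space A int => f (block n x)).
Proof.
have [M hM] := fM.
apply: (bounded_mfun_local (countable_alphabet m) (@measurable_alphabet m)
  (J := [seq (i.+1)%:Z | i <- iota 0 n]) (M := M)) => [x y xy|x //].
by rewrite (local_block xy).
Qed.

Let bfPhi : bounded_mfun (fun u : seq_space U int => f (block n (Phi u))).
Proof. exact: (bounded_mfun_comp mPhi bf). Qed.

Let mean_S : mean PU S = p k * osc_l1 f.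
Proof.
have bG : bounded_mfun (\1_(~` G k) : seq_space U int -> R).
  by apply: bounded_mfun_indic; apply: measurableC; exact: mG.
rewrite /S mean_sum; last first.
  move=> i; apply: bounded_mfunM; last exact: bounded_mfun_cst.
  exact: (bounded_mfun_iter_shift i.+1 bG).
rewrite /osc_l1 mulr_sumr; apply: eq_bigr => i _.
rewrite [RHS]mulrC /p -(stationary_mean_iter i.+1 (iid_stationary cU dU iidU) bG) -meanZ.
  by apply: eq_mean => u; rewrite mulrC.
exact: (bounded_mfun_iter_shift i.+1 bG).
Qed.

Let f_H u : `|f (block n (Phi u)) - H u| <= S u.
Proof.
apply: le_trans (osc_telescope f _ _) _; apply: ler_sum => i _.
rewrite ler_wpM2r ?osc_ge0// !tnth_mktuple /Y indicE in_setC.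
case: asboolP => h; last by rewrite memNset// ler_nat leq_b1.
rewrite Phi_iter iter_shift add0r eqxx; exact: ler0n.
Qed.

Let mean_fPhi : mean mu (fun x : seq_space A int => f (block n x)) =
  mean PU (fun u : seq_space U int => f (block n (Phi u))).
Proof.
rewrite -(mean_law_image PU mPhi bf); apply: eq_mean_law => E mE.
exact: muE.
Qed.

(** The deviation is at most [S + |H - mean H| + mean S]. Unless [S] exceeds its mean by [e / 3], or
    [H] leaves its mean by [e / 3] on either side, this is at most [2 * (e / 3) + 2 * (e / 6)].
    Three exceptional events give the factor 3, and 72 is 8 times the square of 3. *)
Lemma block_deviation (e : R) : 0 < e -> p k * osc_l1 f <= e / 6 ->
  (mu [set x : int -> A | (e < `|f (block n x) -
      mean mu (fun x : seq_space A int => f (block n x))|)%R] <=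
   (3 * expR (- (e ^+ 2 / (72 * (k + k).+1%:R ^+ 2) / osc_l2_sq f)))%:E)%E.
Proof.
move=> e0 pe; set V := (k + k).+1%:R ^+ 2 * osc_l2_sq f.
have mE : measurable ([set x : int -> A | e < `|f (block n x) -
      mean mu (fun x : seq_space A int => f (block n x))|] : set (seq_space A int)).
  apply: (measurable_local (countable_alphabet m) (@measurable_alphabet m)
    (J := [seq (i.+1)%:Z | i <- iota 0 n])) => x y xy /=.
  by rewrite (local_block xy).
rewrite muE//.
have e3 : 0 < e / 3 by rewrite divr_gt0.
pose E1 : set (seq_space U int) := [set u | e / 3 < S u - mean PU S].
pose E2 : set (seq_space U int) := [set u | e / 3 < H u - mean PU H].
pose E3 : set (seq_space U int) := [set u | e / 3 < - H u - mean PU (fun u : seq_space U int => - H u)].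
have mNH : mean PU (fun u : seq_space U int => - H u) = - mean PU H.
  rewrite -mulN1r -meanZ//; apply: eq_mean => u; by rewrite mulN1r.
have m1 : measurable E1.
  by apply: (measurable_local cU dU (J := J)) => x y xy; rewrite /E1/= (local_S xy).
have m2 : measurable E2.
  by apply: (measurable_local cU dU (J := J)) => x y xy; rewrite /E2/= (local_H xy).
have m3 : measurable E3.
  by apply: (measurable_local cU dU (J := J)) => x y xy; rewrite /E3/= (local_H xy).
have sub : Phi @^-1` [set x : int -> A | e < `|f (block n x) -
      mean mu (fun x : seq_space A int => f (block n x))|] `<=` E1 `|` E2 `|` E3.
  move=> u /=; rewrite mean_fPhi => hu.
  have d1 : `|mean PU (fun u : seq_space U int => f (block n (Phi u))) - mean PU H| <= mean PU S.
    rewrite -meanB//; apply: le_trans (mean_norm _ (bounded_mfunB bfPhi bH)) _.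
    by apply: mean_le => //; apply: bounded_mfun_norm; exact: bounded_mfunB.
  have d2 := f_H u.
  apply: contrapT => /not_orP[/not_orP[/negP n1 /negP n2] /negP n3].
  rewrite -leNgt in n1; rewrite -leNgt in n2; rewrite -leNgt mNH opprK in n3.
  have mS : mean PU S <= e / 6 by rewrite mean_S.
  move: hu; apply/negP; rewrite -leNgt.
  move: d1 d2; rewrite !ler_norml => /andP[d1 d1'] /andP[d2 d2'].
  by apply/andP; split; move: n1 n2 n3 mS d1 d1' d2 d2'; lra.
apply: (le_trans (le_measure PU _ _ sub)); rewrite ?inE.
- by rewrite -[X in measurable X]setTI; exact: mPhi.
- by apply: measurableU => //; exact: measurableU.
apply: (le_trans (measureU2 _ _ _)) => //; first exact: measurableU.
have -> : e ^+ 2 / (72 * (k + k).+1%:R ^+ 2) / osc_l2_sq f = (e / 3) ^+ 2 / (8 * V).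
  have aux (x q y : R) : x ^+ 2 / (72 * q) / y = (x / 3) ^+ 2 / (8 * (q * y)).
    by rewrite !invfM; move: (q^-1) (y^-1) => q' y'; field.
  exact: aux.
rewrite (_ : 3 * _ = expR (- ((e / 3) ^+ 2 / (8 * V))) + expR (- ((e / 3) ^+ 2 / (8 * V))) +
   expR (- ((e / 3) ^+ 2 / (8 * V)))); last by ring.
have [M hM] := fM.
rewrite !EFinD leeD//.
  apply: (le_trans (measureU2 _ _ _)) => //; rewrite leeD//.
    exact: (bounded_differences cU dU iidU uniq_J local_S S_le S_osc c_sq e3).
  exact: (bounded_differences cU dU iidU uniq_J local_H (fun x => hM _) H_osc c_sq e3).
apply: (bounded_differences cU dU iidU uniq_J _ (M := M) _ (c := c) _ c_sq e3).
- by move=> x y xy; rewrite (local_H xy).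
- by move=> x; rewrite normrN; exact: hM.
- by move=> x u j jJ; rewrite -opprD normrN; exact: H_osc.
Qed.

End block_function.

(** The radius [k] is selected as a function of the pair [(e, osc_l1 f)], before [n] and [f] are
    known, so the resulting rate is a legitimate [g]. *)
Lemma finitary_concentration : exponential_concentration mu.
Proof.
have ex (el : R * R) : exists k, 0 < el.1 -> 0 <= el.2 -> p k * el.2 <= el.1 / 6.
  case: el => e l /=; have [e0|e0] := ltP 0 e; last by exists 0%N.
  have [l0|l0] := leP 0 l; last by exists 0%N.
  have l1 : 0 < l + 1 by rewrite ltr_wpDl.
  have el : 0 < e / 6 / (l + 1) by rewrite !divr_gt0.
  have /cvgrPdist_le/(_ _ el)[K _ hK] := p_cvg.
  exists K => _ _; have := hK K (leqnn K); rewrite sub0r normrN ger0_norm// => pK.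
  apply: (le_trans (ler_wpM2r l0 pK)).
  by rewrite mulrAC ler_pdivrMr// ler_wpM2l ?lerDl// divr_ge0// ltW.
have [k hk] := choice ex.
exists 3, (fun e l => e ^+ 2 / (72 * (k (e, l) + k (e, l)).+1%:R ^+ 2)); split.
  by move=> e l e0 l0; rewrite divr_gt0 ?exprn_gt0// mulr_gt0// exprn_gt0// ltr0n.
move=> n e f n0 e0 _; rewrite mean_expectation.
exact: (block_deviation e0 (hk (e, osc_l1 f) e0 (osc_l1_ge0 f))).
Qed.

End coding_concentration.

(** * I.i.d. sequences over a countable alphabet *)

(** [box] mixes constraints by sets on [J1] with exact values on [J2]. A coordinate moves from the
    first list to the second by summing over its countably many values, until only a cylinder
    remains. *)
Lemma iid_of_cylinders (R : realType) (p : nat -> R)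
    (Q : probability (seq_space nat int) R) :
  (forall J w, uniq J -> Q (cylinder J w) = (\prod_(j <- J) p (w j))%:E) -> iid Q.
Proof.
move=> Qcyl.
have cN : countable [set: nat] by exact: countableP.
have dN (B : set nat) : measurable B by [].
pose box (J1 : seq int) (B : int -> set nat) (J2 : seq int) (w : int -> nat) : set (seq_space nat int) :=
  [set x | (forall j, j \in J1 -> B j (x j)) /\ agree J2 x w].
have mbox J1 B J2 w : measurable (box J1 B J2 w).
  have K x y : agree (J1 ++ J2) x y -> box J1 B J2 w x -> box J1 B J2 w y.
    move=> xy [h1 h2]; split=> j jJ; rewrite -xy ?mem_cat ?jJ ?orbT//; first exact: h1.
    exact: h2.
  apply: (measurable_local cN dN (J := J1 ++ J2)) => x y xy; apply/propext.
  by split; apply: K => //; exact: agree_sym.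
have H (J1 : seq int) B (J2 : seq int) w : uniq (J1 ++ J2) -> Q (box J1 B J2 w) =
    ((\prod_(j <- J1) Q [set x | B j (x j)]) * (\prod_(j <- J2) p (w j))%:E)%E.
  elim: J1 J2 w => [|j J1 IH] J2 w.
    move=> uJ; rewrite big_nil mul1e -Qcyl//; congr (Q _).
    by apply/seteqP; split => x; [case|move=> h; split].
  rewrite /= mem_cat negb_or => /andP[/andP[jJ1 jJ2] uJ].
  pose F t : set (seq_space nat int) :=
    if t \in B j then box J1 B (j :: J2) (upd w j t) else set0.
  pose F' t : set (seq_space nat int) :=
    if t \in B j then cylinder [:: j] (fun=> t) else set0.
  have mF t : measurable (F t) by rewrite /F; case: ifP.
  have mF' t : measurable (F' t).
    by rewrite /F'; case: ifP => // _; exact: measurable_cylinder.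
  have tF : trivIset setT F.
    move=> s t _ _ [x []]; rewrite /F; case: ifP => // _ [_ hs]; case: ifP => // _ [_ ht].
    by have := hs j; rewrite inE eqxx updE => /(_ isT) <-; have := ht j; rewrite inE eqxx updE => /(_ isT).
  have tF' : trivIset setT F'.
    move=> s t _ _ [x []]; rewrite /F'; case: ifP => // _ hs; case: ifP => // _ ht.
    by have := hs j; rewrite inE eqxx => /(_ isT) <-; have := ht j; rewrite inE eqxx => /(_ isT).
  have -> : box (j :: J1) B J2 w = \bigcup_t F t.
    apply/seteqP; split => x.
      move=> [h1 h2]; exists (x j) => //; rewrite /F mem_set; last by apply: h1; rewrite inE eqxx.
      split=> [i iJ|i]; first by apply: h1; rewrite inE iJ orbT.
      by rewrite inE /upd; case: eqP => [->//|_ /=]; exact: h2.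
    move=> [t _]; rewrite /F; case: ifP => // /set_mem Bt [h1 h2].
    have xj : x j = t by have := h2 j; rewrite inE eqxx updE => /(_ isT).
    split=> i; first by rewrite inE => /predU1P[->|iJ]; [rewrite xj|exact: h1].
    move=> iJ; have := h2 i; rewrite inE iJ orbT => /(_ isT) ->; rewrite updN//.
    by apply: contraNneq jJ2 => <-.
  have E' : [set x : int -> nat | B j (x j)] = \bigcup_t F' t.
    apply/seteqP; split => x /=.
      move=> Bx; exists (x j) => //; rewrite /F' mem_set// => i.
      by rewrite inE => /eqP ->.
    move=> [t _]; rewrite /F'; case: ifP => // /set_mem Bt h.
    by rewrite (h j) ?inE.
  rewrite big_cons [in RHS]E'.
  rewrite (probability_bigcup Q mF tF).
  rewrite (probability_bigcup Q mF' tF').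
  set c := (\prod_(j <- J1) Q [set x | B j (x j)])%E.
  have c_fin : c \is a fin_num.
    apply: prode_fin_num => i _; apply: fin_num_measure.
    by apply: (measurable_local cN dN (J := [:: i])) => x y xy /=; rewrite xy// inE.
  pose r := fine c * \prod_(j <- J2) p (w j).
  have re : (c * (\prod_(j <- J2) p (w j))%:E)%E = r%:E by rewrite EFinM fineK.
  transitivity (r%:E * \sum_(0 <= t <oo) Q (F' t))%E; last first.
    by rewrite -[RHS]muleA re [RHS]muleC.
  rewrite -nneseriesZl//; apply: eq_eseriesr => t _.
  rewrite /F /F'; case: ifP => _; last by rewrite !measure0 mule0.
  rewrite IH; last by rewrite -cat1s uniq_catCA /= mem_cat negb_or jJ1 jJ2.
  rewrite big_cons updE Qcyl// big_seq1 -/c.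
  rewrite (eq_big_seq (fun k => p (w k))); last first.
    by move=> k kJ; rewrite updN//; apply: contraNneq jJ2 => <-.
  by rewrite -re -muleA -EFinM [(p t * _)%R]mulrC.
split=> [J B uJ mB|i j B mB].
  have := H J B [::] (fun=> 0%N); rewrite cats0 => /(_ uJ).
  rewrite big_nil mule1 => <-; congr (Q _).
  by apply/seteqP; split => x; [move=> h; split|case].
have E i' : [set x : int -> nat | B (x i')] =
    \bigcup_t (if t \in B then cylinder [:: i'] (fun=> t) else set0).
  apply/seteqP; split => x /=.
    move=> Bx; exists (x i') => //; rewrite mem_set// => k.
    by rewrite inE => /eqP ->.
  move=> [t _]; case: ifP => // /set_mem Bt h.
  by rewrite (h i') ?inE.
rewrite !E.
have mF i' t : measurable ((if t \in B then cylinder [:: i'] (fun=> t) else set0) : set (seq_space nat int)).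
  by case: ifP => // _; exact: measurable_cylinder.
have tF i' : trivIset setT (fun t => (if t \in B then cylinder [:: i'] (fun=> t) else set0) : set (seq_space nat int)).
  move=> s t _ _ [x []]; case: ifP => // _ hs; case: ifP => // _ ht.
  by have := hs i'; rewrite inE eqxx => /(_ isT) <-; have := ht i'; rewrite inE eqxx => /(_ isT).
rewrite (probability_bigcup Q (mF i) (tF i)).
rewrite (probability_bigcup Q (mF j) (tF j)).
apply: eq_eseriesr => t _; case: ifP => _; last by rewrite !measure0.
by rewrite !Qcyl// !big_seq1.
Qed.

(** * An i.i.d. sequence read off the digits of one uniform variable *)

Section unit_interval.
Context (R : realType).

Definition unit_interval_measure : set (measurableTypeR R) -> \bar R :=
  mrestr (@lebesgue_measure R) (measurable_itv (Interval (BLeft (0 : R)) (BLeft 1))).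

HB.instance Definition _ := Measure.copy unit_interval_measure
  (mrestr (@lebesgue_measure R) (measurable_itv (Interval (BLeft (0 : R)) (BLeft 1)))).

Let unit_interval_setT : unit_interval_measure setT = 1%E.
Proof.
by rewrite /unit_interval_measure /mrestr setTI lebesgue_measure_itv /= lte_fin ltr01 oppr0 adde0.
Qed.

HB.instance Definition _ :=
  Measure_isProbability.Build _ _ _ unit_interval_measure unit_interval_setT.

End unit_interval.

Section digits.
Context (R : realType) (p : nat -> R).
Hypothesis p0 : forall t, 0 <= p t.

Let cum n : R := \sum_(i < n) p i.

Hypothesis p1 : cum n @[n --> \oo] --> (1 : R).

Definition symbol (x l w : R) : nat :=
  get [set t | l + w * cum t <= x < l + w * cum t.+1].

(* [[l, l + w)] is cut into consecutive pieces of length [w * p t]; the digits of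
   [x] name the successive pieces containing it. *)
Fixpoint digit (x l w : R) (n : nat) : nat :=
  let t := symbol x l w in
  if n is n'.+1 then digit x (l + w * cum t) (w * p t) n' else t.

(** [None] leaves a digit free; its weight is then the total mass 1. *)
Definition fits (o : option nat) (t : nat) : bool :=
  if o is Some a then t == a else true.

Definition weight (o : option nat) : R := if o is Some a then p a else 1.

Definition cell (ps : seq (option nat)) (l w : R) : set R :=
  [set x | l <= x < l + w /\
    forall k, (k < size ps)%N -> fits (nth None ps k) (digit x l w k)].

Let cumS t : cum t.+1 = cum t + p t. Proof. by rewrite /cum big_ord_recr. Qed.

Let cum_mono s t : (s <= t)%N -> cum s <= cum t.
Proof.
elim: t => [|t IH]; first by rewrite leqn0 => /eqP ->.
rewrite leq_eqVlt => /predU1P[->//|st]; rewrite cumS.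
by apply: le_trans (IH st) _; rewrite lerDl.
Qed.

Let cum_ge0 t : 0 <= cum t. Proof. by apply: sumr_ge0. Qed.

Let cum_le1 t : cum t <= 1.
Proof.
rewrite -(cvg_lim _ p1)//; apply: limr_ge; first by apply/cvg_ex; exists 1.
by near=> n; apply: cum_mono; near: n; exact: nbhs_infty_ge.
Unshelve. all: by end_near.
Qed.

Let symbol_unique x l w s t : 0 <= w ->
  l + w * cum s <= x < l + w * cum s.+1 -> l + w * cum t <= x < l + w * cum t.+1 -> s = t.
Proof.
move=> w0.
have H a b : l + w * cum a <= x < l + w * cum a.+1 ->
    l + w * cum b <= x < l + w * cum b.+1 -> (a < b)%N -> False.
  move=> /andP[_ h1] /andP[h2 _] ab.
  have := lt_le_trans h1 (le_trans (lerD (lexx l) (ler_wpM2l w0 (cum_mono ab))) h2).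
  by rewrite ltxx.
by move=> hs ht; case: (ltngtP s t) => // h; [case: (H _ _ hs ht h)|case: (H _ _ ht hs h)].
Qed.

Let symbol_eq x l w t : 0 <= w -> l + w * cum t <= x < l + w * cum t.+1 -> symbol x l w = t.
Proof.
move=> w0 ht; apply: (symbol_unique w0 _ ht).
exact: (@getPex _ [set t | l + w * cum t <= x < l + w * cum t.+1] (ex_intro _ t ht)).
Qed.

Let symbol_ex x l w : 0 <= w -> l <= x < l + w ->
  exists t, l + w * cum t <= x < l + w * cum t.+1.
Proof.
move=> w0 /andP[lx xw].
have w_gt0 : 0 < w by move: lx xw; lra.
have y1 : (x - l) / w < 1 by rewrite ltr_pdivrMr// mul1r; lra.
have ex : exists n, (x - l) / w < cum n.
  have d0 : 0 < 1 - (x - l) / w by rewrite subr_gt0.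
  have /cvgrPdist_lt/(_ _ d0)[N _ hN] := p1.
  by exists N; have := hN N (leqnn N); rewrite ltr_norml => /andP[_]; lra.
case: (ex_minnP ex) => -[|n] hn min.
  by move: hn; rewrite /cum big_ord0 ltNge divr_ge0// subr_ge0.
exists n; apply/andP; split; last first.
  by move: hn; rewrite ltr_pdivrMr// mulrC; lra.
rewrite leNgt; apply/negP => h.
suff : (x - l) / w < cum n by move=> /min; rewrite ltnn.
by rewrite ltr_pdivrMr// mulrC; move: h; lra.
Qed.

Let branch o ps l w t : set R :=
  if fits o t then cell ps (l + w * cum t) (w * p t) else set0.

Let cell_cons o ps l w : 0 <= w -> cell (o :: ps) l w = \bigcup_t branch o ps l w t.
Proof.
move=> w0; apply/seteqP; split => x.
  move=> [lx h]; have [t ht] := symbol_ex w0 lx; exists t => //.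
  have st := symbol_eq w0 ht; rewrite /branch.
  have := h 0%N isT; rewrite /= st => ->; split.
    by move: ht; rewrite cumS mulrDr addrA.
  by move=> k kp; have := h k.+1 kp; rewrite /= st.
move=> [t _]; rewrite /branch; case: ifP => // ot [hx h].
have ht : l + w * cum t <= x < l + w * cum t.+1 by rewrite cumS mulrDr addrA.
have st := symbol_eq w0 ht; split.
  move: ht => /andP[h1 h2]; apply/andP; split.
    by apply: le_trans h1; rewrite lerDl mulr_ge0.
  by apply: (lt_le_trans h2); rewrite lerD2l ler_piMr.
by move=> [|k] /=; rewrite st// ltnS; exact: h.
Qed.

Let trivIset_branch o ps l w : 0 <= w -> trivIset setT (branch o ps l w).
Proof.
move=> w0 s t _ _ [x []]; rewrite /branch; case: ifP => // _ [hs _]; case: ifP => // _ [ht _].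
by apply: (symbol_unique (x := x) (l := l) w0); rewrite cumS mulrDr addrA.
Qed.

Let series_weight o : (\sum_(0 <= t <oo) ((if fits o t then p t else 0)%:E : \bar R))%E = (weight o)%:E.
Proof.
apply/cvg_lim => //; case: o => [a|] /=.
  apply: cvg_near_cst; exists a.+1 => // n /= an.
  rewrite sumEFin; congr _%:E; rewrite -big_mkcond /=.
  by rewrite big_nat1_eq /= an.
rewrite (_ : (fun n => _) = EFin \o cum); first by apply/cvg_EFin; [exact: nearW|exact: p1].
by apply/funext => n /=; rewrite sumEFin big_mkord.
Qed.

(** Cutting along the first digit [t] gives disjoint cells of the same kind in intervals of length
    [w * p t]; summing [p t] over the admissible [t] produces the weight of the first constraint. *)
Lemma cell_measure ps l w : 0 <= w -> measurable (cell ps l w) /\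
  lebesgue_measure (cell ps l w) = (w * \prod_(o <- ps) weight o)%:E.
Proof.
elim: ps l w => [|o ps IH] l w w0.
  have -> : cell [::] l w = [set` Interval (BLeft l) (BLeft (l + w))].
    by apply/seteqP; split => x; [move=> [h _]|move=> h; split]; rewrite /= in_itv in h *.
  split; first exact: measurable_itv.
  rewrite lebesgue_measure_itv /= lte_fin ltrDl big_nil mulr1.
  case: ltP => [_|w0']; first by rewrite -EFinB addrAC subrr add0r.
  by congr _%:E; apply/eqP; rewrite eq_le w0 w0'.
have mb t : measurable (branch o ps l w t).
  by rewrite /branch; case: ifP => // _; apply: (IH _ _ _).1; rewrite mulr_ge0.
rewrite cell_cons//; split; first exact: bigcupT_measurable.
rewrite measure_semi_bigcup//; [|exact: trivIset_branch|exact: bigcupT_measurable].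
rewrite (_ : \big[_/_]_(0 <= i <oo) _ = (\sum_(0 <= t <oo) (w * \prod_(o <- ps) weight o)%:E *
    (if fits o t then p t else 0)%:E)%E).
  rewrite nneseriesZl; last by move=> t _; case: ifP => _; rewrite lee_fin.
  by rewrite series_weight -EFinM big_cons; congr _%:E; ring.
apply: eq_eseriesr => t _; rewrite /branch; case: ifP => _; last by rewrite measure0 mule0.
have [_ e] := IH (l + w * cum t) (w * p t) (mulr_ge0 w0 (p0 t)).
by rewrite [LHS]e -EFinM; congr _%:E; ring.
Qed.

(** Sites are numbered by [pickle]; the value 0 outside [0, 1) concerns a null set only. *)
Definition digit_seq (x : R) : int -> nat :=
  fun z => if 0 <= x < 1 then digit x 0 1 (pickle z) else 0%N.

Let pattern (J : seq int) (w : int -> nat) (k : nat) : option nat :=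
  if (pickle_inv k : option int) is Some z then
    (if z \in J then Some (w z) else None) else None.

Let patterns J w := mkseq (pattern J w) (\max_(j <- J) pickle j).+1.

Let digit_cylinder J w :
  digit_seq @^-1` cylinder J w `&` [set` Interval (BLeft (0 : R)) (BLeft 1)] =
  cell (patterns J w) 0 1.
Proof.
apply/seteqP; split => x /=.
  rewrite in_itv /= => -[h x01]; split; rewrite ?add0r// => k; rewrite size_mkseq => kJ.
  rewrite nth_mkseq// /pattern; case E : pickle_inv => [z|//]; case: ifP => //= zJ.
  have := h z zJ; rewrite /digit_seq x01 => <-.
  by have := @pickle_invK int k; rewrite E /= => ->.
move=> [x01 h]; rewrite add0r in x01; rewrite in_itv/=; split => // j jJ.
have jm : (pickle j < (\max_(j <- J) pickle j).+1)%N.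
  by rewrite ltnS; apply: (@leq_bigmax_seq _ J xpredT pickle).
have := h (pickle j); rewrite size_mkseq => /(_ jm).
by rewrite nth_mkseq// /pattern pickleK_inv jJ /= /digit_seq x01 => /eqP.
Qed.

Let patterns_weight J w : uniq J ->
  \prod_(o <- patterns J w) weight o = \prod_(j <- J) p (w j).
Proof.
move=> uJ; rewrite big_map.
set N := (\max_(j <- J) pickle j).+1; pose K := map pickle J.
have uK : uniq K by rewrite map_inj_uniq//; exact: (pcan_inj pickleK).
transitivity (\prod_(k <- iota 0 N | k \in K) weight (pattern J w k)).
  rewrite [RHS]big_mkcond /=; apply: eq_bigr => k _.
  case: ifP => // kK; rewrite /pattern; case E : pickle_inv => [z|//].
  case: ifP => // zJ; move: kK; rewrite (_ : k \in K)//; apply/mapP; exists z => //.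
  by have := @pickle_invK int k; rewrite E.
rewrite -big_filter (perm_big K).
  by rewrite big_map; apply: eq_big_seq => j jJ; rewrite /pattern pickleK_inv jJ.
apply: uniq_perm => //; first by rewrite filter_uniq// iota_uniq.
move=> k; rewrite mem_filter mem_iota add0n; case: (boolP (k \in K)) => //= /mapP[j jJ ->].
by rewrite ltnS; apply: (@leq_bigmax_seq _ J xpredT pickle).
Qed.

Let measurable_digit_seq :
  measurable_fun setT (digit_seq : R -> seq_space nat int).
Proof.
apply: measurable_seqP => z _ B _; rewrite setTI.
have -> : (fun x => digit_seq x z) @^-1` B =
    \bigcup_a (if a \in B then (fun x => digit_seq x z) @^-1` [set a] else set0).
  apply/seteqP; split => [x Bx|x [a _]].
    by exists (digit_seq x z) => //; rewrite mem_set.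
  by case: ifP => // /set_mem Ba; rewrite /preimage /= => ->.
apply: bigcupT_measurable => a; case: ifP => // _.
have mI : measurable ([set` Interval (BLeft (0 : R)) (BLeft 1)] : set R) by exact: measurable_itv.
rewrite (_ : _ @^-1` _ = cell (patterns [:: z] (fun=> a)) 0 1 `|`
    (if a == 0%N then ~` [set` Interval (BLeft (0 : R)) (BLeft 1)] else set0)).
  apply: measurableU; first by have [] := cell_measure (patterns [:: z] (fun=> a)) 0 (@ler01 R).
  by case: ifP => // _; exact: measurableC.
rewrite -digit_cylinder; apply/seteqP; split => x /=.
  move=> e; case: (boolP (0 <= x < 1)) => [x01|x01].
    by left; split; [move=> i; rewrite inE => /eqP ->|rewrite /= in_itv].
  right; move: e; rewrite /digit_seq (negPf x01) => <-; rewrite eqxx /=.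
  by rewrite in_itv /=; apply/negP.
move=> [[h _]|]; first by rewrite (h z) ?inE.
case: eqP => // -> /=; rewrite in_itv /= => /negP x01.
by rewrite /digit_seq (negPf x01).
Qed.

Definition digit_law : probability (seq_space nat int) R :=
  law_image (@unit_interval_measure R) measurable_digit_seq.

Lemma digit_law_cylinder J w : uniq J ->
  digit_law (cylinder J w) = (\prod_(j <- J) p (w j))%:E.
Proof.
move=> uJ; have [_] := cell_measure (patterns J w) 0 (@ler01 R).
by rewrite mul1r patterns_weight// -digit_cylinder => <-.
Qed.

Lemma digit_law_iid : iid digit_law.
Proof. exact: iid_of_cylinders digit_law_cylinder. Qed.

End digits.

(** * Symbols made of random numbers of fair bits *)

(** A bijection of bit strings with [nat] that respects length: strings of length [k] fill the block
    from [2 ^ k - 1] to [2 ^ k.+1 - 2]. *)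
Fixpoint code (s : seq bool) : nat :=
  if s is b :: s' then (b + (code s').*2).+1 else 0%N.

Fixpoint decode_fuel (n k : nat) : seq bool :=
  if n is n'.+1 then
    (if k is k'.+1 then odd k' :: decode_fuel n' k'./2 else [::])
  else [::].

Definition decode k := decode_fuel k k.

Lemma decodeK : cancel decode code.
Proof.
suff H n k : (k <= n)%N -> code (decode_fuel n k) = k by move=> k; exact: H.
elim: n k => [|n IH] [|k] //= kn.
rewrite IH ?odd_double_half//.
by rewrite -divn2 (leq_trans (leq_div _ _)).

Qed.

Lemma code_inj : injective code.
Proof.
elim=> [|b s IH] [|b' s'] //= [e].
have bb : b = b'.
  by move: (congr1 odd e); rewrite !oddD !odd_double !addbF !oddb.
by move: e; rewrite bb => /addnI/double_inj/IH ->.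
Qed.

Lemma codeK : cancel code decode.
Proof. by move=> s; apply: code_inj; rewrite decodeK. Qed.

Lemma code_range s : (2 ^ size s <= (code s).+1 < 2 ^ (size s).+1)%N.
Proof.
elim: s => [//|b s /andP[h1 h2]] /=.
by rewrite !expnS in h2 *; apply/andP; split; case: b => /=; lia.
Qed.

Lemma size_decode t k : (2 ^ k <= t.+1 < 2 ^ k.+1)%N -> size (decode t) = k.
Proof.
move=> /andP[h1 h2]; have := code_range (decode t); rewrite decodeK => /andP[h3 h4].
by apply/eqP; rewrite eqn_leq -ltnS -(@ltn_exp2l 2)// -[in X in _ && X]ltnS -[X in _ && X](@ltn_exp2l 2)//
  (leq_ltn_trans h3 h2) (leq_ltn_trans h1 h4).
Qed.

(** Strings too short to have a bit of rank [r] stay fixed, so that the size is preserved and the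
    map is an involution. *)
Definition flip_bit (r : nat) (s : seq bool) : seq bool :=
  if (r < size s)%N then set_nth false s r (~~ nth false s r) else s.

Lemma size_flip_bit r s : size (flip_bit r s) = size s.
Proof. by rewrite /flip_bit; case: ltnP => // rs; rewrite size_set_nth; apply/maxn_idPr. Qed.

Lemma nth_flip_bit r s : (r < size s)%N -> nth false (flip_bit r s) r = ~~ nth false s r.
Proof. by move=> rs; rewrite /flip_bit rs nth_set_nth /= eqxx. Qed.

Lemma nth_flip_bitN r s k : k != r -> nth false (flip_bit r s) k = nth false s k.
Proof. by move=> kr; rewrite /flip_bit; case: ifP => // _; rewrite nth_set_nth /= (negPf kr). Qed.

Lemma flip_bitK r : involutive (flip_bit r).
Proof.
move=> s; apply: (@eq_from_nth _ false); rewrite !size_flip_bit// => k ks.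
have [->|kr] := eqVneq k r; last by rewrite !nth_flip_bitN.
have [rs|sr] := ltnP r (size s); first by rewrite !nth_flip_bit ?size_flip_bit// negbK.
by rewrite /flip_bit !(ltnNge r) sr /= sr.
Qed.

Section bit_process.
Context (R : realType).

(* The size of a symbol is less than [k] with probability (k - 1) / (k + 1)
   (truncated subtraction: 0 for [k = 0]); its mean is infinite. *)
Definition size_cdf (k : nat) : R := k.-1%:R / k.+1%:R.

Definition symbol_weight (t : nat) : R :=
  (size_cdf (size (decode t)).+1 - size_cdf (size (decode t))) / 2 ^+ size (decode t).

Lemma symbol_weight_ge0 t : 0 <= symbol_weight t.
Proof.
rewrite divr_ge0 ?exprn_ge0// subr_ge0 /size_cdf; case: (size _) => [|k] /=.
  by rewrite !mul0r.
by rewrite ler_pdivrMr// mulrAC ler_pdivlMr// -!natrM ler_nat; nia.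
Qed.

(** The symbols below [(2 ^ k).-1] are the strings shorter than [k]. The [2 ^ k] strings of length
    [k] share equally the mass of that size, and the sum telescopes. *)
Lemma sum_symbol_weight k : \sum_(i < (2 ^ k).-1) symbol_weight i = size_cdf k.
Proof.
elim: k => [|k IH]; first by rewrite big_ord0 /size_cdf mul0r.
have k2 : (0 < 2 ^ k)%N by rewrite expn_gt0.
rewrite -(big_mkord xpredT) (big_cat_nat _ (n := (2 ^ k).-1)) //=; last by rewrite expnS; lia.
rewrite big_mkord IH.
rewrite (eq_big_nat _ _ (F2 := fun=> (size_cdf k.+1 - size_cdf k) / 2 ^+ k)); last first.
  move=> t /andP[t1 t2]; rewrite /symbol_weight (@size_decode t k)//.
  by rewrite expnS in t2 *; apply/andP; split; lia.
rewrite sumr_const_nat (_ : ((2 ^ k.+1).-1 - (2 ^ k).-1)%N = (2 ^ k)%N); last by rewrite expnS; lia.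
rewrite -[X in _ + X](mulr_natr _ (2 ^ k)%N) natrX divfK; last by rewrite expf_neq0// pnatr_eq0.
by rewrite addrC subrK.
Qed.

Lemma size_cdf_le1 k : size_cdf k <= 1.
Proof. by rewrite /size_cdf ler_pdivrMr// mul1r ler_nat; lia. Qed.

Lemma sum_symbol_weight_cvg : \sum_(i < n) symbol_weight i @[n --> \oo] --> (1 : R).
Proof.
have mono a b : (a <= b)%N -> \sum_(i < a) symbol_weight i <= \sum_(i < b) symbol_weight i.
  elim: b => [|b IH]; first by rewrite leqn0 => /eqP ->.
  rewrite leq_eqVlt => /predU1P[->//|ab]; rewrite big_ord_recr /=.
  by apply: le_trans (IH ab) _; rewrite lerDl symbol_weight_ge0.
apply/cvgrPdist_le => e e0.
pose k := (Num.bound (2 / e)).+1.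
exists (2 ^ k)%N => // n /= kn.
have up : \sum_(i < n) symbol_weight i <= 1.
  apply: le_trans (mono n (2 ^ n).-1 _) _; first by have := ltn_expl n (ltnSn 1); lia.
  by rewrite sum_symbol_weight size_cdf_le1.
have low : size_cdf k <= \sum_(i < n) symbol_weight i.
  by rewrite -sum_symbol_weight; apply: mono; lia.
rewrite ger0_norm ?subr_ge0// lerBlDr.
suff : 1 - size_cdf k <= e by move: low; lra.
have b : 2 / e < k%:R.
  apply: lt_le_trans (archi_boundP _) _; first by rewrite divr_ge0// ltW.
  by rewrite ler_nat.
rewrite /size_cdf (_ : k.-1%:R = k.+1%:R - 2); last by rewrite -natrB//.
rewrite mulrBl divff ?pnatr_eq0// opprB addrC subrK ler_pdivrMr//.
rewrite ltr_pdivrMr// in b; apply: ltW; apply: (lt_le_trans b).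
by rewrite mulrC ler_wpM2l ?(ltW e0)// ler_nat.
Qed.

Definition bit_law : probability (seq_space nat int) R :=
  digit_law symbol_weight_ge0 sum_symbol_weight_cvg.

Lemma bit_law_cylinder J w : uniq J ->
  bit_law (cylinder J w) = (\prod_(j <- J) symbol_weight (w j))%:E.
Proof. exact: digit_law_cylinder. Qed.

Lemma bit_law_iid : iid bit_law.
Proof. exact: digit_law_iid. Qed.

Lemma countable_nat : countable [set: nat]. Proof. exact: countableP. Qed.
Lemma measurable_nat_set (B : set nat) : measurable B. Proof. by []. Qed.

Definition flip (j : int) (r : nat) (x : int -> nat) : int -> nat :=
  upd x j (code (flip_bit r (decode (x j)))).

Lemma flipE j r x i : flip j r x i = if i == j then code (flip_bit r (decode (x i))) else x i.
Proof. by rewrite /flip /upd; case: eqP => // ->. Qed.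

Lemma size_flip j r x i : size (decode (flip j r x i)) = size (decode (x i)).
Proof. by rewrite flipE; case: eqP => // _; rewrite codeK size_flip_bit. Qed.

Lemma measurable_flip j r :
  measurable_fun setT (flip j r : seq_space nat int -> seq_space nat int).
Proof.
apply: measurable_seqP => i.
apply: (measurable_fun_local countable_nat measurable_nat_set (J := [:: i])) => x y xy.
by rewrite !flipE xy// inE.
Qed.

(** The weight of a symbol depends on its size alone, which flipping a bit preserves. *)
Lemma flip_law j r E : measurable (E : set (seq_space nat int)) ->
  law_image bit_law (measurable_flip j r) E = bit_law E.
Proof.
apply: (law_ext countable_nat measurable_nat_set) => J w; rewrite law_imageE.
have -> : cylinder J w = cylinder (undup J) w.
  by apply/seteqP; split => x h i iJ; apply: h; move: iJ; rewrite mem_undup.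
have := undup_uniq J; move: (undup J) => {}J uJ.
have -> : flip j r @^-1` cylinder J w = cylinder J (flip j r w).
  apply/seteqP; split => x h i iJ; have := h i iJ.
    by rewrite !flipE; case: eqP => // _ <-; rewrite codeK flip_bitK decodeK.
  by rewrite !flipE => ->; case: eqP => // _; rewrite codeK flip_bitK decodeK.
rewrite !bit_law_cylinder//; congr _%:E; apply: eq_bigr => i _.
by rewrite /symbol_weight size_flip.
Qed.

Lemma mean_flip j r (f : seq_space nat int -> R) : bounded_mfun f ->
  mean bit_law (fun x => f (flip j r x)) = mean bit_law f.
Proof.
move=> bf; rewrite -(mean_law_image bit_law (measurable_flip j r) bf).
by apply: eq_mean_law => E mE; exact: flip_law.
Qed.

(** Does the work of conditioning on everything except one fair bit: [g] is the average of [f] over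
    that bit. *)
Lemma mean_flip_avg j r (f g : seq_space nat int -> R) :
  bounded_mfun f -> bounded_mfun g ->
  (forall x, f x + f (flip j r x) = 2 * g x) -> mean bit_law f = mean bit_law g.
Proof.
move=> bf bg fg.
have bff : bounded_mfun (fun x : seq_space nat int => f (flip j r x)).
  exact: (bounded_mfun_comp (measurable_flip j r) bf).
have : 2 * mean bit_law f = 2 * mean bit_law g.
  rewrite -[in RHS]meanZ// -(eq_mean _ fg) meanD// mean_flip//; ring.
by apply: mulfI; rewrite pnatr_eq0.
Qed.

(* Site [i] reads the bit of rank [r] of the symbol sitting [r] sites to its
   left, when that symbol is long enough; distinct sites thus read distinct
   bits. The pair is the dyadic interval (left end, width) determined by the
   bits read at the first [n] lags. *)
Fixpoint dyadic (x : int -> nat) (i : int) (n : nat) : R * R :=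
  if n is r.+1 then
    let s := decode (x (i - r%:Z)) in
    let lw := dyadic x i r in
    if (r < size s)%N then (lw.1 + (nth false s r)%:R * (lw.2 / 2), lw.2 / 2) else lw
  else (0, 1).

Lemma dyadic_width_gt0 x i n : 0 < (dyadic x i n).2.
Proof. by elim: n => [//|n IH] /=; case: ifP => // _; rewrite divr_gt0. Qed.

Lemma dyadic_left_mono x i n : (dyadic x i n).1 <= (dyadic x i n.+1).1.
Proof.
by rewrite /=; case: ifP => //= _; rewrite lerDl mulr_ge0// divr_ge0// ltW// dyadic_width_gt0.
Qed.

Lemma dyadic_right_mono x i n :
  (dyadic x i n.+1).1 + (dyadic x i n.+1).2 <= (dyadic x i n).1 + (dyadic x i n).2.
Proof.
have w0 := dyadic_width_gt0 x i n; rewrite /=; case: ifP => //= _.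
by case: (nth _ _ _); rewrite ?mul1r ?mul0r; lra.
Qed.

Lemma dyadic_right_le1 x i n : (dyadic x i n).1 + (dyadic x i n).2 <= 1.
Proof.
elim: n => [|n IH]; first by rewrite add0r.
exact: le_trans (dyadic_right_mono x i n) IH.
Qed.

Lemma dyadic_local i n : local_on [seq i - r%:Z | r <- iota 0 n] (fun x => dyadic x i n).
Proof.
elim: n => [//|n IH] x y xy /=.
rewrite (IH x y) ?xy//; first by apply/mapP; exists n => //; rewrite mem_iota /=.
move=> k kn; apply: xy; move: kn => /mapP[q]; rewrite mem_iota add0n => /andP[_ qn] ->.
by apply/mapP; exists q => //; rewrite mem_iota add0n (leq_trans qn).
Qed.

Lemma dyadic_shift x i n : dyadic (shift_seq x) i n = dyadic x (i + 1) n.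
Proof. by elim: n => [//|n IH] /=; rewrite IH /shift_seq addrAC. Qed.

(** Site [i] reads rank [n] at site [i - n], so the bit of rank [r] at site [-r] is read by site 0
    alone. *)
Lemma dyadic_flip x i r n : i != 0 -> dyadic (flip (- r%:Z) r x) i n = dyadic x i n.
Proof.
move=> i0; elim: n => [//|n IH] /=; rewrite IH size_flip.
case: ifP => // ns; congr ((_ + _%:R * _), _).
rewrite flipE; case: eqP => // e; rewrite codeK nth_flip_bitN//.
by apply: contraNneq i0 => nr; apply/eqP; move: e; rewrite nr; lia.
Qed.

Lemma dyadic_flip0 x r n : (n <= r)%N -> dyadic (flip (- r%:Z) r x) 0 n = dyadic x 0 n.
Proof.
elim: n => [//|n IH] /= nr; rewrite IH ?(ltnW nr)// size_flip.
case: ifP => // ns; congr ((_ + _%:R * _), _).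
by rewrite flipE; case: eqP => // e; exfalso; lia.
Qed.

End bit_process.

(** * One step of the coding *)

Section coding_step.
Context (R : realType).

(* The probability that a uniform point of [[l, l + w)] is at most [t]. *)
Definition ramp (l w t : R) : R := Num.min 1 (Num.max 0 ((t - l) / w)).

Definition inside (l w t : R) : R := (l <= t < l + w)%R%:R.

Lemma ramp_split l w t : 0 < w ->
  ramp l (w / 2) t + ramp (l + w / 2) (w / 2) t = 2 * ramp l w t.
Proof.
move=> w0; rewrite /ramp.
have -> : (t - l) / (w / 2) = 2 * ((t - l) / w) by field; rewrite gt_eqF.
have -> : (t - (l + w / 2)) / (w / 2) = 2 * ((t - l) / w) - 1 by field; rewrite gt_eqF.
move: ((t - l) / w) => y; rewrite /Num.min /Num.max.
by do ![case: ifPn; rewrite -?leNgt] => *; lra.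
Qed.

Lemma inside_split l w t : 0 < w ->
  inside l (w / 2) t + inside (l + w / 2) (w / 2) t = inside l w t.
Proof.
move=> w0; rewrite /inside (_ : l + w / 2 + w / 2 = l + w); last by field.
case: (leP l t) => lt /=; case: (ltP t (l + w / 2)) => t1 /=; case: (leP (l + w / 2) t) => t2 /=;
  case: (ltP t (l + w)) => t3 /=; rewrite ?addr0 ?add0r//; exfalso; lra.
Qed.

Definition endpoint (s : bool) (lw : R * R) : R := if s then lw.1 else lw.1 + lw.2.

Lemma ramp_endpoint s l w t : 0 < w ->
  `|(endpoint s (l, w) <= t)%R%:R - ramp l w t| <= inside l w t.
Proof.
move=> w0; rewrite /inside /ramp.
have [tl|lt] := ltP t l.
  have y0 : (t - l) / w < 0 by rewrite ltr_pdivrMr// mul0r subr_lt0.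
  rewrite /= (max_l (ltW y0)) (min_r ler01) subr0 (_ : (_ <= t)%R = false) ?normr0//.
  by apply/negbTE; rewrite -ltNge /endpoint; case: s => //=; lra.
have y0 : 0 <= (t - l) / w by rewrite divr_ge0 ?subr_ge0// ltW.
rewrite (max_r y0); have [tw|wt] := ltP t (l + w) => /=.
  have y1 : (t - l) / w <= 1 by rewrite ler_pdivrMr// mul1r; lra.
  rewrite (min_r y1) ler_norml; case: (_ <= t)%R => /=; apply/andP; split; lra.
have y1 : 1 <= (t - l) / w by rewrite ler_pdivlMr// mul1r; lra.
rewrite (min_l y1) (_ : (_ <= t)%R = true) ?subrr ?normr0//.
by rewrite /endpoint; case: s.
Qed.

Lemma inside_norm l w t : `|inside l w t| <= 1.
Proof. by rewrite /inside; case: (_ && _); rewrite ?normr1 ?normr0. Qed.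

Lemma ramp_norm l w t : `|ramp l w t| <= 1.
Proof.
rewrite ger0_norm; first by rewrite /ramp ge_min lexx.
by rewrite /ramp le_min ler01 le_max lexx.
Qed.

(* [shrink r x] is the factor by which the dyadic interval of site 0 shrinks at
   lag [r]. *)
Let shrink (r : nat) (x : int -> nat) : R :=
  if (r < size (decode (x (- r%:Z))))%N then 1 / 2 else 1.

Let blocal K (f : (int -> nat) -> R) M : local_on K f -> (forall x, `|f x| <= M) ->
  bounded_mfun (f : seq_space nat int -> R).
Proof. exact: (bounded_mfun_local countable_nat measurable_nat_set). Qed.

Let local_shrink r : local_on [:: - r%:Z] (shrink r).
Proof. by move=> x y xy; rewrite /shrink xy// inE. Qed.

Let shrink_norm r x : `|shrink r x| <= 1.
Proof. by rewrite /shrink; case: ifP => _; rewrite ger0_norm//; lra. Qed.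

(** The value is 1/2 plus half the probability [r / (r + 2)] that the symbol has size at most [r].
    The form of [size_cdf] is chosen to get this ratio, which makes the product in [mean_rest]
    telescope. *)
Let mean_shrink r : mean (bit_law R) (shrink r) = r.+1%:R / r.+2%:R.
Proof.
pose c t : R := (t == 0%N)%:R.
pose E t : set (seq_space nat int) := cylinder [:: - r%:Z] (fun=> t).
have mE t : measurable (E t) by exact: (measurable_cylinder countable_nat measurable_nat_set).
have -> : mean (bit_law R) (shrink r) =
    mean (bit_law R) (fun x : seq_space nat int => 1 / 2 + 1 / 2 * \sum_(t < (2 ^ r.+1).-1) \1_(E t) x).
  apply: eq_mean => x; rewrite /shrink.
  have sE (N : nat) : \sum_(t < N) (\1_(E t) x : R) = (x (- r%:Z) < N)%N%:R.
    elim: N => [|N IH]; first by rewrite big_ord0.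
    rewrite big_ord_recr /= IH indicE -natrD; congr _%:R.
    have -> : (x \in E N) = (x (- r%:Z) == N).
      apply/idP/eqP; rewrite inE; first by move=> /(_ (- r%:Z)) -> //; rewrite inE.
      by move=> h i; rewrite inE => /eqP ->.
    by rewrite ltnS; case: ltngtP.
  rewrite sE; have := code_range (decode (x (- r%:Z))); rewrite decodeK => /andP[h1 h2].
  set S := size _ in h1 h2 *; set v := x _ in h1 h2 *.
  have -> : (v < (2 ^ r.+1).-1)%N = (S <= r)%N.
    have p2 : (0 < 2 ^ r.+1)%N by rewrite expn_gt0.
    apply/idP/idP => h.
      rewrite leqNgt; apply/negP => rS.
      have : (2 ^ r.+1 <= 2 ^ S)%N by rewrite leq_exp2l.
      lia.
    have : (2 ^ S.+1 <= 2 ^ r.+1)%N by rewrite leq_exp2l.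
    lia.
  by case: ltnP => _ /=; lra.
have bE t : bounded_mfun (\1_(E t) : seq_space nat int -> R) by exact: bounded_mfun_indic.
have bS : bounded_mfun (fun x : seq_space nat int => \sum_(t < (2 ^ r.+1).-1) (\1_(E t) x : R)).
  by apply: bounded_mfun_sum => t.
rewrite meanD; [|exact: bounded_mfun_cst|exact: bounded_mfunZ].
rewrite mean_cst meanZ// mean_sum//.
rewrite (eq_bigr (fun t : 'I_(2 ^ r.+1).-1 => symbol_weight R t)); last first.
  move=> t _; rewrite mean_indic//.
  by have := bit_law_cylinder R (fun=> nat_of_ord t) (isT : uniq [:: - r%:Z]); rewrite /E big_seq1 => ->.
rewrite sum_symbol_weight /size_cdf /= -[r.+2]addn2 -[r.+1]addn1 !natrD.
by field; rewrite -natrD pnatr_eq0 addn2.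
Qed.

Let rest (n m : nat) (x : int -> nat) : R := \prod_(m <= r < n) shrink r x.

Let local_rest n m : local_on [seq - r%:Z | r <- iota 0 n] (rest n m).
Proof.
move=> x y xy; rewrite /rest !big_seq; apply: eq_bigr => r; rewrite mem_index_iota => /andP[_ rn].
apply: local_shrink => i; rewrite inE => /eqP ->; apply: xy; apply/mapP.
by exists r => //; rewrite mem_iota.
Qed.

Let rest_norm n m x : `|rest n m x| <= 1.
Proof.
rewrite /rest; elim/big_ind: _ => [|a b a1 b1|r _]; rewrite ?normr1//.
by rewrite normrM mulr_ile1.
Qed.

Let mean_indep J j (f h : (int -> nat) -> R) M N : j \notin J ->
  local_on J f -> local_on [:: j] h -> (forall x, `|f x| <= M) -> (forall x, `|h x| <= N) ->
  mean (bit_law R) (fun x => f x * h x) = mean (bit_law R) f * mean (bit_law R) h.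
Proof.
move=> jJ fJ hj fM hN; have bf := blocal fJ fM; have bh := blocal hj hN.
rewrite (resample countable_nat measurable_nat_set (bit_law_iid R) j (bounded_mfunM bf bh)).
transitivity (mean (bit_law R) (fun x : seq_space nat int => mean (bit_law R) h * f x)).
  apply: eq_mean => x; rewrite mulrC -meanZ//; apply: eq_mean => y.
  rewrite (@local_on_upd _ _ _ _ _ _ _ _ fJ jJ); congr (_ * _); apply: hj => i.
  by rewrite inE => /eqP ->; rewrite updE.
by rewrite meanZ// mulrC.
Qed.

Let mean_rest n : mean (bit_law R) (rest n 0) = n.+1%:R^-1.
Proof.
elim: n => [|n IH].
  rewrite invr1 -[RHS](mean_cst (bit_law R)); apply: eq_mean => x.
  by rewrite /rest big_geq.
rewrite (@eq_mean _ _ _ _ _ (fun x : seq_space nat int => rest n 0 x * shrink n x)); last first.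
  by move=> x; rewrite /rest big_nat_recr.
rewrite (mean_indep _ (@local_rest n 0) (@local_shrink n) (rest_norm n 0) (shrink_norm n)).
  by rewrite IH mean_shrink mulrA mulVf ?mul1r// pnatr_eq0.
by apply/negP => /mapP[q]; rewrite mem_iota => /andP[_ qn] e; lia.
Qed.

Variables (J : seq int) (g tau : (int -> nat) -> R) (n : nat).
Hypotheses (gJ : local_on J g) (tauJ : local_on J tau).
Hypotheses (g1 : forall x, `|g x| <= 1) (tau01 : forall x, 0 <= tau x <= 1).
Hypothesis gflip : forall r x, (r <= n)%N -> g (flip (- r%:Z) r x) = g x.
Hypothesis tauflip : forall r x, (r <= n)%N -> tau (flip (- r%:Z) r x) = tau x.

Let J' := J ++ [seq - r%:Z | r <- iota 0 n.+1].

Let local_dyadic m : (m <= n.+1)%N -> local_on J' (fun x => dyadic R x 0 m).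
Proof.
move=> mn x y xy; apply: dyadic_local => i /mapP[r]; rewrite mem_iota add0n => /andP[_ rm] ->.
apply: xy; rewrite mem_cat; apply/orP; right; apply/mapP; exists r; last by lia.
by rewrite mem_iota; lia.
Qed.

Let localJ' (Y : Type) (f : (int -> nat) -> Y) : local_on J f -> local_on J' f.
Proof. by apply: local_on_sub => i iJ; rewrite mem_cat iJ. Qed.

Let dyadicS x m : dyadic R x 0 m.+1 =
  if (m < size (decode (x (- m%:Z))))%N then
    ((dyadic R x 0 m).1 + (nth false (decode (x (- m%:Z))) m)%:R * ((dyadic R x 0 m).2 / 2),
     (dyadic R x 0 m).2 / 2) else dyadic R x 0 m.
Proof. by rewrite /= sub0r. Qed.

(** Flipping the bit read at lag [m] exchanges the two halves of the current interval; with no bit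
    to read, the interval stays the same and counts twice. *)
Let split_sum (q : R -> R -> R -> R) x m t :
  q (dyadic R x 0 m.+1).1 (dyadic R x 0 m.+1).2 t +
    q (dyadic R (flip (- m%:Z) m x) 0 m.+1).1 (dyadic R (flip (- m%:Z) m x) 0 m.+1).2 t =
  let l := (dyadic R x 0 m).1 in let w := (dyadic R x 0 m).2 in
  if (m < size (decode (x (- m%:Z))))%N then q l (w / 2) t + q (l + w / 2) (w / 2) t
  else 2 * q l w t.
Proof.
rewrite !dyadicS size_flip (dyadic_flip0 R x (leqnn m)).
case: ifPn => ms; last by cbv zeta; rewrite [in RHS]mulr_natl mulr2n.
rewrite flipE eqxx codeK nth_flip_bit//=.
by case: (nth _ _ _); rewrite /= ?mul1r ?mul0r ?addr0// addrC.
Qed.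

Let rampf m x := g x * ramp (dyadic R x 0 m).1 (dyadic R x 0 m).2 (tau x).
Let insidef m x := inside (dyadic R x 0 m).1 (dyadic R x 0 m).2 (tau x) * rest n.+1 m x.

Let b_rampf m : (m <= n.+1)%N -> bounded_mfun (rampf m : seq_space nat int -> R).
Proof.
move=> mn; apply: (blocal (K := J') (M := 1)) => [x y xy|x].
  by rewrite /rampf (localJ' gJ xy) (localJ' tauJ xy) (local_dyadic mn xy).
by rewrite /rampf normrM mulr_ile1// ramp_norm.
Qed.

Let b_insidef m : (m <= n.+1)%N -> bounded_mfun (insidef m : seq_space nat int -> R).
Proof.
move=> mn; apply: (blocal (K := J') (M := 1)) => [x y xy|x].
  rewrite /insidef (localJ' tauJ xy) (local_dyadic mn xy); congr (_ * _).
  by apply: local_rest => i iJ; apply: xy; rewrite mem_cat iJ orbT.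
by rewrite /insidef normrM mulr_ile1// inside_norm.
Qed.

(** At lag 0 the interval is [0, 1) and the ramp is [tau] itself; averaging over the bit of each
    further lag changes nothing, by [ramp_split]. *)
Let mean_rampf m : (m <= n.+1)%N ->
  mean (bit_law R) (rampf m) = mean (bit_law R) (fun x : seq_space nat int => g x * tau x).
Proof.
elim: m => [_|m IH mn].
  apply: eq_mean => x; rewrite /rampf /= /ramp subr0 divr1; congr (_ * _).
  by have /andP[t0 t1] := tau01 x; rewrite (max_r t0) min_r.
rewrite -IH ?(ltnW mn)//; apply: (@mean_flip_avg R (- m%:Z) m); [exact: b_rampf|exact: b_rampf (ltnW mn)|].
move=> x; rewrite /rampf gflip// tauflip// -mulrDr (split_sum ramp) /= mulrCA; congr (_ * _).
by case: ifP => // _; apply: ramp_split; exact: dyadic_width_gt0.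
Qed.

(** Choosing one half of an interval halves the chance that it contains [tau], and [shrink m]
    accounts for exactly this factor. The mean of the final indicator is thereby traded for that of
    the product of all the factors. *)
Let mean_insidef m : (m <= n.+1)%N ->
  mean (bit_law R) (insidef m) = mean (bit_law R) (insidef 0).
Proof.
elim: m => [//|m IH mn].
rewrite -IH ?(ltnW mn)//; apply: (@mean_flip_avg R (- m%:Z) m); [exact: b_insidef|exact: b_insidef (ltnW mn)|].
move=> x; rewrite /insidef tauflip//.
have shrink_flip k r y : shrink k (flip (- r%:Z) r y) = shrink k y by rewrite /shrink size_flip.
have -> : rest n.+1 m.+1 (flip (- m%:Z) m x) = rest n.+1 m.+1 x.
  by rewrite /rest; apply: eq_bigr => r _.
have -> : rest n.+1 m x = shrink m x * rest n.+1 m.+1 x by rewrite /rest big_ltn.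
rewrite -mulrDl (split_sum inside) /= !mulrA; congr (_ * _); rewrite /shrink.
case: ifP => _; last by rewrite mulr1.
by rewrite inside_split ?dyadic_width_gt0//; field.
Qed.

(* Conditionally on the symbol sizes the fair bits can be resampled: the mean of
   [ramp] is then exactly that of [tau], and [tau] lies in the final interval with
   probability at most the mean [n.+2%:R^-1] of its width. *)
Lemma endpoint_error s :
  `|mean (bit_law R) (fun x : seq_space nat int =>
      g x * (endpoint s (dyadic R x 0 n.+1) <= tau x)%R%:R) -
    mean (bit_law R) (fun x : seq_space nat int => g x * tau x)| <= n.+2%:R^-1.
Proof.
rewrite -(mean_rampf (leqnn _)).
have bE : bounded_mfun (fun x : seq_space nat int =>
    g x * (endpoint s (dyadic R x 0 n.+1) <= tau x)%R%:R).
  apply: (blocal (K := J') (M := 1)) => [x y xy|x].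
    by rewrite (localJ' gJ xy) (localJ' tauJ xy) (local_dyadic (leqnn _) xy).
  rewrite normrM mulr_ile1//.
  by case: (endpoint _ _ <= _); rewrite ?normr1 ?normr0.
rewrite -meanB//; last exact: b_rampf.
apply: le_trans (mean_norm _ (bounded_mfunB bE (b_rampf (leqnn _)))) _.
apply: (le_trans (y := mean (bit_law R) (insidef n.+1))).
  apply: mean_le; [|exact: b_insidef|].
    by apply: bounded_mfun_norm; apply: bounded_mfunB => //; exact: b_rampf.
  move=> x; rewrite /rampf /insidef /rest big_geq// mulr1 -mulrBr normrM.
  rewrite -[leRHS]mul1r ler_pM//.
  have := @ramp_endpoint s (dyadic R x 0 n.+1).1 (dyadic R x 0 n.+1).2 (tau x) (dyadic_width_gt0 R x 0 n.+1).
  by rewrite -surjective_pairing.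
rewrite mean_insidef// -(mean_rest n.+1); apply: mean_le; first exact: b_insidef.
  exact: (blocal (@local_rest n.+1 0) (rest_norm n.+1 0)).
move=> x; rewrite /insidef -[leRHS]mul1r ler_wpM2r//; last first.
  by apply: le_trans (ler_norm _) (inside_norm _ _ _).
by apply: prodr_ge0 => r _; rewrite /shrink; case: ifP => // _; rewrite divr_ge0.
Qed.

End coding_step.

(** * Monotone codings *)

Lemma probability_setD0 d (T : measurableType d) (R : realType) (P : probability T R) (A B : set T) :
  measurable A -> measurable B -> B `<=` A -> P A = P B -> P (A `\` B) = 0%E.
Proof.
move=> mA mB BA AB; transitivity (P A - P B)%E.
  by rewrite measureD ?setIidr// (le_lt_trans (probability_le1 _ _))// ltry.
by rewrite AB subee// fin_num_measure.
Qed.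

Section monotone_coding.
Context (R : realType) (m : nat) (P : 'I_m.+1 -> (nat -> 'I_m.+1) -> R).
Notation A := 'I_m.+1.
Notation past := (nat -> A).
Hypotheses (Pk : is_prob_kernel P) (Pa : attractive P).

Definition tail (a : nat) (x : past) : R := \sum_(j : A | (a <= j)%N) P j x.

Lemma tail0 x : tail 0 x = 1.
Proof. by rewrite /tail -[RHS](Pk.2 x). Qed.

Lemma tail_ge0 a x : 0 <= tail a x.
Proof. by apply: sumr_ge0 => j _; have /andP[] := Pk.1 j x. Qed.

Lemma tail_anti a b x : (a <= b)%N -> tail b x <= tail a x.
Proof.
move=> ab; rewrite /tail big_mkcond [leRHS]big_mkcond; apply: ler_sum => j _.
case: (leqP b j) => [bj|_]; first by rewrite (leq_trans ab bj).
by case: ifP => // _; have /andP[] := Pk.1 j x.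
Qed.

Lemma tail_le1 a x : tail a x <= 1.
Proof. by rewrite -(tail0 x); exact: tail_anti. Qed.

Lemma tail_gt a x : (m < a)%N -> tail a x = 0.
Proof.
move=> ma; apply: big1 => j; rewrite leqNgt => /negP; case.
by have := ltn_ord j; lia.
Qed.

Lemma tail_le (a : nat) x y : past_le x y -> tail a x <= tail a y.
Proof.
move=> xy; have [am|ma] := ltnP a m.+1; first exact: (Pa (Ordinal am) xy).
by rewrite !tail_gt.
Qed.

Lemma tailB (a : A) x : P a x = tail a x - tail a.+1 x.
Proof.
rewrite /tail [X in _ = X - _](bigD1 a)//= (eq_bigl (fun j : A => (a < j)%N)) ?addrK//.
by move=> j; rewrite ltn_neqAle -val_eqE /= eq_sym andbC.
Qed.

(** The quantile coupling: for uniform [v] the letter is at least [b] with probability [tail b x],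
    and attractiveness makes it monotone in the past. *)
Definition update (v : R) (x : past) : A := [arg max_(a > ord0 | v <= tail a x) (a : nat)].

Lemma updateP v x (b : nat) : v <= 1 -> (b <= m)%N ->
  (b <= update v x)%N = (v <= tail b x).
Proof.
move=> v1 bm; rewrite /update; case: arg_maxnP => [|a va amax]; first by rewrite tail0.
apply/idP/idP => [ba|vb]; first exact: (le_trans va (tail_anti x ba)).
exact: (amax (Ordinal (bm : (b < m.+1)%N)) vb).
Qed.

Lemma update_mono v v' x x' : v <= 1 -> v' <= v -> past_le x x' ->
  (update v x <= update v' x')%N.
Proof.
move=> v1 vv xx; have um : (update v x <= m)%N by rewrite -ltnS.
rewrite (updateP _ (le_trans vv v1) um); apply: (le_trans vv).
by apply: le_trans (tail_le _ xx); rewrite -updateP.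
Qed.

Definition extremal (s : bool) : A := if s then ord_max else ord0.

Definition push (a : A) (x : past) : past := fun k => if k is k'.+1 then x k' else a.

(* The left endpoints approach the uniform variable from below and so select
   letters that are too large, to be used with the maximal past. *)
Definition level s (x : int -> nat) i n : R := endpoint s (dyadic R x i n).

Lemma level_le1 s x i n : level s x i n <= 1.
Proof.
have := dyadic_right_le1 R x i n; have := dyadic_width_gt0 R x i n.
by rewrite /level /endpoint; case: s => //; lra.
Qed.

(* The past, at time [b + t], of the chain started at time [b] from the maximal
   past ([s = true]) or the minimal one, driven by the symbols from [b] on. *)
Fixpoint chain (s : bool) (x : int -> nat) (b : int) (t : nat) : past :=
  if t is t'.+1 then
    push (update (level s x (b + t'%:Z) t'.+1) (chain s x b t')) (chain s x b t')
  else fun=> extremal s.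

(** Compares how close two letters are to [extremal s], so that the upper and lower approximations
    are treated together. *)
Definition outer (s : bool) (a b : A) : bool := if s then (b <= a)%N else (a <= b)%N.

Lemma outer_extremal s a : outer s (extremal s) a.
Proof. by rewrite /outer /extremal; case: s => //; rewrite -ltnS. Qed.

Lemma outer_refl s a : outer s a a.
Proof. by rewrite /outer; case: s. Qed.

Lemma outer_trans s : transitive (outer s).
Proof. by rewrite /outer; case: s => b a c; [move=> ba cb; exact: leq_trans cb ba|exact: leq_trans]. Qed.

Lemma level_step s x i n :
  if s then level s x i n <= level s x i n.+1 else level s x i n.+1 <= level s x i n.
Proof. by case: s; [exact: dyadic_left_mono|exact: dyadic_right_mono]. Qed.

(** An earlier start replaces the extremal initial letter by an actual one and gives every later
    site one more lag, hence a narrower interval; both changes move the chain inwards. *)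
Lemma chain_earlier s x b t k : outer s (chain s x b t k) (chain s x (b - 1) t.+1 k).
Proof.
elim: t k => [|t IH] k; first exact: outer_extremal.
case: k => [|k]; last exact: IH.
rewrite [chain s x b t.+1]/= [chain s x (b - 1) t.+2]/=.
have -> : b - 1 + t.+1%:Z = b + t%:Z by lia.
have st := level_step s x (b + t%:Z) t.+1.
move: IH st; rewrite /outer; case: s => IH st; apply: update_mono => //; exact: level_le1.
Qed.

Lemma chain_head s x b t :
  chain s x b t.+1 0 = update (level s x (b + t%:Z) t.+1) (chain s x b t).
Proof. by []. Qed.

Lemma chainS s x b t k : chain s x b t.+1 k.+1 = chain s x b t k.
Proof. by []. Qed.

Lemma chain_sandwich x b t k : (chain false x b t k <= chain true x b t k)%N.
Proof.
elim: t k => [|t IH] [|k] //; last by rewrite !chainS.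
rewrite !chain_head; apply: update_mono; [exact: level_le1| |exact: IH].
by rewrite /level /endpoint lerDl ltW// dyadic_width_gt0.
Qed.

Lemma chain_add s x b t k j : chain s x b (t + j) (k + j) = chain s x b t k.
Proof. by elim: j => [|j IH]; rewrite ?addn0// !addnS chainS. Qed.

Lemma chain_local s b t : local_on [seq b + i%:Z | i <- iota 0 t] (fun x => chain s x b t).
Proof.
elim: t => [//|t IH] x y xy /=.
have e : chain s x b t = chain s y b t.
  apply: IH => i /mapP[q]; rewrite mem_iota add0n => /andP[_ qt] ->; apply: xy.
  by apply/mapP; exists q => //; rewrite mem_iota /=; lia.
rewrite e /level; congr (push (update (endpoint s _) _) _).
apply: dyadic_local => i /mapP[q]; rewrite mem_iota add0n => /andP[_ qt] ->; apply: xy.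
apply/mapP; exists (t - q)%N; last by lia.
by rewrite mem_iota /=; lia.
Qed.

Lemma chain_shift s x b t : chain s (shift_seq x) b t = chain s x (b + 1) t.
Proof. by elim: t => [//|t IH] /=; rewrite IH /level dyadic_shift addrAC. Qed.

(** The chain up to time -1 may use the symbol at [-r], but never the bit in it reserved for site 0.
    This gives the independence of past and present that [endpoint_error] requires. *)
Lemma chain_flip s x n t r : (t <= n)%N ->
  chain s (flip (- r%:Z) r x) (- n%:Z) t = chain s x (- n%:Z) t.
Proof.
elim: t => [//|t IH] tn /=; rewrite IH ?(ltnW tn)// /level dyadic_flip//.
by apply/eqP; lia.
Qed.

Definition approximant s x (i : int) (n : nat) : A := chain s x (i - n%:Z) n.+1 0.

Lemma approximant_step s x i n : outer s (approximant s x i n) (approximant s x i n.+1).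
Proof.
have := chain_earlier s x (i - n%:Z) n.+1 0.
by rewrite (_ : i - n%:Z - 1 = i - n.+1%:Z)//; lia.
Qed.

Lemma approximant_outer s x i n k : (n <= k)%N ->
  outer s (approximant s x i n) (approximant s x i k).
Proof.
elim: k => [|k IH]; first by rewrite leqn0 => /eqP ->; exact: outer_refl.
rewrite leq_eqVlt => /predU1P[->|nk]; first exact: outer_refl.
exact: outer_trans (IH nk) (approximant_step s x i k).
Qed.

Let rank s (a : A) : nat := if s then a : nat else (m - a)%N.

Let rank_le s a b : outer s a b -> (rank s b <= rank s a)%N.
Proof. by rewrite /outer /rank; case: s => // ab; rewrite leq_sub2l. Qed.

Let rank_inj s : injective (rank s).
Proof.
move=> a b; rewrite /rank; have := ltn_ord a; have := ltn_ord b => hb ha e; apply/val_inj => /=.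
by move: e; case: s; lia.
Qed.

(** A monotone sequence in a finite alphabet is eventually constant, here for every [x] and not just
    almost surely. *)
Lemma approximant_stable s x i :
  exists a, exists N, forall n, (N <= n)%N -> approximant s x i n = a.
Proof.
pose Q r := `[< exists n, rank s (approximant s x i n) = r >].
have exQ : exists r, Q r by exists (rank s (approximant s x i 0)); apply/asboolP; exists 0%N.
case: (ex_minnP exQ) => r /asboolP[N eN] min.
exists (approximant s x i N), N => n Nn; apply: (@rank_inj s); apply/eqP.
rewrite eqn_leq rank_le ?approximant_outer//= eN min//.
by apply/asboolP; exists n.
Qed.

Definition limit_coding s (x : int -> nat) : int -> A := fun i =>
  get [set a | exists N, forall n, (N <= n)%N -> approximant s x i n = a].

Lemma limit_codingP s x i :
  exists N, forall n, (N <= n)%N -> approximant s x i n = limit_coding s x i.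
Proof. exact: (@getPex _ [set a | exists N, forall n, (N <= n)%N -> approximant s x i n = a]
  (approximant_stable s x i)). Qed.

Lemma limit_coding_eq s x i a :
  (exists N, forall n, (N <= n)%N -> approximant s x i n = a) -> limit_coding s x i = a.
Proof.
move=> [N hN]; have [M hM] := limit_codingP s x i.
by rewrite -(hM (maxn M N)) ?leq_maxl// hN// leq_maxr.
Qed.

Lemma limit_coding_shift s x : limit_coding s (shift_seq x) = shift_seq (limit_coding s x).
Proof.
apply/funext => i; apply: limit_coding_eq; have [N hN] := limit_codingP s x (i + 1).
exists N => n Nn; rewrite /shift_seq -(hN n Nn) /approximant chain_shift.
by congr (chain s x _ _ _); lia.
Qed.

Lemma approximant_limit s x i n : outer s (approximant s x i n) (limit_coding s x i).
Proof.
have [N hN] := limit_codingP s x i.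
by rewrite -(hN (maxn n N)) ?leq_maxr//; apply: approximant_outer; exact: leq_maxl.
Qed.

Lemma limit_coding_sandwich x i : (limit_coding false x i <= limit_coding true x i)%N.
Proof.
have [N hN] := limit_codingP false x i; have [M hM] := limit_codingP true x i.
rewrite -(hN (maxn N M)) ?leq_maxl// -(hM (maxn N M)) ?leq_maxr//.
exact: chain_sandwich.
Qed.

Lemma approximant_local s i n :
  local_on [seq i - k%:Z | k <- iota 0 n.+1] (fun x => approximant s x i n).
Proof.
move=> x y xy; rewrite /approximant (@chain_local s (i - n%:Z) n.+1 x y)// => z /mapP[q].
rewrite mem_iota add0n => /andP[_ qn] ->; apply: xy; apply/mapP; exists (n - q)%N; last by lia.
by rewrite mem_iota /=; lia.
Qed.

Lemma measurable_limit_coding s :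
  measurable_fun setT (limit_coding s : seq_space nat int -> seq_space A int).
Proof.
apply: measurable_seqP => i _ B _; rewrite setTI.
have -> : (fun x : seq_space nat int => limit_coding s x i) @^-1` B =
    \bigcup_N \bigcap_(n in [set n | (N <= n)%N]) [set x | B (approximant s x i n)].
  apply/seteqP; split => x /=.
    have [N hN] := limit_codingP s x i => Bx; exists N => // n /= Nn.
    by rewrite hN.
  move=> [N _ h]; have [M hM] := limit_codingP s x i.
  rewrite /preimage /= -(hM (maxn N M)) ?leq_maxr//.
  by apply: (h (maxn N M)); rewrite /= leq_maxl.
apply: bigcupT_measurable => N; apply: bigcap_measurableType => n _.
apply: (measurable_local countable_nat measurable_nat_set (J := [seq i - k%:Z | k <- iota 0 n.+1])).
by move=> x y xy /=; rewrite (approximant_local s xy).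
Qed.

Lemma chain_past_cvg s x k : exists N, forall n, (N <= n)%N ->
  chain s x (- n%:Z) n k = past_of (limit_coding s x) k.
Proof.
have [N hN] := limit_codingP s x (- (k.+1)%:Z).
exists (N + k.+1)%N => n Nn; rewrite /past_of -(hN (n - k.+1)%N); last by lia.
rewrite /approximant (_ : - (k.+1)%:Z - (n - k.+1)%N%:Z = - n%:Z); last by lia.
rewrite -(chain_add s x (- n%:Z) (n - k.+1).+1 0 k) add0n.
by congr (chain s x _ _ _); lia.
Qed.

Lemma approximant0 s x n : approximant s x 0 n =
  update (level s x 0 n.+1) (chain s x (- n%:Z) n).
Proof. by rewrite /approximant chain_head sub0r addNr. Qed.

Lemma limit_coding_left_local s x y i :
  (forall j, j <= i -> x j = y j) -> limit_coding s x i = limit_coding s y i.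
Proof.
move=> xy; apply: limit_coding_eq; have [N hN] := limit_codingP s y i.
exists N => n Nn; rewrite -(hN n Nn); apply: approximant_local => z /mapP[q _ ->].
by apply: xy; lia.
Qed.

Hypothesis Pc : continuous_kernel P.

Lemma tail_close b e : 0 < e -> exists k, forall x y : past,
  (forall i, (i < k)%N -> x i = y i) -> `|tail b x - tail b y| <= e.
Proof.
move=> e0; have e1 : 0 < e / m.+1%:R by rewrite divr_gt0.
have [k hk] := kernel_close Pk Pc e1; exists k => x y xy.
rewrite /tail -sumrB big_mkcond; apply: le_trans (ler_norm_sum _ _ _) _.
apply: (le_trans (y := \sum_(j : A) e / m.+1%:R)).
  apply: ler_sum => j _; case: ifP => _; first exact: hk.
  by rewrite normr0 ltW.
by rewrite sumr_const card_ord -[leLHS]mulr_natr divfK// pnatr_eq0.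
Qed.

Lemma bounded_mfun_tail b : bounded_mfun (tail b : seq_space A nat -> R).
Proof.
rewrite (_ : tail b = fun x => \sum_(j : A) (b <= j)%N%:R * P j x).
  by apply: bounded_mfun_sum => j; apply: bounded_mfunZ; exact: bounded_mfun_kernel.
apply/funext => x; rewrite /tail big_mkcond; apply: eq_bigr => j _.
by case: ifP => _; rewrite ?mul1r ?mul0r.
Qed.

Section coding_law.
Variable s : bool.

Definition coding_law : probability (seq_space A int) R :=
  law_image (bit_law R) (measurable_limit_coding s).

Lemma coding_law_stationary : stationary coding_law.
Proof.
move=> E mE.
change (bit_law R (limit_coding s @^-1` (@shift_seq _ A @^-1` E)) =
  bit_law R (limit_coding s @^-1` E)).
have mF : measurable (limit_coding s @^-1` E : set (seq_space nat int)).
  by rewrite -[X in measurable X]setTI; exact: measurable_limit_coding.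
rewrite -(iid_stationary countable_nat measurable_nat_set (bit_law_iid R) mF).
congr (bit_law R _); apply/seteqP; split => x; rewrite /preimage /= limit_coding_shift//.
Qed.

Let past_local n : local_on [seq - n%:Z + i%:Z | i <- iota 0 n] (fun x => chain s x (- n%:Z) n).
Proof. exact: chain_local. Qed.

Let mpast_coding : measurable_fun setT
  (fun x : seq_space nat int => past_of (limit_coding s x) : seq_space A nat).
Proof. exact: (measurableT_comp (@measurable_past_of m) (measurable_limit_coding s)). Qed.

Let near_past J x : exists N, forall n, (N <= n)%N ->
  agree J (chain s x (- n%:Z) n) (past_of (limit_coding s x)).
Proof.
elim: J => [|k J [N hN]]; first by exists 0%N => n _ i.
have [M hM] := chain_past_cvg s x k; exists (maxn N M) => n.
rewrite geq_max => /andP[Nn Mn] i; rewrite inE => /predU1P[->|]; first exact: hM.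
exact: hN.
Qed.

(** For a chain started at [-n], the letter at 0 is at least [b] exactly when the endpoint is at
    most [tail b], so [endpoint_error] bounds the gap by [n.+2%:R^-1]. Both sides pass to the limit
    by dominated convergence, the letters by stabilisation and [tail b] by continuity of the
    kernel. *)
Lemma coding_tail (b : nat) J w : (b <= m)%N ->
  mean (bit_law R) (fun x : seq_space nat int => \1_(cylinder J w) (past_of (limit_coding s x)) *
    (b <= limit_coding s x 0)%N%:R) =
  mean (bit_law R) (fun x : seq_space nat int => \1_(cylinder J w) (past_of (limit_coding s x)) *
    tail b (past_of (limit_coding s x))).
Proof.
move=> bm; set B := cylinder J w.
have lB : local_on J (\1_B : past -> R) := local_on_indic R (@local_on_cylinder _ _ J w).
have B1 y : `|(\1_B y : R)| <= 1 by rewrite indicE; case: (_ \in _); rewrite ?normr1 ?normr0.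
have b1 (c : bool) : `|c%:R : R| <= 1 by case: c; rewrite ?normr1 ?normr0.
have t1 y : `|tail b y| <= 1 by rewrite ger0_norm ?tail_ge0 ?tail_le1.
have mB : measurable (B : set (seq_space A nat)).
  exact: (measurable_cylinder (countable_alphabet m) (@measurable_alphabet m)).
have mBc : measurable_fun setT (fun x : seq_space nat int => \1_B (past_of (limit_coding s x)) : R).
  by case: (bounded_mfun_comp mpast_coding (bounded_mfun_indic R mB)).
pose f n (x : seq_space nat int) : R := \1_B (chain s x (- n%:Z) n) * (b <= approximant s x 0 n)%N%:R.
pose t n (x : seq_space nat int) : R := \1_B (chain s x (- n%:Z) n) * tail b (chain s x (- n%:Z) n).
have ft n : `|mean (bit_law R) (f n) - mean (bit_law R) (t n)| <= n.+2%:R^-1.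
  pose K := [seq - n%:Z + i%:Z | i <- iota 0 n].
  have := @endpoint_error R K (fun x => \1_B (chain s x (- n%:Z) n)) (fun x => tail b (chain s x (- n%:Z) n)) n.
  have H1 : local_on K (fun x => \1_B (chain s x (- n%:Z) n) : R) by move=> x y /past_local ->.
  have H2 : local_on K (fun x => tail b (chain s x (- n%:Z) n)) by move=> x y /past_local ->.
  move=> /(_ H1 H2 (fun x => B1 _)).
  have H3 x : 0 <= tail b (chain s x (- n%:Z) n) <= 1 by rewrite tail_ge0 tail_le1.
  move=> /(_ H3 _ _ s) h.
  rewrite [mean _ (f n)](_ : _ = mean (bit_law R) (fun x : seq_space nat int => \1_B (chain s x (- n%:Z) n) *
      (endpoint s (dyadic R x 0 n.+1) <= tail b (chain s x (- n%:Z) n))%R%:R)); last first.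
    apply: eq_mean => x; rewrite /f approximant0 (updateP _ _ bm)//.
    exact: level_le1.
  by apply: h => r x rn; rewrite chain_flip.
have mf n : measurable_fun setT (f n).
  apply: (measurable_fun_local countable_nat measurable_nat_set
    (J := [seq - n%:Z + i%:Z | i <- iota 0 n] ++ [seq 0 - k%:Z | k <- iota 0 n.+1])) => x y xy.
  rewrite /f (@past_local n x y) ?(@approximant_local s 0 n x y)//; apply: agree_sub xy => i iJ;
    by rewrite mem_cat iJ ?orbT.
have mt n : measurable_fun setT (t n).
  apply: (measurable_fun_local countable_nat measurable_nat_set
    (J := [seq - n%:Z + i%:Z | i <- iota 0 n])) => x y xy.
  by rewrite /t (past_local xy).
have f1 n x : `|f n x| <= 1 by rewrite /f normrM mulr_ile1.
have tn1 n x : `|t n x| <= 1 by rewrite /t normrM mulr_ile1.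
have mlim : measurable_fun setT (fun x : seq_space nat int => \1_B (past_of (limit_coding s x)) *
    (b <= limit_coding s x 0)%N%:R : R).
  apply: measurable_funM => //.
  have bl : measurable_fun setT (fun y : seq_space A int => (b <= y 0)%N%:R : R).
    apply: (measurable_fun_local (countable_alphabet m) (@measurable_alphabet m) (J := [:: 0])) => y z yz.
    by rewrite yz ?inE.
  exact: (measurableT_comp bl (measurable_limit_coding s)).
have mlimt : measurable_fun setT (fun x : seq_space nat int => \1_B (past_of (limit_coding s x)) *
    tail b (past_of (limit_coding s x))).
  apply: measurable_funM => //.
  by case: (bounded_mfun_comp mpast_coding (bounded_mfun_tail b)).
have cf : mean (bit_law R) (f n) @[n --> \oo] --> mean (bit_law R) (fun x : seq_space nat int =>
    \1_B (past_of (limit_coding s x)) * (b <= limit_coding s x 0)%N%:R).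
  apply: (mean_dominated mf mlim f1) => x; apply: cvg_near_cst.
  have [N hN] := near_past J x; have [M hM] := limit_codingP s x 0.
  exists (maxn N M) => // n /=; rewrite geq_max => /andP[Nn Mn].
  by rewrite /f (lB _ _ (hN n Nn)) hM.
have ct : mean (bit_law R) (t n) @[n --> \oo] --> mean (bit_law R) (fun x : seq_space nat int =>
    \1_B (past_of (limit_coding s x)) * tail b (past_of (limit_coding s x))).
  apply: (mean_dominated mt mlimt tn1) => x; apply/cvgrPdist_le => e e0.
  have [k hk] := tail_close b e0.
  have [N hN] := near_past J x; have [M hM] := near_past (iota 0 k) x.
  exists (maxn N M) => // n /=; rewrite geq_max => /andP[Nn Mn].
  rewrite /t (lB _ _ (hN n Nn)) -mulrBr normrM -[leRHS]mul1r ler_pM//.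
  by apply: hk => i ik; rewrite hM// mem_iota.
apply/eqP; rewrite -subr_eq0 -normr_le0.
have cft : `|mean (bit_law R) (f n) - mean (bit_law R) (t n)| @[n --> \oo] -->
    `|mean (bit_law R) (fun x : seq_space nat int => \1_B (past_of (limit_coding s x)) *
      (b <= limit_coding s x 0)%N%:R) - mean (bit_law R) (fun x : seq_space nat int =>
      \1_B (past_of (limit_coding s x)) * tail b (past_of (limit_coding s x)))|.
  by apply: cvg_norm; apply: cvgB.
have c0 : (n.+2%:R^-1 : R) @[n --> \oo] --> (0 : R).
  by have := @cvg_harmonic R; rewrite -cvg_shiftS.
by apply: (ler_cvg_to cft c0); near=> n; exact: ft.
Unshelve. all: by end_near.
Qed.

(** The event that the letter is [a] is a difference of two tail events, and [coding_tail] handles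
    each. *)
Lemma coding_law_compatible : compatible P coding_law.
Proof.
apply: compatible_of_cylinders => // a J w; set B := cylinder J w.
have mB : measurable (B : set (seq_space A nat)).
  exact: (measurable_cylinder (countable_alphabet m) (@measurable_alphabet m)).
have lawM (f : seq_space A int -> R) : bounded_mfun f ->
    mean coding_law f = mean (bit_law R) (f \o limit_coding s).
  exact: mean_law_image.
rewrite (lawM _ (bounded_mfunM (bounded_mfun_coord R 0 a) (bounded_mfun_past_indic R mB))).
rewrite (lawM _ (bounded_mfunM (bounded_mfun_kernel_past Pk Pc a) (bounded_mfun_past_indic R mB))).
have bBc : bounded_mfun (fun x : seq_space nat int => \1_B (past_of (limit_coding s x)) : R).
  exact: (bounded_mfun_comp mpast_coding (bounded_mfun_indic R mB)).
have bT b : bounded_mfun (fun x : seq_space nat int => \1_B (past_of (limit_coding s x)) *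
    tail b (past_of (limit_coding s x))).
  exact: (bounded_mfunM bBc (bounded_mfun_comp mpast_coding (bounded_mfun_tail b))).
have bI (b : nat) : bounded_mfun (fun x : seq_space nat int => \1_B (past_of (limit_coding s x)) *
    (b <= limit_coding s x 0)%N%:R : R).
  have bl : bounded_mfun (fun y : seq_space A int => (b <= y 0)%N%:R : R).
    apply: (bounded_mfun_local (countable_alphabet m) (@measurable_alphabet m) (J := [:: 0]) (M := 1)) => [y z yz|y].
      by rewrite yz ?inE.
    by case: (_ <= _)%N; rewrite ?normr1 ?normr0.
  exact: (bounded_mfunM bBc (bounded_mfun_comp (measurable_limit_coding s) bl)).
have key (b : nat) : mean (bit_law R) (fun x : seq_space nat int => \1_B (past_of (limit_coding s x)) *
    (b <= limit_coding s x 0)%N%:R) =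
  mean (bit_law R) (fun x : seq_space nat int => \1_B (past_of (limit_coding s x)) *
    tail b (past_of (limit_coding s x))).
  have [bm|mb] := leqP b m; first exact: coding_tail.
  apply: eq_mean => x; rewrite (tail_gt _ mb) leqNgt (leq_trans _ mb)//.
transitivity (mean (bit_law R) (fun x : seq_space nat int => \1_B (past_of (limit_coding s x)) *
    (a <= limit_coding s x 0)%N%:R - \1_B (past_of (limit_coding s x)) *
    (a < limit_coding s x 0)%N%:R)).
  apply: eq_mean => x /=; rewrite -mulrBr mulrC; congr (_ * _).
  rewrite -val_eqE /=; case: ltngtP => _; rewrite ?subrr ?subr0//.
transitivity (mean (bit_law R) (fun x : seq_space nat int => \1_B (past_of (limit_coding s x)) *
    tail a (past_of (limit_coding s x)) - \1_B (past_of (limit_coding s x)) *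
    tail a.+1 (past_of (limit_coding s x)))).
  by rewrite !meanB// !key.
by apply: eq_mean => x /=; rewrite -mulrBr mulrC tailB.
Qed.

End coding_law.

Lemma unique_finitary (mu : probability (seq_space A int) R) :
  unique_compatible_chain P -> stationary mu -> compatible P mu ->
  finitary_coding_countable_iid mu.
Proof.
move=> [nu [_ uniq_nu]] smu cmu.
have lawE s E : measurable (E : set (seq_space A int)) -> coding_law s E = mu E.
  move=> mE; rewrite (uniq_nu mu)// (uniq_nu (coding_law s))//.
    exact: coding_law_stationary.
  exact: coding_law_compatible.
(* For each [a], the event that the lower limit reaches [a] lies inside the one for the upper limit
   and has the same probability, so the difference [N a] is null; the limits differ only on the
   union of the [N a]. *)
have same0 : {ae bit_law R, forall x, limit_coding false x 0 = limit_coding true x 0}.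
  pose N a : set (seq_space nat int) :=
    [set x | (a <= limit_coding true x 0)%N /\ ~ (a <= limit_coding false x 0)%N].
  have mle (a : nat) : measurable ([set y : int -> A | (a <= y 0)%N] : set (seq_space A int)).
    apply: (measurable_local (countable_alphabet m) (@measurable_alphabet m) (J := [:: 0])) => y z yz /=.
    by rewrite yz ?inE.
  have mge s (a : nat) : measurable ([set x | (a <= limit_coding s x 0)%N] : set (seq_space nat int)).
    by rewrite -[X in measurable X]setTI; exact: (measurable_limit_coding s measurableT (mle a)).
  have N0 a : bit_law R (N a) = 0%E.
    have -> : N a = [set x | (a <= limit_coding true x 0)%N] `\` [set x | (a <= limit_coding false x 0)%N].
      by apply/seteqP; split.
    apply: probability_setD0 => //; first by move=> x /= /leq_trans; apply; exact: limit_coding_sandwich.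
    transitivity (mu [set y : int -> A | (a <= y 0)%N]); first exact: (lawE true _ (mle a)).
    exact/esym/(lawE false _ (mle a)).
  suff neg : (bit_law R).-negligible (\bigcup_a N a).
    apply: (negligibleS _ neg).
    move=> x /= ne; exists (limit_coding true x 0 : nat) => //; split => // h.
    apply: ne; apply/val_inj/eqP; rewrite /= eqn_leq h andbT; exact: limit_coding_sandwich.
  apply: negligible_bigcup => a; exists (N a); split => //.
    have -> : N a = [set x | (a <= limit_coding true x 0)%N] `\` [set x | (a <= limit_coding false x 0)%N].
      by apply/seteqP; split.
    exact: measurableD.
  exact: N0.
(* [theta] is the first time at which the two approximations meet. *)
pose good (x : int -> nat) n := approximant false x 0 n == approximant true x 0 n.
pose theta (x : int -> nat) : option nat :=
  if pselect (exists n, good x n) is left e then Some (ex_minn e) else None.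
(* Both limits are squeezed between the two approximations, which coincide at [n]. *)
have good_val x n : good x n -> limit_coding true x 0 = approximant true x 0 n.
  move=> /eqP g; apply/val_inj/eqP; rewrite /= eqn_leq.
  have := approximant_limit true x 0 n; rewrite /outer => -> /=.
  have := approximant_limit false x 0 n; rewrite /outer g => h.
  exact: (leq_trans h (limit_coding_sandwich x 0)).
have good_local n : local_on [seq 0 - k%:Z | k <- iota 0 n.+1] (good ^~ n).
  by move=> x y xy; rewrite /good (approximant_local false xy) (approximant_local true xy).
have theta_good x n : theta x = Some n -> good x n.
  by rewrite /theta; case: pselect => // e [<-]; case: ex_minnP.
exists default_measure_display; exists (nat : measurableType default_measure_display); exists (bit_law R); split => //.
- exact: countable_nat.
- exact: bit_law_iid.
(* The coding never looks to the right of the site, so the right radius is 0. *)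
exists (limit_coding true), theta, (fun=> Some 0%N); split.
- exact: measurable_limit_coding.
- exact: limit_coding_shift.
- by move=> E mE; rewrite -(lawE true).
- apply: ae_imply same0 => x e; split => //; rewrite /theta; case: pselect => // h _; apply: h.
  have [N hN] := limit_codingP false x 0; have [M hM] := limit_codingP true x 0.
  exists (maxn N M); rewrite /good hN ?leq_maxl// hM ?leq_maxr// e//.
split=> [k l|x y xy].
  have [->|l0] := eqVneq l 0%N; last first.
    have -> : [set u : int -> nat | theta u = Some k /\ Some 0%N = Some l] = set0.
      by apply/seteqP; split => // u [_ [/esym/eqP]]; rewrite (negPf l0).
    by case: (smallest_sigma_algebra setT (@coord_sets _ nat _ [set i : int | - k%:Z <= i <= l%:Z])).
  apply: (local_on_sigma countable_nat measurable_nat_set (J := [seq 0 - q%:Z | q <- iota 0 k.+1])).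
    by move=> i /mapP[q]; rewrite mem_iota add0n => /andP[_ qk] -> /=; lia.
  have thetaP x : (theta x = Some k) <-> good x k /\ forall j, (j < k)%N -> ~~ good x j.
    rewrite /theta; case: pselect => [e|ne]; last first.
      by split=> // -[g _]; exfalso; apply: ne; exists k.
    case: ex_minnP => n gn min; split=> [[<-]|[gk lt]].
      by split=> // j jn; apply/negP => /min; rewrite leqNgt jn.
    congr Some; apply/eqP; rewrite eqn_leq min//= leqNgt; apply/negP => nk.
    by move: (lt n nk); rewrite gn.
  have gl x y j : agree [seq 0 - q%:Z | q <- iota 0 k.+1] x y -> (j <= k)%N -> good x j = good y j.
    move=> xy jk; apply: good_local => i /mapP[q]; rewrite mem_iota add0n => /andP[_ qj] ->.
    by apply: xy; apply/mapP; exists q => //; rewrite mem_iota; lia.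
  have imp x y : agree [seq 0 - q%:Z | q <- iota 0 k.+1] x y -> theta x = Some k -> theta y = Some k.
    move=> xy /thetaP[gk lt]; apply/thetaP; rewrite -(gl x y)//; split => // j jk.
    by rewrite -(gl x y j xy (ltnW jk)); exact: lt.
  move=> x y xy; apply/propext; split=> -[e _]; split => //; first exact: imp xy e.
  by apply: imp e; exact: agree_sym.
case E : (theta x) => [n|] in xy.
  have gx := theta_good x n E.
  have ag : agree [seq 0 - k%:Z | k <- iota 0 n.+1] x y.
    move=> i /mapP[q]; rewrite mem_iota add0n => /andP[_ qn] ->; apply: xy.
    by rewrite /in_window; apply/andP; split; lia.
  have gy : good y n by rewrite -(good_local n x y ag).
  by rewrite (good_val x n gx) (good_val y n gy) (approximant_local true ag).
(* When [theta] is infinite the window is the whole left half-line, which determines the limit;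
   agreement is required even on this null event. *)
apply: limit_coding_left_local => j j0; apply: xy; rewrite /in_window /=; lia.
Qed.

End monotone_coding.

Theorem theorem1 (R : realType) (m : nat)
    (P : 'I_m.+1 -> (nat -> 'I_m.+1) -> R)
    (Xmax : probability (seq_space 'I_m.+1 int) R) :
  is_prob_kernel P -> attractive P -> regular_kernel P ->
  maximum_phase P Xmax ->
  (unique_compatible_chain P <-> finitary_coding_countable_iid Xmax) /\
  (finitary_coding_countable_iid Xmax <-> exponential_concentration Xmax).
Proof.
move=> Pk Pa Pr [nu [fx wl]].
have stat : stationary Xmax := weak_limit_stationary wl.
have comp : compatible P Xmax := weak_limit_compatible Pk Pr.2 fx wl.
have i12 : unique_compatible_chain P -> finitary_coding_countable_iid Xmax.
  by move=> uniq_P; exact: (unique_finitary Pk Pa Pr.2 uniq_P stat comp).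
have i23 : finitary_coding_countable_iid Xmax -> exponential_concentration Xmax.
  move=> [d [U [PU [cU dU iidU [Phi [t1 [t2 [mPhi PhiS muE tfin [tmeas tdet]]]]]]]]].
  exact: (finitary_concentration cU dU iidU mPhi PhiS muE tfin tmeas tdet).
have i31 : exponential_concentration Xmax -> unique_compatible_chain P.
  move=> conc; exists Xmax; split=> // lam slam clam.
  exact: (concentration_unique Pk Pr stat comp slam clam conc).
by split; split=> // h; [exact/i31/i23|exact/i12/i31].
Qed.
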